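(* Assume that $c_1,\dots,c_n$ are integers (with $c_i>1$), and let $r\ge2$. There is a natural bijection between the parabolic $\mathrm{SL}(r,\mathbb C)$-opers on $X$ and the equivalence classes of equivariant $\mathrm{SL}(r,\mathbb C)$-connections on $\mathrm{Sym}^{r-1}(\mathcal V)$.
   Context: SETTING. $X$ is a compact connected Riemann surface with canonical bundle $K_X$; $S=\{x_1,\dots,x_n\}\subset X$ is a set of $n\ge 1$ distinct points, and $n\ge 3$ if $X$ has genus $0$. $S$ also denotes the reduced divisor $\sum x_i$, and $F(kS):=F\otimes\mathcal O_X(kS)$. $X':=X\setminus S$. PARABOLIC BUNDLES. A parabolic bundle $E_*$ is a holomorphic vector bundle $E$ with, at each $x_i$, a filtration $E_{x_i}=E_{i,1}\supset\cdots\supset E_{i,l_i}\supset E_{i,l_i+1}=0$ and weights $0\le\alpha_{i,1}<\cdots<\alpha_{i,l_i}<1$. Equivalently it is the decreasing filtered sheaf $(E_t)_{t\in\mathbb R}$: for $0\le t<1$, $E_t\subset E$ consists of sections $s$ with $s(x_i)\in E_{i,j}$, $j$ the smallest index with $\alpha_{i,j}\ge t$ ($s(x_i)=0$ if there is none), and $E_{t+1}=E_t(-S)$. Tensor product: $(V_*\otimes W_* )_t=\sum_{a+b=t}V_a\otimes W_b$; $\mathrm{Sym}^m(E_* )_t$ is the image of $(E_*^{\otimes m})_t$ in the symmetric power (on $X'$, meromorphic along $S$). A logarithmic connection on $E$ singular over $S$ is $D:E\to E\otimes K_X(S)$ satisfying the Leibniz rule, with residue $\mathrm{Res}(D,x_i)\in\mathrm{End}(E_{x_i})$.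 A parabolic connection on $E_*$ is such a $D$ with $\mathrm{Res}(D,x_i)(E_{i,j})\subset E_{i,j}$ and with $\mathrm{Res}(D,x_i)$ acting on $E_{i,j}/E_{i,j+1}$ as multiplication by $\alpha_{i,j}$. THE PARABOLIC GUNNING BUNDLE. Fix a holomorphic line bundle $\mathcal L$ with an isomorphism $\mathcal L^{\otimes2}\cong K_X$. Let $0\to\mathcal L\to\widetilde E\xrightarrow{p_0}\mathcal L^*\to0$ be the extension with class $1\in H^1(X,\mathrm{Hom}(\mathcal L^*,\mathcal L))=H^1(X,K_X)=\mathbb C$, and $E:=p_0^{-1}(\mathcal L^*(-S))$, so $0\to\mathcal L\to E\xrightarrow{p}\mathcal L^*(-S)\to0$. For $x\in S$, the image of $\widetilde E(-S)_x\to E_x$ (induced by the inclusion $\widetilde E(-S)\subset E$) is a line mapped isomorphically by $p$ to $\mathcal L^*(-S)_x$; it is denoted $\mathcal L^*(-S)_x\subset E_x$. $E_*$ is $E$ with filtration $0\subset\mathcal L^*(-S)_{x_i}\subset E_{x_i}$, the weight of the line being $\frac{c_i+1}{2c_i+1}$ and that of $E_{x_i}$ being $\frac{c_i}{2c_i+1}$. Then $\det E_*=\mathcal O_X$ (trivial parabolic structure), hence $\det\mathrm{Sym}^{r-1}(E_* )=\mathcal O_X$. OPERS. A parabolic $\mathrm{SL}(r,\mathbb C)$-connection on $\mathrm{Sym}^{r-1}(E_* )$ is a parabolic connection inducing the trivial connection $d$ on $\det\mathrm{Sym}^{r-1}(E_* )=\mathcal O_X$. A parabolic $\mathrm{SL}(r,\mathbb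 C)$-oper on $X$ is an equivalence class of these, two being equivalent if they differ by a holomorphic automorphism of the parabolic bundle $\mathrm{Sym}^{r-1}(E_* )$. COVERING. Fix a ramified Galois covering $\varphi:Y\to X$, with Galois group $\Gamma$, unramified over $X'$ and with ramification order $2c_i+1$ at every point over $x_i$; $Y':=\varphi^{-1}(X')$. An orbifold bundle on $Y$ is a holomorphic vector bundle with a lift of the $\Gamma$-action by holomorphic bundle automorphisms. Parabolic bundles $V_*$ with weights at $x_i$ in $\frac1{2c_i+1}\mathbb Z$ correspond to orbifold bundles $\mathbb V$ by $V_t=\bigl(\varphi_*(\mathbb V\otimes\mathcal O_Y(\sum_i\lfloor -t(2c_i+1)\rfloor\,\varphi^{-1}(x_i)_{\rm red}))\bigr)^\Gamma$; in particular $\mathbb V|_{Y'}=\varphi^*(V|_{X'})$. $\mathcal V$ is the rank two orbifold bundle corresponding to $E_*$; $\mathrm{Sym}^{r-1}(\mathcal V)$ carries the induced $\Gamma$-action, and $\det\mathrm{Sym}^{r-1}(\mathcal V)=\mathcal O_Y$ equivariantly. A holomorphic connection on $\mathrm{Sym}^{r-1}(\mathcal V)$ is equivariant if it is preserved by $\Gamma$; it is an $\mathrm{SL}(r,\mathbb C)$-connection if it induces the trivial connection on $\det\mathrm{Sym}^{r-1}(\mathcal V)=\mathcal O_Y$. Two equivariant $\mathrm{SL}(r,\mathbb C)$-connections are equivalent if they differ by a $\Gamma$-equivariant holomorphic automorphism of $\mathrm{Sym}^{r-1}(\mathcal V)$. The natural bijection is induced by the parabolic–orbifold correspondence: to a parabolic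 connection $D$ on $\mathrm{Sym}^{r-1}(E_* )$ corresponds the equivariant connection on $\mathrm{Sym}^{r-1}(\mathcal V)$ whose restriction to $Y'$ is the pullback $\varphi^*(D|_{X'})$. *)

(* Defs.v *)
From HB Require Import structures.
From mathcomp Require Import all_boot all_order all_algebra all_fingroup.
From mathcomp Require Import all_classical all_reals all_analysis.
From mathcomp Require Import complex.

Set Implicit Arguments.
Unset Strict Implicit.
Unset Printing Implicit Defensive.

Import Order.TTheory GRing.Theory Num.Theory.
Import numFieldNormedType.Exports.

Local Open Scope classical_set_scope.
Local Open Scope complex_scope.
Local Open Scope ring_scope.

(** Riemann surfaces.  The library puts the topology of the complex numbers on
    the alias [R[i]^o] of [R[i]].  A chart [i] is [coord i], restricted to the
    open set [cdom i]; [icoord i] is its inverse, defined on [coord i @` cdom i]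
    and junk elsewhere.  As for Mathlib's [chartAt], a preferred chart around
    every point is part of the structure (it only serves to name bases of the
    cotangent lines). *)
Record riemannSurface (R : realType) := RiemannSurface {
  rs_top :> topologicalType;
  cidx : Type;
  cdom : cidx -> set rs_top;
  coord : cidx -> rs_top -> R[i]^o;
  icoord : cidx -> R[i]^o -> rs_top;
  chart_at : rs_top -> cidx;
  rs_hausdorff : hausdorff_space rs_top;
  cdom_open : forall i, open (cdom i);
  cimg_open : forall i, open (coord i @` cdom i);
  coordK : forall i p, cdom i p -> icoord i (coord i p) = p;
  coord_cont : forall i p, cdom i p -> {for p, continuous (coord i)};
  icoord_cont : forall i p, cdom i p ->
    {for coord i p, continuous (icoord i)};
  mem_chart_at : forall p, cdom (chart_at p) p;
  coord_compat : forall i j p, cdom i p -> cdom j p ->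
    derivable (coord j \o icoord i) (coord i p) 1
}.

(** In the predicates below the set [U] on which something is holomorphic is
    meant to be open. *)
Section HolomorphicFunctions.
Context {R : realType}.
Implicit Types X Y : riemannSurface R.

Definition holo X (U : set X) (f : X -> R[i]) : Prop :=
  forall i p, U p -> cdom i p ->
    derivable ((f : X -> R[i]^o) \o icoord i) (coord i p) 1.

Definition mholo X (U : set X) r q (M : X -> 'M[R[i]]_(r, q)) : Prop :=
  forall a b, holo U (fun p => M p a b).

Definition holo_map X Y (f : Y -> X) : Prop :=
  continuous f /\
  forall i : cidx X, holo (f @^-1` cdom i) (fun y => coord i (f y) : R[i]).

(* The coefficient of df at p on the basis d(coord (chart_at p)) of the
   cotangent line at p. *)
Definition dif X (f : X -> R[i]) (p : X) : R[i] :=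
  'D_1 ((f : X -> R[i]^o) \o icoord (chart_at p)) (coord (chart_at p) p).

(* The pullback of 1-forms along f at y, on the same bases. *)
Definition jac X Y (f : Y -> X) (y : Y) : R[i] :=
  dif (fun y' => coord (chart_at (f y)) (f y') : R[i]) y.

(* A local coordinate centred at p (meaningful near p only). *)
Definition zat X (p q : X) : R[i] :=
  (coord (chart_at p) q : R[i]) - (coord (chart_at p) p : R[i]).

(* f has ramification order e at y: z o f = w ^ e * (unit), for local
   coordinates z, w centred at f y and y. *)
Definition ram_order X Y (f : Y -> X) (y : Y) (e : nat) : Prop :=
  exists (U : set Y) (h : Y -> R[i]),
    [/\ open_nbhs y U, holo U h, h y != 0 &
        forall y', U y' -> zat (f y) (f y') = zat y y' ^+ e * h y'].

End HolomorphicFunctions.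

(** Holomorphic vector bundles.  Every fibre of a bundle of rank r is identified,
    without any compatibility between different points, with the space C^r of
    column vectors; the holomorphic structure is the datum of an atlas of
    frames.  The columns of [fmx a p] are the values at p of the frame [a], which
    is defined on [fdom a].  Sections, homomorphisms, ... are then mere functions
    on the surface.  The record is raw data, subject to [is_vbundle]. *)
Record vbundle (R : realType) (X : riemannSurface R) (r : nat) := VBundle {
  fidx : Type;
  fdom : fidx -> set X;
  fmx : fidx -> X -> 'M[R[i]]_r
}.

Section Bundles.
Context {R : realType}.
Implicit Types X Y : riemannSurface R.

Definition is_vbundle X r (B : vbundle X r) : Prop :=
  [/\ forall a : fidx B, open (fdom a),
      forall p, exists a : fidx B, fdom a p,
      forall (a : fidx B) p, fdom a p -> fmx a p \in unitmx &
      forall a b : fidx B, mholo (fdom a `&` fdom b)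
        (fun p => invmx (fmx a p) *m fmx b p)].

Definition hol_sec X r (B : vbundle X r) (U : set X)
    (s : X -> 'cV[R[i]]_r) : Prop :=
  forall a : fidx B, mholo (U `&` fdom a) (fun p => invmx (fmx a p) *m s p).

Definition is_hom X r q (B : vbundle X r) (B' : vbundle X q) (U : set X)
    (M : X -> 'M[R[i]]_(q, r)) : Prop :=
  forall (a : fidx B) (b : fidx B'),
    mholo (U `&` (fdom a `&` fdom b))
      (fun p => invmx (fmx b p) *m M p *m fmx a p).

Definition is_iso X r (B B' : vbundle X r) (U : set X)
    (M : X -> 'M[R[i]]_r) : Prop :=
  is_hom B B' U M /\ forall p, U p -> M p \in unitmx.

Definition trivial_bundle X : vbundle X 1 :=
  @VBundle R X 1 unit (fun=> setT) (fun _ _ => 1%:M).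

Definition canonical_bundle X : vbundle X 1 :=
  @VBundle R X 1 (cidx X) (@cdom R X)
    (fun i p => (dif (fun q => coord i q : R[i]) p)%:M).

(* The fibre of the dual is C^r with the dual basis. *)
Definition dual_bundle X r (B : vbundle X r) : vbundle X r :=
  VBundle (fun a : fidx B => fdom a) (fun a p => (invmx (fmx a p))^T).

Definition twist X r (B : vbundle X r) (L : vbundle X 1) : vbundle X r :=
  VBundle (fun ab : fidx B * fidx L => fdom ab.1 `&` fdom ab.2)
    (fun ab p => fmx ab.2 p 0 0 *: fmx ab.1 p).

Definition det_bundle X r (B : vbundle X r) : vbundle X 1 :=
  VBundle (fun a : fidx B => fdom a) (fun a p => (\det (fmx a p))%:M).

Definition pullback X Y r (f : Y -> X) (B : vbundle X r) : vbundle Y r :=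
  VBundle (fun a : fidx B => f @^-1` fdom a) (fun a y => fmx a (f y)).

(* Near p, s is a section of B(-k p); the value of s at p is irrelevant. *)
Definition ord_ge X r (B : vbundle X r) (p : X) (k : int)
    (s : X -> 'cV[R[i]]_r) : Prop :=
  exists (U : set X) (s' : X -> 'cV[R[i]]_r),
    [/\ open_nbhs p U, hol_sec B U s' &
        forall q, U q -> q != p -> s q = zat p q ^ k *: s' q].

(* The genus: the dimension of H^0(X, K_X). *)
Definition has_genus X (g : nat) : Prop :=
  exists w : 'I_g -> X -> 'cV[R[i]]_1,
    (forall k, hol_sec (canonical_bundle X) setT (w k)) /\
    forall eta, hol_sec (canonical_bundle X) setT eta ->
      exists! l : {ffun 'I_g -> R[i]},
        forall p, eta p = \sum_k l k *: w k p.

End Bundles.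

(** Symmetric powers of C^2: the basis vector e_0 ^ (m - j) * e_1 ^ j of
    Sym^m(C^2) is encoded as 'X ^ j, so that a vector v stands for the polynomial
    v_0 + v_1 'X and the symmetric product is the product of polynomials. *)
Section SymmetricPowers.
Context {R : realType}.
Implicit Types X : riemannSurface R.

Definition linpoly (v : 'cV[R[i]]_2) : {poly R[i]} :=
  (v 0 0)%:P + (v 1 0)%:P * 'X.

Definition symprod m (v : 'I_m -> 'cV[R[i]]_2) : 'cV[R[i]]_m.+1 :=
  \col_i (\prod_k linpoly (v k))`_i.

Definition symmx m (g : 'M[R[i]]_2) : 'M[R[i]]_m.+1 :=
  \matrix_(i, j) (linpoly (col 0 g) ^+ (m - j) * linpoly (col 1 g) ^+ j)`_i.

Definition sym_bundle X m (B : vbundle X 2) : vbundle X m.+1 :=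
  VBundle (fun a : fidx B => fdom a) (fun a p => symmx m (fmx a p)).

End SymmetricPowers.

(** Parabolic bundles over the points [x i].  [pflag P i j], for
    [j < plen P i], is the j-th step of the filtration of the fibre at [x i]
    (numbered from 0, decreasing) and [pweight P i j] is its weight. *)
Record parabolic (R : realType) (X : riemannSurface R) (n r : nat) :=
  Parabolic {
    pbundle : vbundle X r;
    plen : 'I_n -> nat;
    pflag : 'I_n -> nat -> set 'cV[R[i]]_r;
    pweight : 'I_n -> nat -> R
  }.

Section ParabolicBundles.
Context {R : realType}.
Implicit Types (X : riemannSurface R) (n r : nat).

Definition compl_pts X n (x : 'I_n -> X) : set X := [set p | forall i, p <> x i].

(* The subspace of the fibre at [x i] in which the values of the sections of E_t
   lie, for 0 <= t < 1. *)
Definition par_fibre X n r (P : parabolic X n r) (i : 'I_n) (t : R) :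
    set 'cV[R[i]]_r :=
  [set v | (exists j, [/\ (j < plen P i)%N, t <= pweight P i j,
                        forall j', (j' < j)%N -> pweight P i j' < t &
                        pflag P i j v])
         \/ ((forall j, (j < plen P i)%N -> pweight P i j < t) /\ v = 0)].

(* A filtered sheaf (V_t) inside the sheaf of sections of B over the complement
   of S is given by its stalks: [V i t s] says that near [x i] the section s,
   which need only be defined on a punctured neighbourhood, lies in V_t. *)
Definition filtration X n r :=
  'I_n -> R -> (X -> 'cV[R[i]]_r) -> Prop.

Definition filt_sec X n r (x : 'I_n -> X) (B : vbundle X r)
    (V : filtration X n r) (t : R) (U : set X) (s : X -> 'cV[R[i]]_r) : Prop :=
  hol_sec B (U `&` compl_pts x) s /\ forall i, U (x i) -> V i t s.

(* The filtered sheaf of a parabolic bundle: for t = k + t0, with k an integer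
   and 0 <= t0 < 1, E_t = E_t0(-kS). *)
Definition par_filt X n r (x : 'I_n -> X) (P : parabolic X n r) :
    filtration X n r := fun i t s =>
  exists (U : set X) (s' : X -> 'cV[R[i]]_r),
    [/\ open_nbhs (x i) U, hol_sec (pbundle P) U s',
        par_fibre P i (t - (Num.floor t)%:~R) (s' (x i)) &
        forall q, U q -> q != x i ->
          s q = zat (x i) q ^ Num.floor t *: s' q].

(* The sheaf Sym^m(V)_t: near [x i], the finite sums of symmetric products v_1 ... v_m
   with v_k in V_(t_k) and t_1 + ... + t_m = t. *)
Definition sym_filt X n (x : 'I_n -> X) m (V : filtration X n 2) :
    filtration X n m.+1 := fun i t s =>
  exists (N : nat) (tt : 'I_N -> 'I_m -> R)
         (v : 'I_N -> 'I_m -> X -> 'cV[R[i]]_2),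
    [/\ forall l, \sum_k tt l k = t,
        forall l k, V i (tt l k) (v l k) &
        exists2 U : set X, open_nbhs (x i) U &
          forall q, U q -> q != x i ->
            s q = \sum_l symprod (fun k => v l k q)].

End ParabolicBundles.

(** Connections.  A connection is an operator on germs of holomorphic sections;
    [D s p] is the value at p of D applied to the germ of s at p, expressed in the
    fibre of B ⊗ K at p, and is junk if s is not holomorphic near p. *)
Section Connections.
Context {R : realType}.
Implicit Types (X Y : riemannSurface R) (n r : nat).

Definition operator X r := (X -> 'cV[R[i]]_r) -> X -> 'cV[R[i]]_r.

(* D is a holomorphic connection on the restriction of B to the open set U0. *)
Definition is_connection X r (B : vbundle X r) (U0 : set X)
    (D : operator X r) : Prop :=
  forall U, open U -> U `<=` U0 ->
  [/\ forall s s', hol_sec B U s -> (forall p, U p -> s p = s' p) ->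
        forall p, U p -> D s p = D s' p,
      forall s, hol_sec B U s -> hol_sec (twist B (canonical_bundle X)) U (D s),
      forall s s', hol_sec B U s -> hol_sec B U s' ->
        forall p, U p -> D (fun q => s q + s' q) p = D s p + D s' p &
      forall f s, holo U f -> hol_sec B U s ->
        forall p, U p ->
          D (fun q => f q *: s q) p = dif f p *: s p + f p *: D s p].

(* theta trivializes det B over U0.  The connection induced by D on det B maps
   f_1 /\ ... /\ f_r to the sum over j of f_1 /\ ... /\ D f_j /\ ... /\ f_r;
   here f_j is the j-th column of F, and this connection is required to be d. *)
Definition det_trivial X r (B : vbundle X r) (U0 : set X) (theta : X -> R[i])
    (D : operator X r) : Prop :=
  forall U (F : X -> 'M[R[i]]_r), open U -> U `<=` U0 ->
    (forall j, hol_sec B U (fun q => col j (F q))) ->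
    forall p, U p ->
      dif (fun q => theta q * \det (F q)) p =
      theta p * \sum_j \det (\matrix_(a, b)
        (if b == j then D (fun q => col j (F q)) p a 0 else F p a b)).

(* The contraction of D s with the vector field z d/dz, for the coordinate
   z = zat p. *)
Definition log_der X r (D : operator X r) (p : X) (s : X -> 'cV[R[i]]_r) :
    X -> 'cV[R[i]]_r :=
  fun q => (zat p q / dif (fun q' => zat p q') q) *: D s q.

(* The stalk at [x i] of the union of the V_u, u > t. *)
Definition filt_gt X n r (V : filtration X n r) (i : 'I_n) (t : R)
    (s : X -> 'cV[R[i]]_r) : Prop := exists2 u, t < u & V i u s.

Definition is_weight X n r (V : filtration X n r) (i : 'I_n) (t : R) : Prop :=
  exists2 s, V i t s & ~ filt_gt V i t s.

(* D is a parabolic connection on the filtered sheaf V.  The underlying bundle is V_0; its fibre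
   at [x i] is V_0 / V_0(-x_i) = V_0 / V_1 (stalks at [x i]), whose step of weight
   t is V_t / V_1, and the residue at [x i] is the endomorphism of this fibre
   induced by [log_der D (x i)]. *)
Definition parabolic_connection X n r (x : 'I_n -> X) (B : vbundle X r)
    (V : filtration X n r) (D : operator X r) : Prop :=
  [/\ is_connection B (compl_pts x) D,
      (* D maps V_0 to V_0 ⊗ K_X(S) *)
      forall i s, V i 0 s -> V i 0 (log_der D (x i) s),
      (* the residues preserve the filtrations *)
      forall i t s, 0 <= t < 1 -> is_weight V i t -> V i t s ->
        V i t (log_der D (x i) s) &
      (* the residues act on the graded piece of weight t as t *)
      forall i t s, 0 <= t < 1 -> is_weight V i t -> V i t s ->
        filt_gt V i t (fun q => log_der D (x i) s q - t%:C *: s q)].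

(* D2 is the transform of D1 by an automorphism of B over U0 satisfying Q. *)
Definition gauge_equiv X r (B : vbundle X r) (U0 : set X)
    (Q : (X -> 'M[R[i]]_r) -> Prop) (D1 D2 : operator X r) : Prop :=
  exists A : X -> 'M[R[i]]_r,
    [/\ is_iso B B U0 A, Q A &
        forall U s, open U -> U `<=` U0 -> hol_sec B U s ->
          forall p, U p -> D2 (fun q => A q *m s q) p = A p *m D1 s p].

Definition class_of T (P : T -> Prop) (e : T -> T -> Prop) (d : T) : set T :=
  [set d' | P d' /\ e d d'].

Definition classes T (P : T -> Prop) (e : T -> T -> Prop) : set (set T) :=
  [set c | exists2 d, P d & c = class_of P e d].

End Connections.

Section Gunning.
Context {R : realType}.
Implicit Types (X : riemannSurface R) (n : nat).

(* The 1-form w, holomorphic near p except at p, is meromorphic at p with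
   residue c. *)
Definition has_residue X (w : X -> 'cV[R[i]]_1) (p : X) (c : R[i]) : Prop :=
  exists (U : set X) (N : nat) (a : nat -> R[i]) (h : X -> R[i]),
    [/\ open_nbhs p U, holo U h, a 0 = c &
        forall q, U q -> q != p ->
          w q 0 0 = (\sum_(0 <= k < N.+1) a k / zat p q ^+ k.+1 + h q)
                    * dif (fun q' => zat p q') q].

Definition short_exact X r1 r2 r3 (inc : X -> 'M[R[i]]_(r2, r1))
    (prj : X -> 'M[R[i]]_(r3, r2)) : Prop :=
  forall p,
  [/\ forall u, inc p *m u = 0 -> u = 0 :> 'cV_r1,
      forall v : 'cV_r2, prj p *m v = 0 <-> exists u, v = inc p *m u &
      forall w : 'cV_r3, exists v, w = prj p *m v].

Definition splitting X (L : vbundle X 1) (Et : vbundle X 2)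
    (prj : X -> 'M[R[i]]_(1, 2)) (U : set X) (sg : X -> 'M[R[i]]_(2, 1)) : Prop :=
  is_hom (dual_bundle L) Et U sg /\ forall p, U p -> prj p *m sg p = 1%:M.

(* The class in H^1(X, Hom(L^*, L)) = H^1(X, K_X) = C of the extension
   0 -> L -> Et -> L^* -> 0, where kappa : L^2 = K_X.  In terms of local
   splittings s_a it is the class of the cocycle s_b - s_a; subtracting a
   meromorphic global splitting s0 (holomorphic off the finite set T) exhibits it
   as the coboundary of the meromorphic cochain s_a - s0, and the isomorphism
   H^1(X, K_X) = C maps it to the sum of the residues of the latter. *)
Definition extension_class X (L : vbundle X 1) (kappa : X -> 'M[R[i]]_1)
    (Et : vbundle X 2) (inc : X -> 'M[R[i]]_(2, 1)) (prj : X -> 'M[R[i]]_(1, 2))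
    (c : R[i]) : Prop :=
  exists (T : seq X) (s0 : X -> 'M[R[i]]_(2, 1)) (res : X -> R[i]),
    [/\ uniq T, splitting L Et prj [set p | p \notin T] s0,
        forall p, p \in T -> exists (U : set X) (s1 : X -> 'M[R[i]]_(2, 1))
            (eta : X -> 'M[R[i]]_1),
          [/\ open_nbhs p U, splitting L Et prj U s1,
              forall q, U q -> q \notin T -> s1 q - s0 q = inc q *m eta q &
              has_residue (fun q => kappa q *m eta q) p (res p)] &
        \sum_(p <- T) res p = c].

(* [j] identifies E with the subsheaf p0^-1(L^*(-S)) of Et. *)
Definition is_preimage_bundle X n (x : 'I_n -> X) (Et E : vbundle X 2)
    (prj : X -> 'M[R[i]]_(1, 2)) (j : X -> 'M[R[i]]_2) : Prop :=
  is_hom E Et setT j /\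
  (forall p, compl_pts x p -> j p \in unitmx) /\
  forall U s, open U -> hol_sec Et U s ->
    ((forall i, U (x i) -> prj (x i) *m s (x i) = 0) <->
     exists2 s', hol_sec E U s' & forall p, U p -> s p = j p *m s' p).

(* The image of the fibre at p of Et(-S) in E_p, for p in S. *)
Definition gunning_line X (E : vbundle X 2) (j : X -> 'M[R[i]]_2) (p : X) :
    set 'cV[R[i]]_2 :=
  [set v | exists (U : set X) (s : X -> 'cV[R[i]]_2),
     [/\ open_nbhs p U, hol_sec E U s, j p *m s p = 0 & v = s p]].

Definition gunning_parabolic X n (x : 'I_n -> X) (c : 'I_n -> nat)
    (E : vbundle X 2) (j : X -> 'M[R[i]]_2) : parabolic X n 2 :=
  Parabolic E (fun=> 2%N)
    (fun i k => if k is 0%N then setT else gunning_line E j (x i))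
    (fun i k => if k is 0%N then (c i)%:R / (2 * c i + 1)%N%:R
                else (c i + 1)%N%:R / (2 * c i + 1)%N%:R).

(* theta is the trivialization det Et = L ⊗ L^* = O_X: for u in L and v in Et,
   theta (inc u /\ v) = <prj v, u>. *)
Definition is_det_pairing X (inc : X -> 'M[R[i]]_(2, 1))
    (prj : X -> 'M[R[i]]_(1, 2)) (theta : X -> R[i]) : Prop :=
  forall p (v : 'cV[R[i]]_2),
    theta p * \det (row_mx (inc p) v : 'M[R[i]]_2) = (prj p *m v) 0 0.

End Gunning.

Section Orbifold.
Context {R : realType}.
Implicit Types (X Y : riemannSurface R) (n r : nat).

Definition holomorphic_action (G : finGroupType) Y (act : G -> Y -> Y) : Prop :=
  [/\ forall y, act 1%g y = y,
      forall g h y, act (g * h)%g y = act g (act h y) &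
      forall g, holo_map (act g)].

Definition ramified_galois_covering X Y n (x : 'I_n -> X) (e : 'I_n -> nat)
    (f : Y -> X) (G : finGroupType) (act : G -> Y -> Y) : Prop :=
  [/\ holo_map f /\ (forall p, exists y, f y = p),
      holomorphic_action act,
      (forall g, (forall y, act g y = y) -> g = 1%g) /\
        (forall y y', f y = f y' <-> exists g, y' = act g y),
      forall y, compl_pts x (f y) -> ram_order f y 1 &
      forall y i, f y = x i -> ram_order f y (e i)].

(* [rho g y] is the lift of [act g] from the fibre at y to that at [act g y]. *)
Definition orbifold_bundle Y (G : finGroupType) (act : G -> Y -> Y) r
    (V : vbundle Y r) (rho : G -> Y -> 'M[R[i]]_r) : Prop :=
  [/\ is_vbundle V,
      forall g, is_iso V (pullback (act g) V) setT (rho g),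
      forall y, rho 1%g y = 1%:M &
      forall g h y, rho (g * h)%g y = rho g (act h y) *m rho h y].

(* s is a section on the open set W of V twisted by the sum over i of
   k i times the reduced divisor f^-1(x i). *)
Definition twisted_sec X Y n (x : 'I_n -> X) (f : Y -> X) r (V : vbundle Y r)
    (k : 'I_n -> int) (W : set Y) (s : Y -> 'cV[R[i]]_r) : Prop :=
  hol_sec V (W `&` f @^-1` compl_pts x) s /\
  forall y i, W y -> f y = x i -> ord_ge V y (- k i) s.

(* The orbifold bundle (V, rho) corresponds to the parabolic bundle with
   underlying bundle B and filtered sheaf F; Psi is the identification of
   f^* B and V off the ramification. *)
Definition par_orb_correspond X Y n (x : 'I_n -> X) (e : 'I_n -> nat)
    (f : Y -> X) (G : finGroupType) (act : G -> Y -> Y) r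
    (B : vbundle X r) (F : filtration X n r)
    (V : vbundle Y r) (rho : G -> Y -> 'M[R[i]]_r)
    (Psi : Y -> 'M[R[i]]_r) : Prop :=
  [/\ is_iso (pullback f B) V (f @^-1` compl_pts x) Psi,
      forall g y, compl_pts x (f y) -> Psi (act g y) = rho g y *m Psi y &
      forall t U s, open U ->
        (twisted_sec x f V (fun i => Num.floor (- t * (e i)%:R))
             (f @^-1` U) s /\
         (forall g y, U (f y) -> compl_pts x (f y) ->
            s (act g y) = rho g y *m s y))
        <->
        exists2 s' : X -> 'cV[R[i]]_r, filt_sec x B F t U s' &
          forall y, U (f y) -> compl_pts x (f y) -> s y = Psi y *m s' (f y)].

(* D commutes with the operators s |-> rho(g)^-1 s(g .). *)
Definition equivariant_connection Y (G : finGroupType) (act : G -> Y -> Y) r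
    (V : vbundle Y r) (rho : G -> Y -> 'M[R[i]]_r) (D : operator Y r) : Prop :=
  is_connection V setT D /\
  forall g U s, open U -> hol_sec V U s ->
    forall y, U (act g y) ->
      D (fun y' => invmx (rho g y') *m s (act g y')) y =
      jac (act g) y *: (invmx (rho g y) *m D s (act g y)).

(* The restriction of D' to f^-1(X \ S) is the pullback of D. *)
Definition pullback_connection X Y n (x : 'I_n -> X) (f : Y -> X) r
    (B : vbundle X r) (Psi : Y -> 'M[R[i]]_r)
    (D : operator X r) (D' : operator Y r) : Prop :=
  forall U s, open U -> U `<=` compl_pts x -> hol_sec B U s ->
    forall y, U (f y) ->
      D' (fun y' => Psi y' *m s (f y')) y = jac f y *: (Psi y *m D s (f y)).

End Orbifold.

(** theta trivializes the determinant of the rank two bundle; the power of it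
    used below is explained by det Sym^(r-1) = det ^ binomial(r, 2). *)
Section Opers.
Context {R : realType}.
Implicit Types (X Y : riemannSurface R) (n r : nat).

Definition par_SL_connection X n (x : 'I_n -> X) r (P : parabolic X n 2)
    (theta : X -> R[i]) (D : operator X r.-1.+1) : Prop :=
  parabolic_connection x (sym_bundle r.-1 (pbundle P))
    (sym_filt x (par_filt x P)) D /\
  det_trivial (sym_bundle r.-1 (pbundle P)) (compl_pts x)
    (fun p => theta p ^+ 'C(r, 2)) D.

Definition par_equiv X n (x : 'I_n -> X) r (P : parabolic X n 2) :
    operator X r.-1.+1 -> operator X r.-1.+1 -> Prop :=
  gauge_equiv (sym_bundle r.-1 (pbundle P)) (compl_pts x)
    (fun A => forall i t s,
       sym_filt x (par_filt x P) i t s <->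
       sym_filt x (par_filt x P) i t (fun q => A q *m s q)).

Definition par_SL_opers X n (x : 'I_n -> X) r (P : parabolic X n 2)
    (theta : X -> R[i]) : set (set (operator X r.-1.+1)) :=
  classes (par_SL_connection x P theta) (par_equiv x P).

Definition equi_SL_connection Y (G : finGroupType) (act : G -> Y -> Y) r
    (V : vbundle Y 2) (rho : G -> Y -> 'M[R[i]]_2) (theta : Y -> R[i])
    (D : operator Y r.-1.+1) : Prop :=
  equivariant_connection act (sym_bundle r.-1 V)
    (fun g y => symmx r.-1 (rho g y)) D /\
  det_trivial (sym_bundle r.-1 V) setT (fun y => theta y ^+ 'C(r, 2)) D.

Definition equi_equiv Y (G : finGroupType) (act : G -> Y -> Y) r
    (V : vbundle Y 2) (rho : G -> Y -> 'M[R[i]]_2) :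
    operator Y r.-1.+1 -> operator Y r.-1.+1 -> Prop :=
  gauge_equiv (sym_bundle r.-1 V) setT
    (fun A => forall g y,
       A (act g y) *m symmx r.-1 (rho g y) = symmx r.-1 (rho g y) *m A y).

Definition equi_SL_classes Y (G : finGroupType) (act : G -> Y -> Y) r
    (V : vbundle Y 2) (rho : G -> Y -> 'M[R[i]]_2) (theta : Y -> R[i]) :
    set (set (operator Y r.-1.+1)) :=
  classes (equi_SL_connection act V rho theta) (equi_equiv act V rho).

End Opers.

(* Main.v *)
(** Over a point with [f y = x i], the sections of weight t in Sym^m(E) are those
    whose pullback by Phi = Sym^m(Psi) vanishes to order at least t N_i at y, where
    N_i = 2 c_i + 1.  For the Gunning bundle this follows from adapted frames e of E
    and v of V with Phi e_k = w^(c_i + k) v_k, w a coordinate centred at y; that v is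
    a frame is seen on determinants, since c_i + (c_i + 1) = N_i.
    - A parabolic connection D is pulled back to the frame v: its pole N_i dw / w
      times the residue is compensated by the derivatives of the powers of w, exactly
      because the weights are the residues.
    - An equivariant connection D' descends to X \ S, holomorphic functions
      descending because the correspondence can be applied to u(f) Psi e, and it is
      logarithmic with the required residues since z d/dz is w d/dw up to a unit.
    - Gauge transformations are transported by A' = Phi A Phi^-1 off the ramification,
      and extend over it because they preserve orders of vanishing.
    Identities of sections over Y are checked off the ramification and extend by
    continuity.  The derivative of a holomorphic function is holomorphic as soon as a
    connection exists, since df s = D(f s) - f D s, so no Cauchy theory is used. *)
Require Import Defs.
From HB Require Import structures.
From mathcomp Require Import all_boot all_order all_algebra all_fingroup.
From mathcomp Require Import all_classical all_reals all_analysis.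
From mathcomp Require Import complex.
From mathcomp Require Import ring zify.
(* MathComp's vector also exports a [coord]. *)
Import Defs.

Set Implicit Arguments.
Unset Strict Implicit.
Unset Printing Implicit Defensive.

Import Order.TTheory GRing.Theory Num.Theory.
Import numFieldNormedType.Exports.

Local Open Scope classical_set_scope.
Local Open Scope complex_scope.
Local Open Scope ring_scope.

(** The passage between D and D' is treated as a relation, [pullback_connection], and not as a map:
    an [operator] is arbitrary on germs that are not holomorphic, so D does not determine D'. The
    relation is total in both directions and respects the two equivalences, which is enough for a
    bijection of classes. The order attached to a weight t is the ceiling of t N_i, written
    [- Num.floor (- t * N)]; so membership in V_t is one integral condition at each point of the
    fibre, and no quotient V_0 / V_1 is ever formed. With z d/dz = nu^-1 w d/dw and nu = N_i at y, a
    section of order k is multiplied by k / N_i up to terms of higher order; hence acting as t on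
    the graded piece means that subtracting t raises the order. The obstacle at a ramification point
    is that the adapted frame of Sym^m(E) has exponents m c_i + k, which may be N_i or more, while
    the residue condition only concerns weights in [0, 1). The frame is therefore first divided by
    powers of a coordinate of X, which leaves the exponents modulo N_i. *)

Lemma derive_comp (K : numFieldType) (U V W : normedModType K) (f : U -> V)
    (g : V -> W) (x v : U) (u : V) (a : K) :
  differentiable f x -> differentiable g (f x) -> 'D_v f x = a *: u ->
  'D_v (g \o f) x = a *: 'D_u g (f x).
Proof.
move=> df dg fE; rewrite (deriveE _ (differentiable_comp df dg)).
rewrite diff_comp //= -(deriveE _ df) fE.
by rewrite linearZ (deriveE _ dg).
Qed.

(** * Holomorphic functions and differentials *)

Section ComplexDerivative.
Context {K : numFieldType}.
Implicit Types f g : K^o -> K^o.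

Lemma is_derive_comp f g (z a b : K^o) :
  is_derive z 1 f a -> is_derive (f z) 1 g b -> is_derive z 1 (g \o f) (b * a).
Proof.
move=> [df fE] [dg gE].
have dF : differentiable f z by exact: (@derivable1_diffP _ _ f z).1.
have dG : differentiable g (f z) by exact: (@derivable1_diffP _ _ g (f z)).1.
have dGF := differentiable_comp dF dG.
apply: DeriveDef; first by exact: (@derivable1_diffP _ _ (g \o f) z).2.
have a1 : 'D_1 f z = a *: (1 : K^o) by rewrite fE; symmetry; exact: mulr1.
have := derive_comp dF dG a1; rewrite gE mulrC; exact.
Qed.

Lemma is_derive_add f g (z a b : K^o) :
  is_derive z 1 f a -> is_derive z 1 g b ->
  is_derive z 1 (fun w => f w + g w) (a + b).
Proof. by move=> fa gb; exact: is_deriveD. Qed.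

Lemma is_derive_mul f g (z a b : K^o) :
  is_derive z 1 f a -> is_derive z 1 g b ->
  is_derive z 1 (fun w => f w * g w) (a * g z + f z * b).
Proof.
move=> fa gb; have := is_deriveM fa gb.
by rewrite /GRing.scale /= addrC (mulrC (g z)).
Qed.

Lemma derivable_continuous f (z : K^o) : derivable f z 1 -> {for z, continuous f}.
Proof.
move=> df; apply: differentiable_continuous.
exact: (@derivable1_diffP _ _ f z).1.
Qed.

Lemma dnbhs_proper (z : K^o) (A : set K^o) :
  nbhs z A -> exists2 w, A w & w != z.
Proof.
move=> Az.
have pf : ProperFilter z^' by exact: Proper_dnbhs_numFieldType.
have := @filter_ex _ _ pf [set w | A w /\ w != z].
case; last by move=> w [Aw wz]; exists w.
by apply: filterS Az => w Aw wz; split.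
Qed.

End ComplexDerivative.

Section HoloAt.
Context {R : realType}.
Implicit Types X Y : riemannSurface R.

(* Holomorphy at p: a Variant, so that unification does not unfold it.  Below,
   [mhat], [fhat] and [mfhat] are the versions for matrices, 1-forms and matrices of
   1-forms, and [msec], [ksec] those for sections of B and of B ⊗ K_X. *)
Variant hat X (f : X -> R[i]) (p : X) : Prop := Hat of forall i, cdom i p ->
    derivable ((f : X -> R[i]^o) \o icoord i) (coord i p) 1.

Lemma hatP X (f : X -> R[i]) p i : hat f p -> cdom i p ->
  derivable ((f : X -> R[i]^o) \o icoord i) (coord i p) 1.
Proof. by case=> fp ip; exact: fp. Qed.

Lemma holoE X (U : set X) (f : X -> R[i]) :
  holo U f <-> forall p, U p -> hat f p.
Proof. split=> [h p Up|h i p Up ip]; last exact: hatP (h p Up) ip.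
by split=> i ip; exact: h. Qed.

Lemma cdom_nbhs X (i : cidx X) p : cdom i p -> nbhs p (cdom i).
Proof. by move=> ip; apply: open_nbhs_nbhs; split=> //; exact: cdom_open. Qed.

Lemma near_icoord X (i : cidx X) p (P : set X) : cdom i p ->
  nbhs p P -> \forall z \near coord i p, P (icoord i z).
Proof.
move=> ip Pp; have := icoord_cont ip.
rewrite /continuous_at /= => /(_ P); rewrite /= coordK //; exact.
Qed.

Lemma near_coord_icoord X (i : cidx X) p : cdom i p ->
  \forall z \near coord i p, coord i (icoord i z) = z.
Proof.
move=> ip; have : nbhs (coord i p) (coord i @` cdom i).
  by apply: open_nbhs_nbhs; split; [exact: cimg_open|exists p].
apply: filterS => z [q iq <-]; by rewrite coordK.
Qed.

(** Points of the plane are not isolated, hence neither are those of X; with this, continuity alone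
    carries identities across a ramification point. *)
Lemma near_neq X (p : X) (A : set X) : nbhs p A -> exists2 q, A q & q != p.
Proof.
move=> Ap; have ip := mem_chart_at p.
have [z [Az zE] zp] := dnbhs_proper (filterI (near_icoord ip Ap) (near_coord_icoord ip)).
exists (icoord (chart_at p) z) => //.
by apply: contra zp => /eqP zp; rewrite -zE zp.
Qed.

(** The derivative in an arbitrary chart around p; [dif] is the case of the preferred chart, which
    may change from point to point. *)
Definition cder X (i : cidx X) (f : X -> R[i]) (p : X) : R[i] :=
  'D_1 ((f : X -> R[i]^o) \o icoord i) (coord i p).

Lemma difE X (f : X -> R[i]) p : dif f p = cder (chart_at p) f p.
Proof. by []. Qed.

Lemma hat_is_derive X (f : X -> R[i]) p i : hat f p -> cdom i p ->
  is_derive (coord i p) 1 ((f : X -> R[i]^o) \o icoord i) (cder i f p).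
Proof. by move=> fp ip; apply: DeriveDef => //; exact: hatP. Qed.

Lemma near_eq_is_der (f g : R[i]^o -> R[i]^o) (z a : R[i]^o) :
  (\forall w \near z, f w = g w) -> is_derive z 1 f a -> is_derive z 1 g a.
Proof. by move=> fg; apply: near_eq_is_derive => //; exact: oner_neq0. Qed.

Lemma coord_compat_is_derive X (i k : cidx X) p : cdom i p -> cdom k p ->
  is_derive (coord i p) 1 (coord k \o icoord i) (cder i (coord k) p).
Proof. by move=> ip kp; apply: DeriveDef => //; exact: coord_compat. Qed.

(** One chart suffices: the transition functions are derivable by [coord_compat], and the chain rule
    gives the factor relating the coefficients in two charts. *)
Lemma hat_one X (f : X -> R[i]) p i (a : R[i]^o) : cdom i p ->
  is_derive (coord i p) 1 ((f : X -> R[i]^o) \o icoord i) a ->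
  hat f p /\ forall k, cdom k p -> cder k f p = a * cder k (coord i) p.
Proof.
move=> ip fa.
have key k : cdom k p ->
    is_derive (coord k p) 1 ((f : X -> R[i]^o) \o icoord k)
      (a * cder k (coord i) p).
  move=> kp; have H1 := coord_compat_is_derive kp ip.
  have H2 : is_derive ((coord i \o icoord k) (coord k p)) 1
      ((f : X -> R[i]^o) \o icoord i) a by rewrite /= coordK.
  have := is_derive_comp H1 H2.
  apply: near_eq_is_der; have := near_icoord kp (cdom_nbhs ip).
  by apply: filterS => z iz /=; rewrite coordK.
split=> [|k kp]; first by split=> k kp; have [] := key k kp.
by have [_ <-] := key k kp.
Qed.

Lemma hat_mk X (f : X -> R[i]) p (a : R[i]^o) :
  is_derive (coord (chart_at p) p) 1 ((f : X -> R[i]^o) \o icoord (chart_at p)) a ->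
  hat f p /\ dif f p = a.
Proof.
move=> fa; have [hf _] := hat_one (mem_chart_at p) fa; split => //.
by case: fa.
Qed.

Lemma hat_dif X (f : X -> R[i]) p : hat f p ->
  is_derive (coord (chart_at p) p) 1 ((f : X -> R[i]^o) \o icoord (chart_at p))
    (dif f p).
Proof. by move=> fp; apply: hat_is_derive => //; exact: mem_chart_at. Qed.

Lemma hat_near X (f g : X -> R[i]) p : (\forall q \near p, f q = g q) ->
  hat f p -> hat g p.
Proof.
move=> fg fp; suff [] : hat g p /\ dif g p = dif f p by [].
apply: hat_mk; apply: near_eq_is_der (hat_dif fp).
exact: near_icoord (mem_chart_at p) fg.
Qed.

Lemma dif_near X (f g : X -> R[i]) p : (\forall q \near p, f q = g q) ->
  hat f p -> dif f p = dif g p.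
Proof.
move=> fg fp; suff [_ ->//] : hat g p /\ dif g p = dif f p by [].
apply: hat_mk; apply: near_eq_is_der (hat_dif fp).
exact: near_icoord (mem_chart_at p) fg.
Qed.

Lemma hat_cst X (a : R[i]) (p : X) : hat (fun=> a) p.
Proof. by split=> i ip; exact: derivable_cst. Qed.

Lemma dif_cst X (a : R[i]) (p : X) : dif (fun=> a) p = 0.
Proof. exact: (@derive_cst _ R[i]^o R[i]^o a). Qed.

Lemma hat_dif_add X (f g : X -> R[i]) p : hat f p -> hat g p ->
  hat (fun q => f q + g q) p /\ dif (fun q => f q + g q) p = dif f p + dif g p.
Proof.
move=> hf hg; apply: hat_mk.
exact: (is_derive_add (hat_dif hf) (hat_dif hg)).
Qed.

Lemma hat_add X (f g : X -> R[i]) p : hat f p -> hat g p ->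
  hat (fun q => f q + g q) p.
Proof. by move=> hf hg; have [] := hat_dif_add hf hg. Qed.

Lemma dif_add X (f g : X -> R[i]) p : hat f p -> hat g p ->
  dif (fun q => f q + g q) p = dif f p + dif g p.
Proof. by move=> hf hg; have [] := hat_dif_add hf hg. Qed.

Lemma hat_dif_mul X (f g : X -> R[i]) p : hat f p -> hat g p ->
  hat (fun q => f q * g q) p /\
  dif (fun q => f q * g q) p = dif f p * g p + f p * dif g p.
Proof.
move=> hf hg; apply: hat_mk.
have := is_derive_mul (hat_dif hf) (hat_dif hg).
by rewrite /= coordK //; exact: mem_chart_at.
Qed.

Lemma hat_mul X (f g : X -> R[i]) p : hat f p -> hat g p ->
  hat (fun q => f q * g q) p.
Proof. by move=> hf hg; have [] := hat_dif_mul hf hg. Qed.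

Lemma dif_mul X (f g : X -> R[i]) p : hat f p -> hat g p ->
  dif (fun q => f q * g q) p = dif f p * g p + f p * dif g p.
Proof. by move=> hf hg; have [] := hat_dif_mul hf hg. Qed.

Lemma hat_opp X (f : X -> R[i]) p : hat f p -> hat (fun q => - f q) p.
Proof.
move=> hf; have := hat_mul (hat_cst (-1) p) hf.
by under eq_fun do rewrite mulN1r.
Qed.

Lemma hat_sub X (f g : X -> R[i]) p : hat f p -> hat g p ->
  hat (fun q => f q - g q) p.
Proof. by move=> hf hg; apply: hat_add => //; exact: hat_opp. Qed.

Lemma hat_inv X (f : X -> R[i]) p : f p != 0 -> hat f p ->
  hat (fun q => (f q)^-1) p.
Proof. move=> f0 hf; split=> i ip.
by apply: derivableV; [rewrite /= coordK|exact: hatP]. Qed.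

Lemma hat_exp X (f : X -> R[i]) p n : hat f p -> hat (fun q => f q ^+ n) p.
Proof.
move=> hf; elim: n => [|n IH]; first exact: hat_cst.
by under eq_fun do rewrite exprS; exact: hat_mul.
Qed.

Lemma hat_expz X (f : X -> R[i]) p (n : int) : f p != 0 -> hat f p ->
  hat (fun q => f q ^ n) p.
Proof.
move=> f0 hf; case: n => n; first exact: hat_exp.
by apply: hat_inv; [rewrite expf_neq0|exact: hat_exp].
Qed.

Lemma hat_sum X I (r : seq I) (P : pred I) (F : I -> X -> R[i]) p :
  (forall i, P i -> hat (F i) p) -> hat (fun q => \sum_(i <- r | P i) F i q) p.
Proof.
move=> hF; elim: r => [|a r IH].
  by under eq_fun do rewrite big_nil; exact: hat_cst.
under eq_fun do rewrite big_cons.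
by case: (boolP (P a)) => // Pa; apply: hat_add => //; exact: hF.
Qed.

Lemma hat_prod X I (r : seq I) (P : pred I) (F : I -> X -> R[i]) p :
  (forall i, P i -> hat (F i) p) -> hat (fun q => \prod_(i <- r | P i) F i q) p.
Proof.
move=> hF; elim: r => [|a r IH].
  by under eq_fun do rewrite big_nil; exact: hat_cst.
under eq_fun do rewrite big_cons.
by case: (boolP (P a)) => // Pa; apply: hat_mul => //; exact: hF.
Qed.

Lemma hat_continuous X (f : X -> R[i]) p : hat f p ->
  {for p, continuous (f : X -> R[i]^o)}.
Proof.
move=> fp; have cp := mem_chart_at p; set i := chart_at p in cp.
have C1 := coord_cont cp.
have C2 : {for coord i p, continuous ((f : X -> R[i]^o) \o icoord i)}.
  exact: derivable_continuous (hatP fp cp).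
move=> A Ap; have : nbhs (coord i p) (((f : X -> R[i]^o) \o icoord i) @^-1` A).
  by apply: C2; rewrite /= coordK.
move=> /C1; apply: filterS2 (cdom_nbhs cp) => q iq /=.
by rewrite coordK.
Qed.

End HoloAt.

(* Conversion through the derivative of the library is prohibitively slow. *)
#[global] Opaque dif.

Section Differentials.
Context {R : realType}.
Implicit Types X Y : riemannSurface R.

Lemma near_nbhs X (p : X) (P : set X) : nbhs p P ->
  \forall q \near p, nbhs q P.
Proof. by move=> /nbhs_interior. Qed.

Lemma near_open X (p : X) (P : set X) : nbhs p P ->
  exists2 U, open_nbhs p U & U `<=` P.
Proof. by rewrite nbhsE. Qed.

Lemma hat_neq0 X (f : X -> R[i]) p : hat f p -> f p != 0 ->
  \forall q \near p, f q != 0.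
Proof.
move=> /hat_continuous fc fp.
exact: (cvgr_neq0 (f p : R[i]^o) fc fp).
Qed.

Lemma hat_coord X (i : cidx X) p : cdom i p -> hat (coord i : X -> R[i]) p.
Proof. by move=> ip; split=> k kp; exact: coord_compat. Qed.

Lemma cder_coord X (i : cidx X) p : cdom i p -> cder i (coord i) p = 1.
Proof.
move=> ip; have : is_derive (coord i p) 1 (coord i \o icoord i) (1 : R[i]^o).
  apply: near_eq_is_der (is_derive_id (coord i p) 1).
  by apply: filterS (near_coord_icoord ip) => z /= ->.
by case.
Qed.

Lemma dif_cder X (f : X -> R[i]) p i k : hat f p -> cdom i p -> cdom k p ->
  cder k f p = cder i f p * cder k (coord i) p.
Proof.
by move=> fp ip kp; have [_ ->//] := hat_one ip (hat_is_derive fp ip).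
Qed.

Lemma dif_chart X (f : X -> R[i]) p i : hat f p -> cdom i p ->
  dif f p = cder i f p * dif (coord i) p.
Proof. by move=> fp ip; apply: dif_cder => //; exact: mem_chart_at. Qed.

(** The chain rule for the transition to the preferred chart and back exhibits an inverse. *)
Lemma dif_coord_neq0 X (i : cidx X) p : cdom i p -> dif (coord i) p != 0.
Proof.
move=> ip; have cp := mem_chart_at p.
have := dif_cder (hat_coord cp) ip cp; rewrite (cder_coord cp) => /esym E.
by apply/eqP => d0; move: E; rewrite -difE d0 mulr0 => /esym/eqP; rewrite oner_eq0.
Qed.

Lemma cderE X (f : X -> R[i]) p i : hat f p -> cdom i p ->
  cder i f p = dif f p / dif (coord i) p.
Proof.
by move=> fp ip; rewrite (dif_chart fp ip) mulfK //; exact: dif_coord_neq0.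
Qed.

Lemma zatpp X (p : X) : zat p p = 0.
Proof. exact: subrr. Qed.

Lemma dif_subc X (f : X -> R[i]) (a : R[i]) p : hat f p ->
  dif (fun q => f q - a) p = dif f p.
Proof.
move=> hf; have /= := dif_add hf (hat_cst (- a) p).
by rewrite dif_cst addr0.
Qed.

Lemma near_zat X (p : X) : \forall q \near p, [/\ hat (zat p) q,
  dif (zat p) q != 0 & q != p -> zat p q != 0].
Proof.
have cp := mem_chart_at p; apply: filterS (cdom_nbhs cp) => q cq.
have hq := hat_sub (hat_coord cq) (hat_cst (coord (chart_at p) p : R[i]) q).
split=> //.
  by rewrite /zat (dif_subc _ (hat_coord cq)); exact: dif_coord_neq0.
apply: contraNneq => /eqP; rewrite /zat subr_eq0 => /eqP E.
by rewrite -(coordK cq) E coordK.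
Qed.

Lemma hat_zat X (p : X) : hat (zat p) p.
Proof. by have [] := nbhs_singleton (near_zat p). Qed.

Lemma dif_zat X (p : X) : dif (zat p) p = 1.
Proof.
have cp := mem_chart_at p.
by rewrite /zat (dif_subc _ (hat_coord cp)) difE cder_coord.
Qed.

Lemma dif_sum X I (r : seq I) (F : I -> X -> R[i]) p :
  (forall i, hat (F i) p) ->
  dif (fun q => \sum_(i <- r) F i q) p = \sum_(i <- r) dif (F i) p.
Proof.
move=> hF; elim: r => [|a r IH].
  by rewrite big_nil; under eq_fun do rewrite big_nil; rewrite dif_cst.
rewrite big_cons -IH -dif_add; [|exact: hF|by apply: hat_sum => i _; exact: hF].
by congr (dif _ _); apply/funext => q; rewrite big_cons.
Qed.

(** If the values at p differed, the difference would stay nonzero nearby by continuity, against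
    [near_neq]. *)
Lemma hat_eq_punctured X (f g : X -> R[i]) p : hat f p -> hat g p ->
  (\forall q \near p, q != p -> f q = g q) -> f p = g p.
Proof.
move=> hf hg fg; apply/eqP; rewrite -subr_eq0; apply/negPn/negP => h0.
have := hat_neq0 (hat_sub hf hg) h0.
move=> /(filterI fg) /near_neq [q [Eq]] + qp.
by rewrite Eq // subrr eqxx.
Qed.

Section Comp.
Variables (X Y : riemannSurface R) (f : Y -> X).
Hypothesis fh : holo_map f.

Lemma holo_map_cont y (P : set X) : nbhs (f y) P -> \forall y' \near y, P (f y').
Proof. by have [fc _] := fh => /(fc y). Qed.

Lemma hat_coord_comp y i : cdom i (f y) ->
  hat (fun y' => coord i (f y') : R[i]) y.
Proof. by have [_ /(_ i)/holoE H] := fh => ip; exact: H. Qed.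

Lemma comp_hat_dif y (g : X -> R[i]) : hat g (f y) ->
  hat (fun y' => g (f y')) y /\
  dif (fun y' => g (f y')) y = jac f y * dif g (f y).
Proof.
move=> gp; have cp := mem_chart_at (f y); have cy := mem_chart_at y.
apply: hat_mk; rewrite mulrC.
have H1 := hat_dif (hat_coord_comp cp).
have H2 : is_derive (((fun y' => coord (chart_at (f y)) (f y')) \o
    icoord (chart_at y)) (coord (chart_at y) y)) 1
    ((g : X -> R[i]^o) \o icoord (chart_at (f y))) (dif g (f y)).
  by rewrite [X in is_derive X]/= (coordK cy); exact: hat_dif.
apply: near_eq_is_der (is_derive_comp H1 H2).
apply: filterS (near_icoord cy (holo_map_cont (cdom_nbhs cp))) => z iz /=.
by rewrite coordK.
Qed.

Lemma hat_comp y (g : X -> R[i]) : hat g (f y) -> hat (fun y' => g (f y')) y.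
Proof. by move=> /comp_hat_dif[]. Qed.

Lemma dif_comp y (g : X -> R[i]) : hat g (f y) ->
  dif (fun y' => g (f y')) y = jac f y * dif g (f y).
Proof. by move=> /comp_hat_dif[]. Qed.

End Comp.

Lemma jac_comp X Y (Z : riemannSurface R) (f : Y -> X) (g : Z -> Y) (z : Z) :
  holo_map f -> holo_map g -> jac (f \o g) z = jac g z * jac f (g z).
Proof.
move=> fh gh; rewrite {1}/jac /=; apply: (dif_comp gh).
by apply: hat_coord_comp => //; exact: mem_chart_at.
Qed.

End Differentials.

(** * Matrices of holomorphic functions *)

HB.lock Definition mdif (R : realType) (X : riemannSurface R) r q
    (M : X -> 'M[R[i]]_(r, q)) (p : X) : 'M[R[i]]_(r, q) :=
  \matrix_(a, b) dif (fun z => M z a b) p.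

Section Matrices.
Context {R : realType}.
Implicit Types X Y : riemannSurface R.

Variant mhat X r q (M : X -> 'M[R[i]]_(r, q)) (p : X) : Prop :=
  MHat of forall a b, hat (fun p => M p a b) p.

Lemma mhatP X r q (M : X -> 'M[R[i]]_(r, q)) p a b :
  mhat M p -> hat (fun p => M p a b) p.
Proof. by case=> H; exact: H. Qed.

Lemma mholoE X (U : set X) r q (M : X -> 'M[R[i]]_(r, q)) :
  mholo U M <-> forall p, U p -> mhat M p.
Proof.
split=> [h p Up|h a b]; first by split=> a b; exact: ((holoE _ _).1 (h a b)).
by apply/holoE => p /h/mhatP.
Qed.

Lemma mhat_near X r q (M N : X -> 'M[R[i]]_(r, q)) p :
  (\forall q \near p, M q = N q) -> mhat M p -> mhat N p.
Proof.
move=> MN [h]; split=> a b; apply: hat_near (h a b).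
by apply: filterS MN => z ->.
Qed.

Lemma mhat_cst X r q (M : 'M[R[i]]_(r, q)) (p : X) : mhat (fun=> M) p.
Proof. by split=> a b; exact: hat_cst. Qed.

Lemma mhat_add X r q (M N : X -> 'M[R[i]]_(r, q)) p : mhat M p -> mhat N p ->
  mhat (fun z => M z + N z) p.
Proof.
move=> [hM] [hN]; split=> a b; have := hat_add (hM a b) (hN a b).
by under [X in _ -> hat X _]eq_fun do rewrite mxE.
Qed.

Lemma mhat_scale X r q (f : X -> R[i]) (M : X -> 'M[R[i]]_(r, q)) p :
  hat f p -> mhat M p -> mhat (fun z => f z *: M z) p.
Proof.
move=> hf [hM]; split=> a b; have := hat_mul hf (hM a b).
by under [X in _ -> hat X _]eq_fun do rewrite mxE.
Qed.

Lemma mhat_mul X r q s (M : X -> 'M[R[i]]_(r, q)) (N : X -> 'M[R[i]]_(q, s)) p :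
  mhat M p -> mhat N p -> mhat (fun z => M z *m N z) p.
Proof.
move=> [hM] [hN]; split=> a b; under [X in hat X _]eq_fun do rewrite mxE.
by apply: hat_sum => k _; exact: hat_mul.
Qed.

Lemma hat_det X r (M : X -> 'M[R[i]]_r) p :
  mhat M p -> hat (fun z => \det (M z)) p.
Proof.
move=> [hM]; rewrite /determinant; apply: hat_sum => s _; apply: hat_mul.
  exact: hat_cst.
by apply: hat_prod => i _.
Qed.

Lemma mhat_adj X r (M : X -> 'M[R[i]]_r) p :
  mhat M p -> mhat (fun z => \adj (M z)) p.
Proof.
move=> [hM]; split=> a b; under [X in hat X _]eq_fun do rewrite mxE.
apply: hat_mul; first exact: hat_cst.
by apply: hat_det; split=> k l; under [X in hat X _]eq_fun do rewrite !mxE.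
Qed.

Lemma near_unitmx X r (M : X -> 'M[R[i]]_r) p : mhat M p ->
  M p \in unitmx -> \forall z \near p, M z \in unitmx.
Proof.
rewrite unitmxE unitfE => /hat_det hM /(hat_neq0 hM).
by apply: filterS => z; rewrite unitmxE unitfE.
Qed.

Lemma mhat_inv X r (M : X -> 'M[R[i]]_r) p : mhat M p ->
  M p \in unitmx -> mhat (fun z => invmx (M z)) p.
Proof.
move=> hM uM; apply: (@mhat_near _ _ _ (fun z => (\det (M z))^-1 *: \adj (M z))).
  by apply: filterS (near_unitmx hM uM) => z uz; rewrite /invmx uz.
apply: mhat_scale; last exact: mhat_adj.
by apply: hat_inv; [rewrite -unitfE -unitmxE|exact: hat_det].
Qed.

Lemma mhat_comp X Y (f : Y -> X) r q (M : X -> 'M[R[i]]_(r, q)) y : holo_map f ->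
  mhat M (f y) -> mhat (fun y => M (f y)) y.
Proof. by move=> fh [hM]; split=> a b; exact: (hat_comp fh (hM a b)). Qed.

Lemma mhat_eq_punctured X r q (M N : X -> 'M[R[i]]_(r, q)) p :
  mhat M p -> mhat N p ->
  (\forall q \near p, q != p -> M q = N q) -> M p = N p.
Proof.
move=> [hM] [hN] MN; apply/matrixP => a b.
apply: (hat_eq_punctured (hM a b) (hN a b)).
by apply: filterS MN => z + zp => /(_ zp) ->.
Qed.

Lemma mdifE X r q (M : X -> 'M[R[i]]_(r, q)) p a b :
  mdif M p a b = dif (fun z => M z a b) p.
Proof. by rewrite mdif.unlock mxE. Qed.

Lemma mdif_near X r q (M N : X -> 'M[R[i]]_(r, q)) p :
  (\forall q \near p, M q = N q) -> mhat M p -> mdif M p = mdif N p.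
Proof.
move=> MN [hM]; apply/matrixP => a b; rewrite 2!mdifE; apply: dif_near; last exact: hM.
by apply: filterS MN => z ->.
Qed.

Lemma mdif_mul X r q s (M : X -> 'M[R[i]]_(r, q)) (N : X -> 'M[R[i]]_(q, s)) p :
  mhat M p -> mhat N p ->
  mdif (fun z => M z *m N z) p = mdif M p *m N p + M p *m mdif N p.
Proof.
move=> [hM] [hN]; apply/matrixP => a b; rewrite mdifE [RHS]mxE.
under [X in dif X _]eq_fun do rewrite mxE.
rewrite [X in X + _]mxE [X in _ + X]mxE dif_sum; last by move=> k; exact: hat_mul.
rewrite -big_split; apply: eq_bigr => k _ /=.
by rewrite (dif_mul (hM a k) (hN k b)) 2!mdifE.
Qed.

Lemma mdif_add X r q (M N : X -> 'M[R[i]]_(r, q)) p : mhat M p -> mhat N p ->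
  mdif (fun z => M z + N z) p = mdif M p + mdif N p.
Proof.
move=> [hM] [hN]; apply/matrixP => a b; rewrite mdifE [RHS]mxE 2!mdifE.
rewrite -(dif_add (hM a b) (hN a b)).
by have -> : (fun z => (M z + N z) a b) = (fun z => M z a b + N z a b);
  first by apply/funext => z; rewrite mxE.
Qed.

Lemma mdif_scale X r q (f : X -> R[i]) (M : X -> 'M[R[i]]_(r, q)) p :
  hat f p -> mhat M p ->
  mdif (fun z => f z *: M z) p = dif f p *: M p + f p *: mdif M p.
Proof.
move=> hf [hM]; apply/matrixP => a b; rewrite mdifE [RHS]mxE [X in X + _]mxE.
rewrite [X in _ + X]mxE mdifE -(dif_mul hf (hM a b)).
by have -> : (fun z => (f z *: M z) a b) = (fun z => f z * M z a b);
  first by apply/funext => z; rewrite mxE.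
Qed.

Lemma mdif_cst X r q (M : 'M[R[i]]_(r, q)) (p : X) : mdif (fun=> M) p = 0.
Proof. by apply/matrixP => a b; rewrite mdifE mxE dif_cst. Qed.

Lemma mdif_comp X Y (f : Y -> X) r q (M : X -> 'M[R[i]]_(r, q)) y : holo_map f ->
  mhat M (f y) -> mdif (fun y => M (f y)) y = jac f y *: mdif M (f y).
Proof.
move=> fh [hM]; apply/matrixP => a b; rewrite mdifE mxE mdifE.
exact: (dif_comp fh (hM a b)).
Qed.

End Matrices.

(** * Holomorphic 1-forms *)

Section Forms.
Context {R : realType}.
Implicit Types X Y : riemannSurface R.

(** The one consequence of Cauchy's theory that is used. It is carried as a hypothesis and supplied
    at the end by [conn_deriv_holo], from the connection at hand. *)
Definition deriv_holo : Prop := forall (f : R[i]^o -> R[i]^o) (z : R[i]^o),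
  (\forall w \near z, derivable f w 1) -> derivable (fun w => 'D_1 f w) z 1.

(* A function stands for a 1-form through the bases d(coord (chart_at p)). *)
Variant fhat X (w : X -> R[i]) (p : X) : Prop :=
  FHat of forall i, cdom i p -> hat (fun q => w q / dif (coord i) q) p.

Lemma fhatP X (w : X -> R[i]) p i : fhat w p -> cdom i p ->
  hat (fun q => w q / dif (coord i) q) p.
Proof. by case=> H; exact: H. Qed.

Lemma fhat_near X (f g : X -> R[i]) p : (\forall q \near p, f q = g q) ->
  fhat f p -> fhat g p.
Proof.
move=> fg [h]; split=> i ip; apply: hat_near (h i ip).
by apply: filterS fg => z ->.
Qed.

Lemma fhat_add X (f g : X -> R[i]) p : fhat f p -> fhat g p ->
  fhat (fun q => f q + g q) p.
Proof.
move=> [hf] [hg]; split=> i ip.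
under [X in hat X _]eq_fun do rewrite mulrDl.
by apply: hat_add; [exact: hf|exact: hg].
Qed.

Lemma fhat_mul X (f g : X -> R[i]) p : hat f p -> fhat g p ->
  fhat (fun q => f q * g q) p.
Proof.
move=> hf [hg]; split=> i ip.
under [X in hat X _]eq_fun do rewrite -mulrA.
by apply: hat_mul => //; exact: hg.
Qed.

Lemma fhat_sum X I (r : seq I) (P : pred I) (F : I -> X -> R[i]) p :
  (forall i, P i -> fhat (F i) p) -> fhat (fun q => \sum_(i <- r | P i) F i q) p.
Proof.
move=> hF; split=> i ip; under [X in hat X _]eq_fun do rewrite mulr_suml.
by apply: hat_sum => k Pk; case: (hF k Pk) => H; exact: H.
Qed.

Lemma fhat_eq_punctured X (f g : X -> R[i]) p : fhat f p -> fhat g p ->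
  (\forall q \near p, q != p -> f q = g q) -> f p = g p.
Proof.
move=> [hf] [hg] fg; have cp := mem_chart_at p.
have /= := hat_eq_punctured (hf _ cp) (hg _ cp) _.
move=> /(_ _)/(mulIf (invr_neq0 (dif_coord_neq0 cp))); apply.
by apply: filterS fg => q + qp => /(_ qp) ->.
Qed.

Hypothesis DH : deriv_holo.

Lemma fhat_dif X (f : X -> R[i]) p : (\forall q \near p, hat f q) ->
  fhat (dif f) p.
Proof.
move=> fp; split=> i ip.
pose F : R[i]^o -> R[i]^o := (f : X -> R[i]^o) \o icoord i.
have dF : \forall w \near coord i p, derivable F w 1.
  near=> w; have <- : coord i (icoord i w) = w.
    by near: w; exact: near_coord_icoord.
  have [fz iz] : hat f (icoord i w) /\ cdom i (icoord i w).
    by near: w; exact: (near_icoord ip (filterI fp (cdom_nbhs ip))).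
  exact: hatP fz iz.
have hD : derivable ((fun w => 'D_1 F w) : R[i]^o -> R[i]^o) (coord i p) 1.
  exact: DH.
apply: (@hat_near _ _ (fun q => 'D_1 F (coord i q) : R[i])).
  apply: filterS (filterI fp (cdom_nbhs ip)) => q [fq iq].
  exact: cderE.
have H : is_derive (coord i p) 1
    (((fun q => 'D_1 F (coord i q)) : X -> R[i]^o) \o icoord i)
    ('D_1 (fun w => 'D_1 F w) (coord i p)).
  apply: near_eq_is_der (DeriveDef hD erefl).
  by apply: filterS (near_coord_icoord ip) => z /= ->.
exact: (hat_one ip H).1.
Unshelve. all: by end_near. Qed.

(** Another chart changes the coefficient by the derivative of a transition function, whose
    holomorphy comes from [deriv_holo]. *)
Lemma fhat_one X (w : X -> R[i]) p i : cdom i p ->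
  hat (fun q => w q / dif (coord i) q) p -> fhat w p.
Proof.
move=> ip h.
apply: (@fhat_near _ (fun q => w q / dif (coord i) q * dif (coord i) q)).
  apply: filterS (cdom_nbhs ip) => q iq.
  by rewrite divfK //; exact: dif_coord_neq0.
apply: fhat_mul; first exact: h.
by apply: fhat_dif; apply: filterS (cdom_nbhs ip) => q; exact: hat_coord.
Qed.

(** [jac f] alone need not be holomorphic, being taken on preferred charts that vary with the point.
    Writing w as a function times d(coord i) replaces it by the differential of coord i o f. *)
Lemma fhat_comp X Y (f : Y -> X) (w : X -> R[i]) y : holo_map f ->
  fhat w (f y) -> fhat (fun y' => jac f y' * w (f y')) y.
Proof.
move=> fh [hw]; have cp := mem_chart_at (f y); set i := chart_at (f y) in cp.
have ny := holo_map_cont fh (cdom_nbhs cp).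
apply: (@fhat_near _ (fun y' => w (f y') / dif (coord i) (f y') *
    dif (fun y' => coord i (f y')) y')).
  apply: filterS ny => z iz.
  rewrite (dif_comp fh (hat_coord iz)) mulrCA.
  by rewrite (divfK (dif_coord_neq0 iz)).
apply: fhat_mul; first exact: (hat_comp fh (hw _ cp)).
apply: fhat_dif; apply: filterS ny => z iz.
exact: (hat_comp fh (hat_coord iz)).
Qed.

End Forms.

(** * Sections and homomorphisms of bundles, read in frames *)

Section Sections.
Context {R : realType}.
Implicit Types X Y : riemannSurface R.

Variant mfhat X r q (M : X -> 'M[R[i]]_(r, q)) (p : X) : Prop :=
  MFHat of forall a b, fhat (fun p => M p a b) p.

Lemma mfhat_near X r q (M N : X -> 'M[R[i]]_(r, q)) p :
  (\forall q \near p, M q = N q) -> mfhat M p -> mfhat N p.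
Proof.
move=> MN [h]; split=> a b; apply: fhat_near (h a b).
by apply: filterS MN => z ->.
Qed.

Lemma mfhat_add X r q (M N : X -> 'M[R[i]]_(r, q)) p : mfhat M p -> mfhat N p ->
  mfhat (fun z => M z + N z) p.
Proof.
move=> [hM] [hN]; split=> a b; have := fhat_add (hM a b) (hN a b).
by under [X in _ -> fhat X _]eq_fun do rewrite mxE.
Qed.

Lemma mfhat_mull X r q s (M : X -> 'M[R[i]]_(r, q)) (N : X -> 'M[R[i]]_(q, s)) p :
  mhat M p -> mfhat N p -> mfhat (fun z => M z *m N z) p.
Proof.
move=> [hM] [hN]; split=> a b; under [X in fhat X _]eq_fun do rewrite mxE.
by apply: fhat_sum => k _; exact: fhat_mul.
Qed.

Lemma mfhat_mulr X r q s (M : X -> 'M[R[i]]_(r, q)) (N : X -> 'M[R[i]]_(q, s)) p :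
  mfhat M p -> mhat N p -> mfhat (fun z => M z *m N z) p.
Proof.
move=> [hM] [hN]; split=> a b; under [X in fhat X _]eq_fun do rewrite mxE.
apply: fhat_sum => k _; under [X in fhat X _]eq_fun do rewrite mulrC.
exact: fhat_mul.
Qed.

Lemma mfhat_scale X r q (f : X -> R[i]) (M : X -> 'M[R[i]]_(r, q)) p :
  hat f p -> mfhat M p -> mfhat (fun z => f z *: M z) p.
Proof.
move=> hf [hM]; split=> a b; have := fhat_mul hf (hM a b).
by under [X in _ -> fhat X _]eq_fun do rewrite mxE.
Qed.

Lemma mfhat_scaler X r q (f : X -> R[i]) (M : X -> 'M[R[i]]_(r, q)) p :
  fhat f p -> mhat M p -> mfhat (fun z => f z *: M z) p.
Proof.
move=> hf [hM]; split=> a b; have := fhat_mul (hM a b) hf.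
by under [X in _ -> fhat X _]eq_fun do rewrite mxE mulrC.
Qed.

Lemma mfhat_eq_punctured X r q (M N : X -> 'M[R[i]]_(r, q)) p :
  mfhat M p -> mfhat N p ->
  (\forall q \near p, q != p -> M q = N q) -> M p = N p.
Proof.
move=> [hM] [hN] MN; apply/matrixP => a b.
apply: (fhat_eq_punctured (hM a b) (hN a b)).
by apply: filterS MN => z + zp => /(_ zp) ->.
Qed.

Lemma mfhat_dif X r q (M : X -> 'M[R[i]]_(r, q)) p : @deriv_holo R ->
  (\forall q \near p, mhat M q) -> mfhat (mdif M) p.
Proof.
move=> DH hM; split=> a b; under [X in fhat X _]eq_fun do rewrite mdifE.
by apply: fhat_dif => //; apply: filterS hM => z /mhatP.
Qed.

Lemma mfhat_comp X Y (f : Y -> X) r q (M : X -> 'M[R[i]]_(r, q)) y :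
  @deriv_holo R -> holo_map f -> mfhat M (f y) ->
  mfhat (fun y' => jac f y' *: M (f y')) y.
Proof.
move=> DH fh [hM]; split=> a b; have := fhat_comp DH fh (hM a b).
by under [X in _ -> fhat X _]eq_fun do rewrite mxE.
Qed.

(* The columns of [s] are sections. *)
Variant msec X r (B : vbundle X r) q (s : X -> 'M[R[i]]_(r, q)) (p : X) : Prop :=
  MSec of forall a : fidx B, fdom a p ->
    mhat (fun z => invmx (fmx a z) *m s z) p.

Variant ksec X r (B : vbundle X r) q (s : X -> 'M[R[i]]_(r, q)) (p : X) : Prop :=
  KSec of forall a : fidx B, fdom a p ->
    mfhat (fun z => invmx (fmx a z) *m s z) p.

Definition homat X r q (B : vbundle X r) (B' : vbundle X q)
    (M : X -> 'M[R[i]]_(q, r)) (p : X) : Prop :=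
  forall a : fidx B, fdom a p -> msec B' (fun z => M z *m fmx a z) p.

Definition frame X r (B : vbundle X r) (F : X -> 'M[R[i]]_r) (p : X) : Prop :=
  msec B F p /\ F p \in unitmx.

Lemma hol_secE X r (B : vbundle X r) (U : set X) s :
  hol_sec B U s <-> forall p, U p -> msec B s p.
Proof.
split=> [h p Up|h a]; first by split=> a ap; exact: ((mholoE _ _).1 (h a)).
by apply/mholoE => p [Up ap]; have [H] := h p Up; exact: H.
Qed.

Lemma is_homE X r q (B : vbundle X r) (B' : vbundle X q) (U : set X) M :
  is_hom B B' U M <-> forall p, U p -> homat B B' M p.
Proof.
have E (a : fidx B) (b : fidx B') :
    (fun p => invmx (fmx b p) *m (M p *m fmx a p)) =
    (fun p => invmx (fmx b p) *m M p *m fmx a p).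
  by apply/funext => p; rewrite mulmxA.
split=> [h p Up a ap|h a b].
  by split=> b bp; rewrite E; exact: ((mholoE _ _).1 (h a b)).
by apply/mholoE => p [Up [ap bp]]; have [H] := h p Up a ap; rewrite -E; exact: H.
Qed.

Lemma msec_near X r (B : vbundle X r) q (s s' : X -> 'M[R[i]]_(r, q)) p :
  (\forall z \near p, s z = s' z) -> msec B s p -> msec B s' p.
Proof.
move=> ss [h]; split=> a ap; apply: mhat_near (h a ap).
by apply: filterS ss => z ->.
Qed.

Lemma ksec_near X r (B : vbundle X r) q (s s' : X -> 'M[R[i]]_(r, q)) p :
  (\forall z \near p, s z = s' z) -> ksec B s p -> ksec B s' p.
Proof.
move=> ss [h]; split=> a ap; apply: mfhat_near (h a ap).
by apply: filterS ss => z ->.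
Qed.

Lemma msec_add X r (B : vbundle X r) q (s t : X -> 'M[R[i]]_(r, q)) p :
  msec B s p -> msec B t p -> msec B (fun z => s z + t z) p.
Proof.
move=> [hs] [ht]; split=> a ap; under [X in mhat X _]eq_fun do rewrite mulmxDr.
by apply: mhat_add; [exact: hs|exact: ht].
Qed.

Lemma msec_mul X r (B : vbundle X r) q m (s : X -> 'M[R[i]]_(r, q))
    (u : X -> 'M[R[i]]_(q, m)) p :
  msec B s p -> mhat u p -> msec B (fun z => s z *m u z) p.
Proof.
move=> [hs] hu; split=> a ap; under [X in mhat X _]eq_fun do rewrite mulmxA.
by apply: mhat_mul => //; exact: hs.
Qed.

Lemma msec_scale X r (B : vbundle X r) q f (s : X -> 'M[R[i]]_(r, q)) p :
  hat f p -> msec B s p -> msec B (fun z => f z *: s z) p.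
Proof.
move=> hf [hs]; split=> a ap; under [X in mhat X _]eq_fun do rewrite -scalemxAr.
by apply: mhat_scale => //; exact: hs.
Qed.

Lemma msec_col X r (B : vbundle X r) q (s : X -> 'M[R[i]]_(r, q)) p j :
  msec B s p -> msec B (fun z => col j (s z)) p.
Proof.
move=> hs; under [X in msec _ X _]eq_fun do rewrite colE.
by apply: msec_mul => //; exact: mhat_cst.
Qed.

Lemma msec_cols X r (B : vbundle X r) q (s : X -> 'M[R[i]]_(r, q)) p :
  (forall j, msec B (fun z => col j (s z)) p) -> msec B s p.
Proof.
move=> hs; split=> a ap; split=> u v; have [H] := hs v; have /mhatP := H a ap.
move=> /(_ u 0); congr (hat _ _); apply/funext => z; rewrite !mxE.
by apply: eq_bigr => k _; rewrite mxE.
Qed.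

Lemma ksec_add X r (B : vbundle X r) q (s t : X -> 'M[R[i]]_(r, q)) p :
  ksec B s p -> ksec B t p -> ksec B (fun z => s z + t z) p.
Proof.
move=> [hs] [ht]; split=> a ap; under [X in mfhat X _]eq_fun do rewrite mulmxDr.
by apply: mfhat_add; [exact: hs|exact: ht].
Qed.

Lemma ksec_scale X r (B : vbundle X r) q f (s : X -> 'M[R[i]]_(r, q)) p :
  hat f p -> ksec B s p -> ksec B (fun z => f z *: s z) p.
Proof.
move=> hf [hs]; split=> a ap; under [X in mfhat X _]eq_fun do rewrite -scalemxAr.
by apply: mfhat_scale => //; exact: hs.
Qed.

Lemma ksec_cols X r (B : vbundle X r) q (s : X -> 'M[R[i]]_(r, q)) p :
  (forall j, ksec B (fun z => col j (s z)) p) -> ksec B s p.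
Proof.
move=> hs; split=> a ap; split=> u v; have [H] := hs v; have [K] := H a ap.
move: (K u 0); congr (fhat _ _); apply/funext => z; rewrite !mxE.
by apply: eq_bigr => k _; rewrite mxE.
Qed.

Section OneBundle.
Variables (X : riemannSurface R) (r : nat) (B : vbundle X r).
Hypothesis vB : is_vbundle B.

Lemma fmx_unit (a : fidx B) p : fdom a p -> fmx a p \in unitmx.
Proof. by have [_ _ H _] := vB; exact: H. Qed.

Lemma fdom_nbhs (a : fidx B) p : fdom a p -> nbhs p (fdom a).
Proof.
by have [H _ _ _] := vB => ap; apply: open_nbhs_nbhs; split=> //; exact: H.
Qed.

Lemma fdom_ex p : exists a : fidx B, fdom a p.
Proof. by have [_ H _ _] := vB; exact: H. Qed.

Lemma frame_fmx (a : fidx B) p : fdom a p -> frame B (fmx a) p.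
Proof.
move=> ap; split; last exact: fmx_unit.
split=> b bp; have [_ _ _ H] := vB; exact: ((mholoE _ _).1 (H b a)).
Qed.

Lemma msec_one q (s : X -> 'M[R[i]]_(r, q)) p (a : fidx B) : fdom a p ->
  mhat (fun z => invmx (fmx a z) *m s z) p -> msec B s p.
Proof.
move=> ap h; have [fa _] := frame_fmx ap.
apply: (msec_near _ (msec_mul fa h)).
apply: filterS (fdom_nbhs ap) => z az.
by rewrite mulKVmx // fmx_unit.
Qed.

Lemma frame_near F p : frame B F p -> \forall z \near p, F z \in unitmx.
Proof.
move=> [[h] uF]; have [a ap] := fdom_ex p.
have nu := near_unitmx (h a ap) _; have fu := fmx_unit ap.
rewrite unitmx_mul unitmx_inv fu uF in nu.
apply: filterS (filterI (nu isT) (fdom_nbhs ap)) => z [+ az].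
by rewrite unitmx_mul => /andP[].
Qed.

Lemma frame_msec F q (s : X -> 'M[R[i]]_(r, q)) p : frame B F p ->
  msec B s p <-> mhat (fun z => invmx (F z) *m s z) p.
Proof.
move=> fF; have nF := frame_near fF; have [[h] uF] := fF.
have [a ap] := fdom_ex p; have fu := fmx_unit ap; split=> [[hs]|hs].
  have uG : invmx (fmx a p) *m F p \in unitmx by rewrite unitmx_mul unitmx_inv fu.
  apply: (mhat_near _ (mhat_mul (mhat_inv (h a ap) uG) (hs a ap))).
  apply: filterS (filterI nF (fdom_nbhs ap)) => z [uz az].
  have vz := fmx_unit az.
  have -> : invmx (invmx (fmx a z) *m F z) = invmx (F z) *m fmx a z.
    have E : (invmx (F z) *m fmx a z) *m (invmx (fmx a z) *m F z) = 1%:M.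
      by rewrite -mulmxA mulKVmx // mulVmx.
    rewrite -[RHS]mulmx1 -(@mulmxV _ _ (invmx (fmx a z) *m F z)).
      by rewrite mulmxA E mul1mx.
    by rewrite unitmx_mul unitmx_inv vz.
  by rewrite -mulmxA mulKVmx.
have [Fs _] := fF; apply: (msec_near _ (msec_mul Fs hs)).
by apply: filterS nF => z uz; rewrite mulKVmx.
Qed.

Lemma frame_ksec F q (s : X -> 'M[R[i]]_(r, q)) p : frame B F p ->
  ksec B s p <-> mfhat (fun z => invmx (F z) *m s z) p.
Proof.
move=> fF; have nF := frame_near fF; have [[h] uF] := fF; split=> [[hs]|hs].
  have [a ap] := fdom_ex p; have fa := frame_fmx ap.
  have fas := ((frame_msec _ fF).1 fa.1).
  apply: (mfhat_near _ (mfhat_mull fas (hs a ap))).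
  apply: filterS (fdom_nbhs ap) => z az.
  by rewrite -mulmxA mulKVmx // fmx_unit.
split=> a ap; apply: (mfhat_near _ (mfhat_mull (h a ap) hs)).
by apply: filterS nF => z uz; rewrite -mulmxA mulKVmx.
Qed.

Lemma msec_eq_punctured q (s t : X -> 'M[R[i]]_(r, q)) p :
  msec B s p -> msec B t p ->
  (\forall z \near p, z != p -> s z = t z) -> s p = t p.
Proof.
move=> [hs] [ht] st; have [a ap] := fdom_ex p.
have := mhat_eq_punctured (hs a ap) (ht a ap) _.
move=> /(_ _)/(congr1 (mulmx (fmx a p))).
rewrite !mulKVmx ?fmx_unit //; apply.
by apply: filterS st => z + zp => /(_ zp) ->.
Qed.

Lemma ksec_eq_punctured q (s t : X -> 'M[R[i]]_(r, q)) p :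
  ksec B s p -> ksec B t p ->
  (\forall z \near p, z != p -> s z = t z) -> s p = t p.
Proof.
move=> [hs] [ht] st; have [a ap] := fdom_ex p.
have := mfhat_eq_punctured (hs a ap) (ht a ap) _.
move=> /(_ _)/(congr1 (mulmx (fmx a p))).
rewrite !mulKVmx ?fmx_unit //; apply.
by apply: filterS st => z + zp => /(_ zp) ->.
Qed.

(** The frame [(a, i)] of the twist is [fmx a] times the coefficient of d(coord i), and division by
    that coefficient is what [fhat] prescribes. *)
Lemma hol_sec_twistE (U : set X) s : 
  hol_sec (twist B (canonical_bundle X)) U s <-> forall p, U p -> ksec B s p.
Proof.
have E (a : fidx B) (i : cidx X) p : fdom a p -> cdom i p ->
    invmx (fmx ((a, i) : fidx (twist B (canonical_bundle X))) p) =
    (dif (coord i) p)^-1 *: invmx (fmx a p).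
  move=> ap ip; rewrite /= mxE eqxx mulr1n invmxZ //.
  by rewrite unitmxZ ?fmx_unit // unitfE dif_coord_neq0.
have H p (a : fidx B) (i : cidx X) u v : fdom a p -> cdom i p ->
  \forall z \near p, (invmx (fmx ((a, i) : fidx (twist B (canonical_bundle X))) z)
    *m s z) u v = (invmx (fmx a z) *m s z) u v / dif (coord i) z.
  move=> ap ip; apply: filterS (filterI (fdom_nbhs ap) (cdom_nbhs ip)) => z [az iz].
  by rewrite E // -scalemxAl mxE mulrC.
rewrite hol_secE; split=> hs p Up.
  split=> a ap; split=> u v; split=> i ip; have [K] := hs p Up.
  have := mhatP u v (K (a, i) (conj ap ip)).
  by apply: hat_near; exact: H.
split=> -[a i] [ap ip]; split=> u v; have [K] := hs p Up; have [L] := K a ap.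
have [M] := L u v; apply: hat_near (M i ip).
by apply: filterS (H p a i u v ap ip) => z ->.
Qed.

End OneBundle.

Section TwoBundles.
Variables (X : riemannSurface R) (r m : nat).
Variables (B : vbundle X r) (B' : vbundle X m).
Hypotheses (vB : is_vbundle B) (vB' : is_vbundle B').

Lemma homat_msec M q (s : X -> 'M[R[i]]_(r, q)) p : homat B B' M p ->
  msec B s p -> msec B' (fun z => M z *m s z) p.
Proof.
move=> hM [hs]; have [a ap] := fdom_ex vB p.
apply: (msec_near _ (msec_mul (hM a ap) (hs a ap))).
apply: filterS (fdom_nbhs vB ap) => z az.
by rewrite -mulmxA mulKVmx // fmx_unit.
Qed.

Lemma homat_ksec M q (s : X -> 'M[R[i]]_(r, q)) p : homat B B' M p ->
  ksec B s p -> ksec B' (fun z => M z *m s z) p.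
Proof.
move=> hM [hs]; have [a ap] := fdom_ex vB p.
split=> b bp; have [h] := hM a ap.
apply: (mfhat_near _ (mfhat_mull (h b bp) (hs a ap))).
apply: filterS (fdom_nbhs vB ap) => z az.
by rewrite -!mulmxA mulKVmx // fmx_unit.
Qed.

Lemma homat_frame M F p : frame B F p -> msec B' (fun z => M z *m F z) p ->
  homat B B' M p.
Proof.
move=> fF hM a ap; have [fa _] := frame_fmx vB ap.
apply: (msec_near _ (msec_mul hM ((frame_msec vB _ fF).1 fa))).
by apply: filterS (frame_near vB fF) => z uz; rewrite -mulmxA mulKVmx.
Qed.

End TwoBundles.

Lemma homat_inv X r (B B' : vbundle X r) M p : is_vbundle B -> is_vbundle B' ->
  homat B B' M p -> M p \in unitmx -> homat B' B (fun z => invmx (M z)) p.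
Proof.
move=> vB vB' hM uM; have [a ap] := fdom_ex vB p.
have [fa ua] := frame_fmx vB ap.
have fMF : frame B' (fun z => M z *m fmx a z) p.
  by split; [exact: hM|rewrite unitmx_mul uM].
apply: (homat_frame vB' fMF); apply: msec_near fa.
apply: filterS (frame_near vB' fMF) => z.
by rewrite unitmx_mul => /andP[uz _]; rewrite mulKmx.
Qed.

Lemma homat_comp X r m q (B : vbundle X r) (B' : vbundle X m) (B'' : vbundle X q)
    M N p : is_vbundle B' -> homat B B' M p -> homat B' B'' N p ->
  homat B B'' (fun z => N z *m M z) p.
Proof.
move=> vB' hM hN a ap; have := homat_msec vB' hN (hM a ap).
by under [X in msec _ X _]eq_fun do rewrite mulmxA.
Qed.

Lemma homat_near X r q (B : vbundle X r) (B' : vbundle X q) M N p :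
  (\forall z \near p, M z = N z) -> homat B B' M p -> homat B B' N p.
Proof.
move=> MN hM a ap; apply: msec_near (hM a ap).
by apply: filterS MN => z ->.
Qed.

Lemma homat_eq_punctured X r q (B : vbundle X r) (B' : vbundle X q) M N p :
  is_vbundle B -> is_vbundle B' -> homat B B' M p -> homat B B' N p ->
  (\forall z \near p, z != p -> M z = N z) -> M p = N p.
Proof.
move=> vB vB' hM hN MN; have [a ap] := fdom_ex vB p.
have := msec_eq_punctured vB' (hM a ap) (hN a ap) _.
move=> /(_ _)/(congr1 (mulmx^~ (invmx (fmx a p)))).
rewrite !mulmxK ?fmx_unit //; apply.
by apply: filterS MN => z + zp => /(_ zp) ->.
Qed.

End Sections.

(** * Connections *)

Section ConnectionTheory.
Context {R : realType}.
Variables (X : riemannSurface R) (r : nat) (B : vbundle X r).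
Hypothesis vB : is_vbundle B.

(** Holomorphic germs: a connection differentiates, so holomorphy at the single point p would not
    allow it to be applied. *)
Definition nsec q (s : X -> 'M[R[i]]_(r, q)) (p : X) : Prop :=
  \forall z \near p, msec B s z.

Lemma nsec_near q (s s' : X -> 'M[R[i]]_(r, q)) p :
  (\forall z \near p, s z = s' z) -> nsec s p -> nsec s' p.
Proof.
move=> /near_nbhs ss hs; apply: filterS (filterI ss hs) => z [Ez hz].
exact: msec_near Ez hz.
Qed.

Lemma nsec_sec q (s : X -> 'M[R[i]]_(r, q)) p : nsec s p -> msec B s p.
Proof. exact: nbhs_singleton. Qed.

Lemma hol_nsec (U : set X) (s : X -> 'cV[R[i]]_r) p : open U -> U p ->
  hol_sec B U s -> nsec s p.
Proof.
by move=> oU Up /hol_secE hs; apply: filterS (open_nbhs_nbhs (conj oU Up)).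
Qed.

Lemma nsec_open (s : X -> 'cV[R[i]]_r) p (P : set X) : nbhs p P -> nsec s p ->
  exists U, [/\ open U, U p, U `<=` P & hol_sec B U s].
Proof.
move=> pP hs; have [U [oU Up] UP] := near_open (filterI pP hs).
exists U; split=> //; first by move=> z /UP[].
by apply/hol_secE => z /UP[].
Qed.

(** For a frame F, [invmx F *m dmat D F] is the connection matrix of D. *)
Definition dmat (D : operator X r) q (F : X -> 'M[R[i]]_(r, q)) (p : X) :
    'M[R[i]]_(r, q) :=
  \matrix_(a, b) D (fun z => col b (F z)) p a 0.

Lemma col_dmat D q (F : X -> 'M[R[i]]_(r, q)) p j :
  col j (dmat D F p) = D (fun z => col j (F z)) p.
Proof. by apply/matrixP => a b; rewrite !mxE ord1. Qed.

Section Use.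
Variables (U0 : set X) (D : operator X r).
Hypotheses (oU0 : open U0) (cD : is_connection B U0 D).

Lemma U0_nbhs p : U0 p -> nbhs p U0.
Proof. by move=> Up; apply: open_nbhs_nbhs. Qed.

Lemma conn_loc s s' p : U0 p -> nsec s p -> (\forall z \near p, s z = s' z) ->
  D s p = D s' p.
Proof.
move=> Up hs ss; have [U [oU Up' UP hU]] := nsec_open (filterI (U0_nbhs Up) ss) hs.
have [|H _ _ _] := cD oU; first by move=> z /UP[].
by apply: H => // z /UP[].
Qed.

Lemma conn_ksec s p : U0 p -> nsec s p -> ksec B (D s) p.
Proof.
move=> Up hs; have [U [oU Up' UP hU]] := nsec_open (U0_nbhs Up) hs.
by have [//|_ H _ _] := cD oU; have /(hol_sec_twistE vB) := H s hU; apply.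
Qed.

Lemma conn_add s s' p : U0 p -> nsec s p -> nsec s' p ->
  D (fun z => s z + s' z) p = D s p + D s' p.
Proof.
move=> Up hs hs'; have [U [oU Up' UP hU]] := nsec_open (filterI (U0_nbhs Up) hs') hs.
have [|_ _ H _] := cD oU; first by move=> z /UP[].
by apply: (H s s' hU _ p Up'); apply/hol_secE => z /UP[].
Qed.

Lemma conn_leib f s p : U0 p -> (\forall z \near p, hat f z) -> nsec s p ->
  D (fun z => f z *: s z) p = dif f p *: s p + f p *: D s p.
Proof.
move=> Up hf hs; have [U [oU Up' UP hU]] := nsec_open (filterI (U0_nbhs Up) hf) hs.
have [|_ _ _ H] := cD oU; first by move=> z /UP[].
by apply: (H f s _ hU p Up'); apply/holoE => z /UP[].
Qed.

Lemma nsec_scale f q (s : X -> 'M[R[i]]_(r, q)) p :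
  (\forall z \near p, hat f z) -> nsec s p -> nsec (fun z => f z *: s z) p.
Proof.
move=> hf hs; apply: filterS (filterI hf hs) => z [fz sz].
exact: msec_scale.
Qed.

Lemma nsec_col q (s : X -> 'M[R[i]]_(r, q)) p j : nsec s p ->
  nsec (fun z => col j (s z)) p.
Proof. by move=> hs; apply: filterS hs => z; exact: msec_col. Qed.

Lemma nsec0 q p : nsec (fun=> 0 : 'M[R[i]]_(r, q)) p.
Proof.
apply: filterE => z; split=> a ap.
under [X in mhat X _]eq_fun do rewrite mulmx0; exact: mhat_cst.
Qed.

Lemma nsec_sum I (l : seq I) (s : I -> X -> 'cV[R[i]]_r) p :
  (forall i, nsec (s i) p) -> nsec (fun z => \sum_(i <- l) s i z) p.
Proof.
move=> hs; elim: l => [|a l IH].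
  by under [X in nsec X _]eq_fun do rewrite big_nil; exact: nsec0.
under [X in nsec X _]eq_fun do rewrite big_cons.
apply: filterS (filterI (hs a) IH) => z [az lz]; exact: msec_add.
Qed.

Lemma conn_sum I (l : seq I) (s : I -> X -> 'cV[R[i]]_r) p : U0 p ->
  (forall i, nsec (s i) p) ->
  D (fun z => \sum_(i <- l) s i z) p = \sum_(i <- l) D (s i) p.
Proof.
move=> Up hs; elim: l => [|a l IH].
  rewrite big_nil; under [X in D X _]eq_fun do rewrite big_nil.
  have h0 : \forall z \near p, hat (fun=> 0 : R[i]) z.
    by apply: filterE => z; exact: hat_cst.
  have /= := conn_leib Up h0 (nsec0 1 p).
  rewrite dif_cst !scale0r addr0; exact.
rewrite big_cons -IH -(conn_add Up (hs a) (nsec_sum l hs)).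
by congr (D _ _); apply/funext => z; rewrite big_cons.
Qed.

Lemma conn_mul q (F : X -> 'M[R[i]]_(r, q)) (u : X -> 'cV[R[i]]_q) p : U0 p ->
  nsec F p -> (\forall z \near p, mhat u z) ->
  D (fun z => F z *m u z) p = F p *m mdif u p + dmat D F p *m u p.
Proof.
move=> Up hF hu.
have -> : (fun z => F z *m u z) =
    (fun z => \sum_j (fun z => u z j 0 *: col j (F z)) z).
  apply/funext => z; apply/matrixP => a b; rewrite summxE mxE ord1.
  by apply: eq_bigr => k _; rewrite !mxE mulrC.
have hj j : \forall z \near p, hat (fun z => u z j 0) z.
  by apply: filterS hu => z /mhatP.
rewrite conn_sum //; last by move=> j; apply: nsec_scale => //; exact: nsec_col.
apply/matrixP => a b; rewrite summxE ord1 [RHS]mxE [X in X + _]mxE [X in _ + X]mxE.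
rewrite -big_split; apply: eq_bigr => k _ /=.
rewrite conn_leib //; last exact: nsec_col.
rewrite [LHS]mxE [X in X + _]mxE [X in _ + X]mxE mdifE [col k _ _ _]mxE.
by rewrite [dmat _ _ _ _ _]mxE mulrC; congr (_ + _); rewrite mulrC.
Qed.

Definition nframe (F : X -> 'M[R[i]]_r) (p : X) : Prop :=
  \forall z \near p, frame B F z.

Lemma nframe_nsec F p : nframe F p -> nsec F p.
Proof. by apply: filterS => z []. Qed.

Lemma nframe_at F p : nframe F p -> frame B F p.
Proof. exact: nbhs_singleton. Qed.

Lemma nframe_of F p : nsec F p -> F p \in unitmx -> nframe F p.
Proof.
move=> hF uF; have fF : frame B F p by split=> //; exact: nsec_sec.
by apply: filterS (filterI hF (frame_near vB fF)) => z [].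
Qed.

Lemma nframe_fmx (a : fidx B) p : fdom a p -> nframe (fmx a) p.
Proof.
by move=> ap; apply: filterS (fdom_nbhs vB ap) => z; exact: frame_fmx.
Qed.

Lemma nframe_coord F q (s : X -> 'M[R[i]]_(r, q)) p : nframe F p -> nsec s p ->
  \forall z \near p, mhat (fun z => invmx (F z) *m s z) z.
Proof.
move=> hF hs; apply: filterS (filterI hF hs) => z [Fz sz].
exact/(frame_msec vB).
Qed.

Lemma ksec_dmat q (F : X -> 'M[R[i]]_(r, q)) p : U0 p -> nsec F p ->
  ksec B (dmat D F) p.
Proof.
move=> Up hF; apply: ksec_cols => j.
under [X in ksec _ X _]eq_fun do rewrite col_dmat.
by apply: conn_ksec => //; exact: nsec_col.
Qed.

End Use.

(** D = d + [Om] in the coordinates of the frame F. *)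
Definition local_conn (D : operator X r) (F Om : X -> 'M[R[i]]_r) (p : X) : Prop :=
  forall s, nsec s p -> D s p = F p *m
    (mdif (fun z => invmx (F z) *m s z) p + Om p *m (invmx (F p) *m s p)).

(** The axioms are local and hold for d + [Om] by the product rule. [deriv_holo] makes D s
    holomorphic, since D s involves derivatives of the coordinates of s. *)
Lemma conn_mk (U0 : set X) (D : operator X r) : @deriv_holo R -> open U0 ->
  (forall p, U0 p -> exists F Om, [/\ nframe F p,
     \forall z \near p, mfhat Om z & \forall z \near p, local_conn D F Om z]) ->
  is_connection B U0 D.
Proof.
move=> DH oU0 hD U oU UU0.
have oN p (P : set X) : U p -> (forall z, U z -> P z) -> nbhs p P.
  by move=> Up UP; apply: filterS (open_nbhs_nbhs (conj oU Up)) => z /UP.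
split.
- move=> s s' hs ss p Up; have [F [Om [hF _ hL]]] := hD p (UU0 _ Up).
  have nss : \forall z \near p, s z = s' z by exact: oN Up ss.
  have ns := hol_nsec oU Up hs; have ns' := nsec_near nss ns.
  have L := nbhs_singleton hL.
  rewrite (L s ns) (L s' ns') (ss p Up); congr (_ *m (_ + _)).
  apply: mdif_near; last exact: (nbhs_singleton (nframe_coord hF ns)).
  by apply: filterS nss => z ->.
- move=> s hs; apply/(hol_sec_twistE vB) => p Up.
  have [F [Om [hF hO hL]]] := hD p (UU0 _ Up); have ns := hol_nsec oU Up hs.
  apply/(frame_ksec vB _ (nframe_at hF)).
  apply: (@mfhat_near _ _ _ _ (fun p => mdif (fun z => invmx (F z) *m s z) p +
      Om p *m (invmx (F p) *m s p))).
    apply: filterS (filterI (filterI hF hL) (near_nbhs ns)) => z [[[_ uz] Lz] sz].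
    by rewrite Lz // mulKmx.
  have hc := nframe_coord hF ns.
  apply: mfhat_add; first exact: mfhat_dif.
  by apply: mfhat_mulr; [exact: nbhs_singleton hO|exact: nbhs_singleton hc].
- move=> s s' hs hs' p Up; have [F [Om [hF hO hL]]] := hD p (UU0 _ Up).
  have ns := hol_nsec oU Up hs; have ns' := hol_nsec oU Up hs'.
  have L := nbhs_singleton hL; rewrite L; last first.
    by apply: filterS (filterI ns ns') => z [sz sz']; exact: msec_add.
  rewrite (L s ns) (L s' ns') -mulmxDr.
  rewrite [invmx (F p) *m (s p + s' p)]mulmxDr; congr (_ *m _).
  have -> : (fun z => invmx (F z) *m (s z + s' z)) =
      (fun z => invmx (F z) *m s z + invmx (F z) *m s' z).
    by apply/funext => z; rewrite mulmxDr.
  rewrite mdif_add; last exact: (nbhs_singleton (nframe_coord hF ns'));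
    last exact: (nbhs_singleton (nframe_coord hF ns)).
  by rewrite [Om p *m (_ + _)]mulmxDr addrACA.
- move=> f s hf hs p Up; have [F [Om [hF hO hL]]] := hD p (UU0 _ Up).
  have ns := hol_nsec oU Up hs; have L := nbhs_singleton hL.
  have hf' : \forall z \near p, hat f z by apply: oN Up _; exact/holoE.
  rewrite (L s ns) L; last exact: nsec_scale.
  have -> : (fun z => invmx (F z) *m (f z *: s z)) =
      (fun z => f z *: (invmx (F z) *m s z)).
    by apply/funext => z; rewrite scalemxAr.
  rewrite mdif_scale; last exact: (nbhs_singleton (nframe_coord hF ns));
    last exact: nbhs_singleton hf'.
  have [_ uF] := nframe_at hF.
  by rewrite scalemxAr !mulmxDr -!scalemxAr mulKVmx // scalerDr addrA.
Qed.

End ConnectionTheory.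

Lemma col_mul (K : pzSemiRingType) m n q (A : 'M[K]_(m, n)) (B : 'M[K]_(n, q)) j :
  col j (A *m B) = A *m col j B.
Proof. by apply/matrixP => a b; rewrite !mxE; apply: eq_bigr => k _; rewrite mxE. Qed.

Lemma is_derive_translate (K : numFieldType) (a z : K^o) :
  is_derive z 1 (fun w => a + w) (1 : K^o).
Proof.
have := is_derive_add (is_derive_cst a z 1) (is_derive_id z (1 : K^o)).
by rewrite add0r.
Qed.

Lemma is_derive_comp_translate (K : numFieldType) (g : K^o -> K^o) (a z b : K^o) :
  is_derive (a + z) 1 g b -> is_derive z 1 (fun w => g (a + w)) b.
Proof.
move=> gb; have := is_derive_comp (is_derive_translate a z) gb.
by rewrite mulr1.
Qed.

Lemma near_translate (K : numFieldType) (P : set K^o) (a z : K^o) :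
  nbhs (a + z) P -> \forall w \near z, P (a + w).
Proof.
have [d _] := is_derive_translate a z.
by have := derivable_continuous d; exact.
Qed.

Lemma derivable_translate (K : numFieldType) (h : K^o -> K^o) (a z : K^o) :
  derivable (fun w => h (a + w)) z 1 -> derivable h (a + z) 1.
Proof.
move=> hD; have E : - a + (a + z) = z by rewrite addKr.
have D0 : is_derive (- a + (a + z)) 1 (fun w => h (a + w))
    ('D_1 (fun w => h (a + w)) z) by rewrite E; exact: DeriveDef.
have [H _] := is_derive_comp_translate D0.
have F : (fun w : K^o => h (a + (- a + w))) = h.
  by apply/funext => w; rewrite addNKr.
by rewrite -F.
Qed.

(** * Holomorphy of derivatives from the existence of a connection *)

Section DerivativeHolomorphic.
Context {R : realType}.

(** The translation by a lets g be holomorphic anywhere in the plane, and not only on the image of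
    the chart. *)
Lemma hat_plane (X : riemannSurface R) (i : cidx X) (q : X)
    (g : R[i]^o -> R[i]^o) (a : R[i]^o) : cdom i q ->
  derivable g (a + coord i q) 1 ->
  hat (fun q => g (a + coord i q) : R[i]) q /\
  cder i (fun q => g (a + coord i q) : R[i]) q = 'D_1 g (a + coord i q).
Proof.
move=> iq gq; have H : is_derive (coord i q) 1
    (((fun q => g (a + coord i q)) : X -> R[i]^o) \o icoord i)
    ('D_1 g (a + coord i q)).
  apply: near_eq_is_der (is_derive_comp_translate (DeriveDef gq erefl)).
  by apply: filterS (near_coord_icoord iq) => w /= wE; rewrite wE.
have [hfq _] := hat_one iq H; have [_ E] := H.
exact: (conj hfq E).
Qed.

Lemma fhat_plane (X : riemannSurface R) (i : cidx X) (p : X)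
    (g : R[i]^o -> R[i]^o) (a : R[i]^o) : cdom i p ->
  (\forall q \near p, cdom i q /\ derivable g (a + coord i q) 1) ->
  fhat (dif (fun q => g (a + coord i q) : R[i])) p ->
  derivable (fun w => 'D_1 g w) (a + coord i p) 1.
Proof.
move=> ip df [/(_ i ip)] h; apply: derivable_translate.
have h2 : hat (fun q => 'D_1 g (a + coord i q) : R[i]) p.
  apply: hat_near h; apply: filterS df => q [iq gq].
  by have [hfq <-] := hat_plane iq gq; rewrite (cderE hfq iq).
have := hat_is_derive h2 ip.
move: (cder _ _ _) => b hb.
suff : is_derive (coord i p) 1 (fun w => 'D_1 g (a + w)) b by case.
apply: near_eq_is_der hb.
by apply: filterS (near_coord_icoord ip) => w /= ->.
Qed.

(* For a local section [s], [df s = D (f s) - f D s] is holomorphic. *)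
Lemma conn_fhat_dif (X : riemannSurface R) r (B : vbundle X r.+1)
    (U0 : set X) (D : operator X r.+1) p f :
  is_vbundle B -> open U0 -> U0 p -> is_connection B U0 D ->
  (\forall q \near p, hat f q) -> fhat (dif f) p.
Proof.
move=> vB oU Up cD hf.
have [a ap] := fdom_ex vB p.
have ns : nsec B (fun z => col 0 (fmx a z)) p.
  by apply: nsec_col; apply: nframe_nsec; exact: nframe_fmx.
have ks := conn_ksec vB oU cD Up ns.
have ks' := conn_ksec vB oU cD Up (nsec_scale hf ns).
have kd : ksec B (fun z => dif f z *: col 0 (fmx a z)) p.
  have kk : ksec B (fun z => D (fun z => f z *: col 0 (fmx a z)) z +
      - f z *: D (fun z => col 0 (fmx a z)) z) p.
    apply: ksec_add; first exact: ks'.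
    apply: ksec_scale; last exact: ks.
    by apply: hat_opp; exact: nbhs_singleton hf.
  apply: ksec_near kk.
  have nU : nbhs p U0 by exact: U0_nbhs.
  have [nf nns] := (near_nbhs hf, near_nbhs ns).
  apply: filterS (filterI nU (filterI nf nns)) => z [Uz [fz sz]].
  by rewrite (conn_leib oU cD Uz fz sz) scaleNr addrK.
have := (frame_ksec vB _ (frame_fmx vB ap)).1 kd => -[/(_ 0 0)] h.
apply: fhat_near h; apply: filterS (fdom_nbhs vB ap) => z az.
rewrite -scalemxAr -col_mul mulVmx ?fmx_unit // mxE mxE mxE.
by rewrite eqxx mulr1.
Qed.

Lemma near_plane (X : riemannSurface R) (i : cidx X) (p : X)
    (P : set R[i]^o) (b : R[i]^o) : cdom i p ->
  nbhs (b + coord i p) P -> \forall q \near p, cdom i q /\ P (b + coord i q).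
Proof.
move=> ip /near_translate /(coord_cont ip) H.
exact: filterI (cdom_nbhs ip) H.
Qed.

(** [deriv_holo] concerns arbitrary points of the plane, whereas a connection sees only functions on
    X; a translation brings z0 to the coordinate of p, where [conn_fhat_dif] applies. The rank is
    positive, so there is a nonvanishing local section to multiply by the function. *)
Lemma conn_deriv_holo (X : riemannSurface R) r (B : vbundle X r.+1)
    (U0 : set X) (D : operator X r.+1) p :
  is_vbundle B -> open U0 -> U0 p -> is_connection B U0 D -> @deriv_holo R.
Proof.
move=> vB oU Up cD g z0 hg; have ip := mem_chart_at p.
have [b bE] : exists b : R[i]^o, z0 = b + coord (chart_at p) p.
  by exists (z0 - coord (chart_at p) p); symmetry; exact: subrK.
have hg' : nbhs (b + coord (chart_at p) p) [set w | derivable g w 1].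
  by rewrite -bE.
have df := near_plane ip hg'.
have hf : \forall q \near p, hat (fun q => g (b + coord (chart_at p) q) : R[i]) q.
  by apply: filterS df => q [iq gq]; have [] := hat_plane iq gq.
have H := fhat_plane ip df (conn_fhat_dif vB oU Up cD hf).
by rewrite bE; exact: H.
Qed.

End DerivativeHolomorphic.

(** * Derivatives of determinants and the connection induced on the determinant *)

Section DeterminantDerivative.
Context {R : realType}.

Lemma cofactor_eq_col (K : comNzRingType) n (A B : 'M[K]_n) a j :
  (forall u v, v != j -> A u v = B u v) -> cofactor A a j = cofactor B a j.
Proof.
move=> AB; rewrite /cofactor; congr (_ * \det _).
by apply/matrixP => u v; rewrite !mxE AB // eq_sym neq_lift.
Qed.

(** Expansion along the replaced column only involves cofactors of A, because the other columns are
    unchanged. *)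
Lemma det_replace_cols (K : comNzRingType) n (A W : 'M[K]_n) :
  \sum_j \det (\matrix_(a, b) (if b == j then W a b else A a b)) =
  \tr (\adj A *m W).
Proof.
apply: eq_bigr => j _; rewrite (expand_det_col _ j) mxE; apply: eq_bigr => a _.
rewrite [\adj _ _ _]mxE mxE eqxx mulrC; congr (_ * _).
by apply: cofactor_eq_col => u v vj; rewrite mxE (negPf vj).
Qed.

Lemma det_replace_rows (K : comNzRingType) n (A W : 'M[K]_n) :
  \sum_j \det (\matrix_(a, b) (if a == j then W a b else A a b)) =
  \tr (\adj A *m W).
Proof.
rewrite mxtrace_mulC -mxtrace_tr trmx_mul trmx_adj.
rewrite -det_replace_cols.
apply: eq_bigr => j _; rewrite -det_tr; congr (\det _).
by apply/matrixP => a b; rewrite !mxE.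
Qed.

Lemma dif_prod (X : riemannSurface R) n (F : 'I_n -> X -> R[i]) p :
  (forall k, hat (F k) p) ->
  dif (fun z => \prod_k F k z) p =
  \sum_k \prod_l (if l == k then dif (F l) p else F l p).
Proof.
elim: n F => [|n IH] F hF.
  by rewrite big_ord0; under eq_fun do rewrite big_ord0; rewrite dif_cst.
under eq_fun do rewrite big_ord_recl.
rewrite dif_mul; [|exact: hF|by apply: hat_prod => k _; exact: hF].
rewrite IH; last by move=> k; exact: hF.
rewrite [RHS]big_ord_recl; congr (_ + _).
  by rewrite big_ord_recl eqxx.
rewrite mulr_sumr; apply: eq_bigr => k _.
by rewrite [RHS]big_ord_recl (negPf (neq_lift _ _)).
Qed.

(** Jacobi's formula: the product rule, applied to each term of the Leibniz expansion,
    differentiates one row at a time. *)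
Lemma dif_det (X : riemannSurface R) n (M : X -> 'M[R[i]]_n) p : mhat M p ->
  dif (fun z => \det (M z)) p = \tr (\adj (M p) *m mdif M p).
Proof.
move=> [hM]; rewrite -det_replace_rows /determinant.
rewrite dif_sum; last first.
  by move=> s; apply: hat_mul; [exact: hat_cst|apply: hat_prod => k _].
rewrite exchange_big; apply: eq_bigr => s _ /=.
rewrite dif_mul; [|exact: hat_cst|by apply: hat_prod => k _].
rewrite dif_cst mul0r add0r dif_prod // mulr_sumr; apply: eq_bigr => k _.
congr (_ * _); apply: eq_bigr => l _; rewrite mxE; case: ifP => // _.
by rewrite mdifE.
Qed.

End DeterminantDerivative.

Section TraceCriterion.
Context {R : realType}.
Variables (X : riemannSurface R) (r : nat) (B : vbundle X r).
Hypothesis vB : is_vbundle B.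
Variables (U0 : set X) (theta : X -> R[i]) (D : operator X r).
Hypotheses (oU0 : open U0) (cD : is_connection B U0 D).
Hypothesis theta_hat : forall (a : fidx B) p, U0 p -> fdom a p ->
  hat (fun z => theta z * \det (fmx a z)) p.

Lemma det_msec_hat F p : U0 p -> msec B F p ->
  hat (fun z => theta z * \det (F z)) p.
Proof.
move=> Up [hF]; have [a ap] := fdom_ex vB p.
apply: (@hat_near _ _ (fun z => theta z * \det (fmx a z) *
    \det (invmx (fmx a z) *m F z))).
  apply: filterS (fdom_nbhs vB ap) => z az.
  by rewrite -mulrA -det_mulmx mulKVmx // fmx_unit.
apply: hat_mul; first exact: theta_hat.
by apply: hat_det; exact: hF.
Qed.

(** The equation d log(theta det F) = tr(connection matrix in the frame F), cleared of its
    denominator. *)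
Definition trace_crit (F : X -> 'M[R[i]]_r) (p : X) : Prop :=
  dif (fun z => theta z * \det (F z)) p =
  theta p * \det (F p) * \tr (invmx (F p) *m dmat D F p).

Lemma det_sumE (F : X -> 'M[R[i]]_r) p :
  \sum_j \det (\matrix_(a, b)
        (if b == j then D (fun q => col j (F q)) p a 0 else F p a b)) =
  \tr (\adj (F p) *m dmat D F p).
Proof.
rewrite -det_replace_cols; apply: eq_bigr => j _; congr (\det _).
by apply/matrixP => a b; rewrite !mxE; case: eqP => // ->.
Qed.

Lemma adj_unit (A : 'M[R[i]]_r) : A \in unitmx -> \adj A = \det A *: invmx A.
Proof.
by move=> uA; rewrite /invmx uA scalerA mulfV ?scale1r // -unitfE -unitmxE.
Qed.

Lemma det_trivial_trace F p : U0 p -> nframe B F p ->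
  det_trivial B U0 theta D -> trace_crit F p.
Proof.
move=> Up hF hD; have [U [oU Up'] UP] := near_open (filterI (U0_nbhs oU0 Up) hF).
have := hD U F oU _ _ p Up'; rewrite det_sumE adj_unit; last first.
  by have [] := nframe_at hF.
rewrite -scalemxAl mxtraceZ mulrA; apply; first by move=> z /UP[].
by move=> j; apply/hol_secE => z /UP[_ [hz _]]; exact: msec_col.
Qed.

(** One frame near each point suffices: for G = F u, Jacobi's formula for det u accounts for the
    change on both sides. *)
Lemma trace_det_trivial :
  (forall p, U0 p -> exists2 F, nframe B F p & trace_crit F p) ->
  det_trivial B U0 theta D.
Proof.
move=> hT U G oU UU0 hG p Up; rewrite det_sumE.
have [F hF cF] := hT p (UU0 p Up); have U0p := UU0 p Up.
have nG : nsec B G p.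
  apply: filterS (open_nbhs_nbhs (conj oU Up)) => z Uz.
  by apply: msec_cols => j; exact: ((hol_secE _ _ _).1 (hG j)).
have hu := nframe_coord vB hF nG; set u := fun z => invmx (F z) *m G z in hu.
have hu0 := nbhs_singleton hu; have [hFp uF] := nframe_at hF.
have GE : \forall z \near p, G z = F z *m u z.
  by apply: filterS hF => z [_ uz]; rewrite /u mulKVmx.
have dG : dmat D G p = F p *m mdif u p + dmat D F p *m u p.
  apply/matrixP => a b; rewrite [LHS]mxE.
  have huc : \forall z \near p, mhat (fun z => col b (u z)) z.
    apply: filterS hu => z hz; under [X in mhat X _]eq_fun do rewrite colE.
    by apply: mhat_mul => //; exact: mhat_cst.
  have := conn_mul oU0 cD U0p (nframe_nsec hF) huc.
  have -> : D (fun z => F z *m col b (u z)) p = D (fun z => col b (G z)) p.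
    symmetry; apply: (conn_loc oU0 cD U0p); first exact: nsec_col.
    by apply: filterS GE => z ->; rewrite col_mul.
  move=> ->; rewrite mxE [in RHS]mxE; congr (_ + _).
    rewrite !mxE; apply: eq_bigr => k _; congr (_ * _); rewrite !mdifE.
    by congr (dif _ _); apply/funext => z; rewrite mxE.
  by rewrite -col_mul mxE.
have -> : dif (fun q => theta q * \det (G q)) p =
    dif (fun q => theta q * \det (F q) * \det (u q)) p.
  apply: dif_near; last by apply: det_msec_hat => //; exact: nsec_sec.
  by apply: filterS GE => z ->; rewrite det_mulmx mulrA.
rewrite dif_mul; [|exact: det_msec_hat|exact: hat_det].
rewrite cF (dif_det hu0) dG (nbhs_singleton GE).
have -> : F p *m mdif u p + dmat D F p *m u p =
    F p *m (mdif u p + invmx (F p) *m dmat D F p *m u p).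
  by rewrite mulmxDr -mulmxA mulKVmx.
set T := invmx (F p) *m dmat D F p.
(* The columns of G are arbitrary sections, so u may be singular and cannot be inverted; the factor
   det F is taken out of the determinants with one replaced column instead. *)
have -> : \tr (\adj (F p *m u p) *m (F p *m (mdif u p + T *m u p))) =
    \det (F p) * \tr (\adj (u p) *m (mdif u p + T *m u p)).
  rewrite -!det_replace_cols mulr_sumr; apply: eq_bigr => j _.
  rewrite -det_mulmx; congr (\det _); apply/matrixP => a b; rewrite !mxE.
  by case: eqP => bj; apply: eq_bigr => k _; rewrite !mxE; case: eqP.
rewrite mulmxDr mxtraceD mulmxA [\tr (_ *m u p)]mxtrace_mulC mulmxA mul_mx_adj.
by rewrite mul_scalar_mx mxtraceZ; ring.
Qed.

End TraceCriterion.

(** * Symmetric powers *)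

Section SymmetricPowerAlgebra.
Context {R : realType}.
Implicit Types (m : nat) (g h : 'M[R[i]]_2).

Lemma sum_ord2 (K : nmodType) (F : 'I_2 -> K) : \sum_k F k = F 0 + F 1.
Proof.
rewrite !big_ord_recl big_ord0 addr0; congr (_ + F _); exact/val_inj.
Qed.

Lemma linpolyZ (a : R[i]) (v : 'cV[R[i]]_2) : linpoly (a *: v) = a *: linpoly v.
Proof. by rewrite /linpoly !mxE scalerDr -!mul_polyC !polyCM mulrA. Qed.

Lemma linpoly_mul g (v : 'cV[R[i]]_2) :
  linpoly (g *m v) = v 0 0 *: linpoly (col 0 g) + v 1 0 *: linpoly (col 1 g).
Proof.
rewrite /linpoly !mxE !sum_ord2.
rewrite -!mul_polyC !polyCD !polyCM; ring.
Qed.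

Lemma coef_linpoly_mul (v : 'cV[R[i]]_2) (P : {poly R[i]}) k :
  (P * linpoly v)`_k = v 0 0 * P`_k + v 1 0 * (if k is k'.+1 then P`_k' else 0).
Proof.
rewrite /linpoly mulrDr coefD coefMC mulrA coefMX coefMC [P`_k * _]mulrC.
by case: k => [|k] /=; rewrite ?mulr0 // [_ * v 1 0]mulrC.
Qed.

Lemma size_linpoly_prod m (v : 'I_m -> 'cV[R[i]]_2) :
  (size (\prod_k linpoly (v k))%R <= m.+1)%N.
Proof.
apply/leq_sizeP; elim: m v => [|m IH] v j mj.
  by rewrite big_ord0 coefC; case: j mj.
rewrite big_ord_recr coef_linpoly_mul IH ?mulr0 ?add0r; last by exact: ltnW.
by case: j mj => // j mj; rewrite IH ?mulr0.
Qed.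

(* Homogeneity: substituting G0, G1 for the two basis vectors. *)
Lemma homog_prod m (v : 'I_m -> 'cV[R[i]]_2) (G0 G1 : {poly R[i]}) :
  \prod_k (v k 0 0 *: G0 + v k 1 0 *: G1) =
  \sum_(i < m.+1) (\prod_k linpoly (v k))`_i *: (G0 ^+ (m - i) * G1 ^+ i).
Proof.
elim: m v => [|m IH] v.
  by rewrite !big_ord0 big_ord1 coefC eqxx scale1r !expr0 mulr1.
rewrite big_ord_recr IH /=; set P := \prod_(k < m) linpoly _.
rewrite mulrDr !mulr_suml.
under [RHS]eq_bigr do rewrite big_ord_recr coef_linpoly_mul scalerDl.
rewrite [RHS]big_split; congr (_ + _).
  rewrite [RHS]big_ord_recr /= -/P.
  have -> : P`_m.+1 = 0.
    have := size_linpoly_prod (fun k => v (widen_ord (leqnSn m) k)).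
    by move=> /leq_sizeP; apply.
  rewrite mulr0 scale0r addr0; apply: eq_bigr => k _.
  rewrite subSn; last by rewrite -ltnS.
  by rewrite -scalerAr -scalerAl scalerA exprSr mulrAC.
rewrite [RHS]big_ord_recl /= mulr0 scale0r add0r; apply: eq_bigr => k _.
rewrite /bump add1n /= subSS -/P.
by rewrite -scalerAr -scalerAl scalerA exprSr mulrA.
Qed.

(** This is [homog_prod] with the linear forms of the two columns of g substituted for the basis. *)
Lemma symmx_symprod m g (v : 'I_m -> 'cV[R[i]]_2) :
  symmx m g *m symprod v = symprod (fun k => g *m v k).
Proof.
apply/matrixP => a b; rewrite ord1 !mxE.
rewrite (eq_bigr _ (fun k _ => linpoly_mul g (v k))).
rewrite homog_prod coef_sum; apply: eq_bigr => k _.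
by rewrite coefZ !mxE mulrC.
Qed.

Lemma prod_ord_if (K : comNzRingType) m (k : 'I_m.+1) (a b : K) :
  \prod_(l < m) (if (l < k)%N then a else b) = b ^+ (m - k) * a ^+ k.
Proof.
have km : (k <= m)%N by rewrite -ltnS.
rewrite -(big_mkord xpredT (fun l => if (l < k)%N then a else b)).
rewrite (big_cat_nat _ km) //= mulrC; congr (_ * _).
  rewrite big_nat (eq_bigr (fun=> b)); last first.
    by move=> l /andP[kl _]; rewrite ltnNge kl.
  by rewrite -big_nat prodr_const_nat.
rewrite big_nat (eq_bigr (fun=> a)); last by move=> l /andP[_ ->].
by rewrite -big_nat prodr_const_nat subn0.
Qed.

(** With columns expressed as symmetric products of columns of g, statements about [symmx] reduce to
    [symmx_symprod] and [symprodZ]. *)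
Lemma col_symmx m g (k : 'I_m.+1) : col k (symmx m g) =
  symprod (fun l : 'I_m => if (l < k)%N then col 1 g else col 0 g).
Proof.
apply/matrixP => a b; rewrite !mxE -prod_ord_if.
rewrite (eq_bigr (fun l : 'I_m =>
  linpoly (if (l < k)%N then col 1 g else col 0 g))) // => l _.
by case: ifP.
Qed.

Lemma col_matrixP (K : Type) m n (A B : 'M[K]_(m, n)) :
  (forall j, col j A = col j B) -> A = B.
Proof.
by move=> AB; apply/matrixP => a b; have /matrixP/(_ a 0) := AB b; rewrite !mxE.
Qed.

Lemma symmxM m g h : symmx m (g *m h) = symmx m g *m symmx m h.
Proof.
apply: col_matrixP => k; rewrite col_mul !col_symmx symmx_symprod.
by congr symprod; apply/funext => l; case: ifP => _; rewrite col_mul.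
Qed.

Lemma symmx1 m : symmx m 1%:M = 1%:M :> 'M[R[i]]_m.+1.
Proof.
apply/matrixP => a b; rewrite !mxE /linpoly !mxE /= polyC1 polyC0 mul0r addr0.
by rewrite add0r mul1r expr1n mul1r coefXn.
Qed.

Lemma symmx_unit m g : g \in unitmx -> symmx m g \in unitmx.
Proof.
move=> ug; have /mulmx1_unit[] // : symmx m g *m symmx m (invmx g) = 1%:M.
by rewrite -symmxM mulmxV // symmx1.
Qed.

Lemma symmxV m g : g \in unitmx -> symmx m (invmx g) = invmx (symmx m g).
Proof.
move=> ug; have us := symmx_unit m ug.
by rewrite -[LHS](mulKmx us) -symmxM mulmxV // symmx1 mulmx1.
Qed.

Lemma symprodZ m (a : 'I_m -> R[i]) (v : 'I_m -> 'cV[R[i]]_2) :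
  symprod (fun k => a k *: v k) = (\prod_k a k) *: symprod v.
Proof.
apply/matrixP => i b; rewrite !mxE -coefZ.
by under eq_bigr do rewrite linpolyZ; rewrite scaler_prod.
Qed.

(** [symmx m g] is again triangular, with diagonal entries g_00^(m - a) g_11^a, and the exponents of
    each factor add up to 0 + 1 + ... + m. *)
Lemma det_symmx_trig m g : is_trig_mx g ->
  \det (symmx m g) = \det g ^+ 'C(m.+1, 2).
Proof.
move=> tg; have g01 : g 0 1 = 0 by have /is_trig_mxP := tg; apply.
have detg : \det g = g 0 0 * g 1 1.
  by rewrite det_trig // !big_ord_recl big_ord0 mulr1; congr (_ * g _ _); apply/val_inj.
have E (a b : 'I_m.+1) : symmx m g a b = if (a < b)%N then 0 else
    (linpoly (col 0 g) ^+ (m - b) * (g 1 1 ^+ b)%:P)`_(a - b).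
  rewrite mxE [linpoly (col 1 g)]/linpoly !mxE g01 polyC0 add0r exprMn.
  by rewrite mulrA coefMXn -polyC_exp.
rewrite det_trig; last by apply/is_trig_mxP => a b ab; rewrite E ab.
have D (a : 'I_m.+1) : symmx m g a a = g 0 0 ^+ (m - a) * g 1 1 ^+ a.
  rewrite E ltnn subnn coefMC; congr (_ * _).
  by rewrite -horner_coef0 horner_exp /linpoly !hornerE !mxE.
rewrite detg (eq_bigr _ (fun a _ => D a)) big_split /=.
rewrite !prodrXr exprMn; congr (_ ^+ _ * _ ^+ _).
  rewrite (reindex_inj rev_ord_inj) /= -bin2_sum big_mkord.
  by apply: eq_bigr => k _; rewrite subSS subKn // -ltnS.
by rewrite -bin2_sum big_mkord.
Qed.

Definition swap2 : 'M[R[i]]_2 := \matrix_(a, b) (a != b)%:R.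

Lemma ord2P (P : 'I_2 -> Prop) : P 0 -> P 1 -> forall a, P a.
Proof.
by move=> P0 P1 [[|[|//]] h]; [rewrite (_ : Ordinal h = 0)|rewrite (_ : Ordinal h = 1)]
  => //; apply/val_inj.
Qed.

Lemma swap2K : swap2 *m swap2 = 1%:M.
Proof.
apply/matrixP; apply: ord2P; apply: ord2P; rewrite !mxE sum_ord2 !mxE /=;
  by rewrite ?mulr0 ?mul0r ?mulr1 ?addr0 ?add0r.
Qed.

(** Exchanging the basis vectors makes g lower triangular. The exchange is an involution, so its
    determinant and that of its symmetric power occur squared, as 1. *)
Lemma det_symmx_triu m g : g 1 0 = 0 ->
  \det (symmx m g) = \det g ^+ 'C(m.+1, 2).
Proof.
move=> g10; pose w := swap2.
have E : (w *m g *m w) 0 1 = 0.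
  rewrite mxE sum_ord2 ![(w *m g) _ _]mxE !sum_ord2 !mxE /= g10.
  by rewrite ?mulr0 ?mul0r ?mulr1 ?addr0 ?add0r ?mul1r.
have tw : is_trig_mx (w *m g *m w).
  by apply/is_trig_mxP => a b; move: a b; do 2!apply: ord2P.
have := det_symmx_trig m tw; rewrite !symmxM !det_mulmx -!mulrA.
have dd : \det w * \det w = 1 by rewrite -det_mulmx swap2K det1.
have ds : \det (symmx m w) * \det (symmx m w) = 1.
  by rewrite -det_mulmx -symmxM swap2K symmx1 det1.
by rewrite [\det g * _]mulrC !mulrA dd mul1r mulrC mulrA ds mul1r.
Qed.

(** A matrix with nonzero pivot is a product L U of triangular ones, to which the two triangular
    cases apply. *)
Lemma det_symmx m g : g \in unitmx -> \det (symmx m g) = \det g ^+ 'C(m.+1, 2).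
Proof.
move=> ug; have main h : h \in unitmx -> h 0 0 != 0 ->
    \det (symmx m h) = \det h ^+ 'C(m.+1, 2).
  move=> uh h0; pose L : 'M[R[i]]_2 := \matrix_(a, b)
    (if a == b then 1 else if a == 0 then 0 else h 1 0 / h 0 0).
  pose U : 'M[R[i]]_2 := \matrix_(a, b)
    (if a == 0 then h 0 b else if b == 0 then 0 else h 1 1 - h 1 0 / h 0 0 * h 0 1).
  have -> : h = L *m U.
    apply/matrixP; apply: ord2P; apply: ord2P;
      rewrite !mxE sum_ord2 !mxE /=
        ?mulr0 ?mul0r ?mulr1 ?addr0 ?add0r ?mul1r //.
    + by rewrite divfK.
    + by rewrite addrC subrK.
  rewrite symmxM !det_mulmx exprMn det_symmx_trig ?det_symmx_triu // ?mxE //.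
  by apply/is_trig_mxP => a b; move: a b; do 2!apply: ord2P => //; rewrite mxE.
have [g0|g0] := eqVneq (g 0 0) 0; last exact: main.
(* Left multiplication by T adds the second row to the first; the pivot becomes [g 1 0], which is
   nonzero because g is invertible. *)
pose T : 'M[R[i]]_2 := \matrix_(a, b) (if (a == 1) && (b == 0) then 0 else 1).
have dT : \det T = 1.
  rewrite -det_tr det_trig.
    by rewrite !big_ord_recl big_ord0 !mxE /= !mulr1.
  by apply/is_trig_mxP => a b; move: a b; do 2!apply: ord2P => //; rewrite !mxE.
have TE : (T *m g) 0 0 = g 1 0.
  by rewrite !mxE sum_ord2 !mxE /= g0 mulr0 add0r mul1r.
have uT : T *m g \in unitmx by rewrite unitmx_mul ug andbT unitmxE dT unitr1.
have T10 : T 1 0 = 0 by rewrite mxE.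
have := main _ uT; rewrite TE symmxM !det_mulmx (det_symmx_triu m T10) dT.
rewrite expr1n !mul1r; apply; apply/eqP => g10.
have : \det g = 0.
  by rewrite (expand_det_col _ 0) sum_ord2 g0 g10 !mul0r addr0.
by move=> dg; move: ug; rewrite unitmxE dg unitr0.
Qed.

End SymmetricPowerAlgebra.

(** * Symmetric powers of bundles *)

Section SymmetricPowerBundle.
Context {R : realType}.
Variables (X : riemannSurface R) (m : nat).

Lemma hat_coef_prod n (v : 'I_n -> X -> 'cV[R[i]]_2) p k :
  (forall l, mhat (v l) p) -> hat (fun z => (\prod_l linpoly (v l z))`_k) p.
Proof.
elim: n v k => [|n IH] v k hv.
  by under eq_fun do rewrite big_ord0; exact: hat_cst.
under eq_fun do rewrite big_ord_recr coef_linpoly_mul.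
have hw j := IH (fun l => v (widen_ord (leqnSn n) l)) j (fun l => hv _).
apply: hat_add; apply: hat_mul; try exact: mhatP (hv _); first exact: hw.
by case: k => [|k]; [exact: hat_cst|exact: hw].
Qed.

Lemma mhat_symprod (v : 'I_m -> X -> 'cV[R[i]]_2) p :
  (forall l, mhat (v l) p) -> mhat (fun z => symprod (fun l => v l z)) p.
Proof.
move=> hv; split=> a b; under [X in hat X _]eq_fun do rewrite mxE.
exact: hat_coef_prod.
Qed.

Lemma mhat_cols r q (M : X -> 'M[R[i]]_(r, q)) p :
  (forall j, mhat (fun z => col j (M z)) p) -> mhat M p.
Proof.
move=> h; split=> a b; have := mhatP a 0 (h b).
by under [X in hat X _ -> _]eq_fun do rewrite mxE.
Qed.

Lemma mhat_col r q (M : X -> 'M[R[i]]_(r, q)) p j :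
  mhat M p -> mhat (fun z => col j (M z)) p.
Proof.
by move=> h; under [X in mhat X _]eq_fun do rewrite colE; apply: mhat_mul => //;
  exact: mhat_cst.
Qed.

Lemma mhat_symmx (g : X -> 'M[R[i]]_2) p :
  mhat g p -> mhat (fun z => symmx m (g z)) p.
Proof.
move=> hg; apply: mhat_cols => j; under [X in mhat X _]eq_fun do rewrite col_symmx.
by apply: (mhat_symprod (v := fun l z => if (l < j)%N then col 1 (g z) else col 0 (g z)))
  => l /=; case: (l < j)%N; exact: mhat_col.
Qed.

Section Bundles.
Variables (B : vbundle X 2).
Hypothesis vB : is_vbundle B.

Lemma sym_vbundle : is_vbundle (sym_bundle m B).
Proof.
have [oB cB uB tB] := vB; split=> //.
  by move=> a p ap; apply: symmx_unit; exact: uB.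
move=> a b; apply/mholoE => p [ap bp].
have := mhat_symmx ((mholoE _ _).1 (tB a b) p (conj ap bp)).
apply: mhat_near; apply: filterS (fdom_nbhs vB ap) => z az.
by rewrite symmxM symmxV // fmx_unit.
Qed.

Lemma msec_symprod (v : 'I_m -> X -> 'cV[R[i]]_2) p :
  (forall l, msec B (v l) p) ->
  msec (sym_bundle m B) (fun z => symprod (fun l => v l z)) p.
Proof.
move=> hv; have [a ap] := fdom_ex vB p.
apply: (msec_one sym_vbundle (a := a : fidx (sym_bundle m B)) ap).
have hs : forall l, mhat (fun z => invmx (fmx a z) *m v l z) p.
  by move=> l; have [H] := hv l; exact: H.
apply: mhat_near (mhat_symprod hs).
apply: filterS (fdom_nbhs vB ap) => z az /=.
by rewrite -symmx_symprod symmxV // fmx_unit.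
Qed.

Lemma msec_symmx (F : X -> 'M[R[i]]_2) p : msec B F p ->
  msec (sym_bundle m B) (fun z => symmx m (F z)) p.
Proof.
move=> hF; apply: msec_cols => j; under [X in msec _ X _]eq_fun do rewrite col_symmx.
by apply: (msec_symprod (v := fun l z => if (l < j)%N then col 1 (F z) else col 0 (F z)))
  => l /=; case: (l < j)%N; exact: msec_col.
Qed.

Lemma frame_symmx (F : X -> 'M[R[i]]_2) p : frame B F p ->
  frame (sym_bundle m B) (fun z => symmx m (F z)) p.
Proof. by move=> [hF uF]; split; [exact: msec_symmx|exact: symmx_unit]. Qed.

End Bundles.

Lemma homat_symmx (B B' : vbundle X 2) M p : is_vbundle B -> is_vbundle B' ->
  homat B B' M p ->
  homat (sym_bundle m B) (sym_bundle m B') (fun z => symmx m (M z)) p.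
Proof.
move=> vB vB' hM; have [a ap] := fdom_ex vB p.
have fa := frame_fmx vB ap.
apply: (homat_frame (sym_vbundle vB) (frame_symmx vB fa)).
have := msec_symmx vB' (hM a ap).
by under [X in msec _ X _ -> _]eq_fun do rewrite symmxM.
Qed.

End SymmetricPowerBundle.

(** * Germs on punctured neighbourhoods and orders of vanishing *)

Section PuncturedGerms.
Context {R : realType}.

Lemma near_neq_point (X : riemannSurface R) (p q : X) : q != p ->
  \forall w \near q, w != p.
Proof.
move=> qp.
have oC : open (~` [set p]).
  apply: closed_openC => z; apply: accessible_closed_set1.
  by apply: hausdorff_accessible; exact: rs_hausdorff.
have qC : (~` [set p]) q by move=> /= E; rewrite E eqxx in qp.
by apply: filterS (open_nbhs_nbhs (conj oC qC)) => w wp; apply/eqP.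
Qed.

Definition ordn (X : riemannSurface R) r (B : vbundle X r) (p : X) (k : int)
    (s : X -> 'cV[R[i]]_r) : Prop :=
  exists2 s', nsec B s' p &
    \forall q \near p, q != p -> s q = zat p q ^ k *: s' q.

(* The filtration by the order of vanishing of the pullback along f, where f has
   ramification order [N i] over [x i]: weight t means order at least t N_i. *)
Definition ord_filt (X Y : riemannSurface R) n (x : 'I_n -> X) (N : 'I_n -> nat)
    (f : Y -> X) r (B : vbundle X r) (C : vbundle Y r) (Phi : Y -> 'M[R[i]]_r) :
    filtration X n r := fun i t s =>
  (\forall q \near x i, q != x i -> msec B s q) /\
  forall y, f y = x i ->
    ordn C y (- Num.floor (- t * (N i)%:R)) (fun z => Phi z *m s (f z)).

Lemma ord_geE (X : riemannSurface R) r (B : vbundle X r) p k s :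
  ord_ge B p k s <-> ordn B p k s.
Proof.
split=> [[U [s' [[oU Up] /hol_secE hs E]]]|[s' hs E]].
  have nU := open_nbhs_nbhs (conj oU Up).
  by exists s'; apply: filterS nU => q Uq; [exact: hs|exact: E].
have [U oU UP] := near_open (filterI hs E).
exists U, s'; split=> //; first by apply/hol_secE => q /UP[].
by move=> q /UP[].
Qed.

Lemma near_punctured_sec (X : riemannSurface R) r (B : vbundle X r) p k
    (s s' : X -> 'cV[R[i]]_r) : nsec B s' p ->
  (\forall q \near p, q != p -> s q = zat p q ^ k *: s' q) ->
  \forall q \near p, q != p -> msec B s q.
Proof.
move=> hs E.
have hp (q : X) : q != p -> \forall w \near q, w != p := @near_neq_point _ p q.
apply: filterS2 (near_nbhs E) (filterI hs (near_zat p)) => q Eq [sq [hz _ z0]] qp.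
apply: (@msec_near _ _ _ _ _ (fun q => zat p q ^ k *: s' q)).
  by apply: filterS2 Eq (hp q qp) => w Ew wp; rewrite Ew.
by apply: msec_scale => //; apply: hat_expz => //; exact: z0.
Qed.

End PuncturedGerms.

(** * The covering and the correspondence *)

Section Covering.
Context {R : realType}.
Variables (X Y : riemannSurface R) (n : nat) (x : 'I_n -> X) (N : 'I_n -> nat).
Variables (f : Y -> X) (G : finGroupType) (act : G -> Y -> Y).
Hypothesis x_inj : injective x.
Hypothesis cov : ramified_galois_covering x N f act.

Local Notation X' := (compl_pts x).

Lemma compl_ptsE p : X' p <-> forall i, p != x i.
Proof. by split=> h i; [apply/eqP|apply/eqP]; exact: h. Qed.

Lemma near_compl p : X' p -> \forall q \near p, X' q.
Proof.
move=> /compl_ptsE h.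
have : \forall q \near p, forall i, q != x i.
  by apply: filter_forall => i; exact: near_neq_point.
by apply: filterS => q hq; apply/compl_ptsE.
Qed.

Lemma open_compl : open X'.
Proof.
by rewrite openE => p /near_compl.
Qed.

Lemma near_compl_punct i : \forall q \near x i, q != x i -> X' q.
Proof.
have : \forall q \near x i, forall k, k != i -> q != x k.
  apply: filter_forall => k; have [->|ki] := eqVneq k i; first exact: filterE.
  have : \forall q \near x i, q != x k.
    by apply: near_neq_point; rewrite (inj_eq x_inj) eq_sym.
  by apply: filterS => q qk _.
apply: filterS => q hq qi; apply/compl_ptsE => k.
by have [->//|ki] := eqVneq k i; exact: hq.
Qed.

Lemma near_other i : \forall q \near x i, forall k, q = x k -> k = i.
Proof.
apply: filterS (near_compl_punct i) => q hq k qk.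
have [qi|/hq/(_ k)//] := eqVneq q (x i).
by apply: x_inj; rewrite -qk.
Qed.

Lemma cov_holo : holo_map f. Proof. by have [[]] := cov. Qed.

Lemma cov_surj p : exists y, f y = p. Proof. by have [[_ H]] := cov. Qed.

Lemma act_holo g : holo_map (act g). Proof. by have [_ [_ _ H]] := cov. Qed.

Lemma cov_act g y : f (act g y) = f y.
Proof. by have [_ _ [_ H] _ _] := cov; symmetry; apply/H; exists g. Qed.

Lemma cov_fibre y y' : f y = f y' -> exists g, y' = act g y.
Proof. by have [_ _ [_ H] _ _] := cov => /H. Qed.

Lemma near_cov y (P : set X) : nbhs (f y) P -> \forall z \near y, P (f z).
Proof. exact: holo_map_cont cov_holo _ _. Qed.

Lemma near_covY y : X' (f y) -> \forall z \near y, X' (f z).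
Proof. by move=> /near_compl/near_cov. Qed.

Lemma ram_near y e : ram_order f y e -> exists h, [/\ h y != 0,
  \forall z \near y, hat h z &
  \forall z \near y, zat (f y) (f z) = zat y z ^+ e * h z].
Proof.
move=> [U [h [[oU Uy] hh h0 E]]]; exists h; split=> //.
  apply: filterS (open_nbhs_nbhs (conj oU Uy)) => z Uz.
  exact: ((holoE _ _).1 hh).
by apply: filterS (open_nbhs_nbhs (conj oU Uy)).
Qed.

Lemma ram_pt y i : f y = x i -> exists h, [/\ h y != 0,
  \forall z \near y, hat h z &
  \forall z \near y, zat (x i) (f z) = zat y z ^+ N i * h z].
Proof.
move=> fy; have [_ _ _ _ H] := cov; have [h] := ram_near (H y i fy).
by rewrite fy => ?; exists h.
Qed.

(** For ramification order 1 the coordinate z o f is w h, and its derivative at y is the nonzero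
    value h y. *)
Lemma jac_neq0 y : X' (f y) -> jac f y != 0.
Proof.
move=> fy; have [_ _ _ H _] := cov; have [h [h0 hh E]] := ram_near (H y fy).
have hz := hat_zat (f y); have := dif_comp cov_holo hz.
rewrite dif_zat mulr1 => <-.
have hh0 := nbhs_singleton hh.
rewrite (dif_near E); last exact: (hat_comp cov_holo).
under [X in dif X _]eq_fun do rewrite expr1.
rewrite dif_mul; [|exact: hat_zat|exact: hh0].
by rewrite dif_zat zatpp mul0r addr0 mul1r.
Qed.

(** In the normal form w ^ N h, neither factor vanishes at points near y other than y, so fibres
    over S are discrete. *)
Lemma near_punct_cov y i : f y = x i -> \forall z \near y, z != y -> X' (f z).
Proof.
move=> fy; have [h [h0 hh E]] := ram_pt fy.
have hn := hat_neq0 (nbhs_singleton hh) h0.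
have hc : \forall z \near y, f z != x i -> X' (f z).
  apply: (@near_cov y [set q | q != x i -> X' q]).
  by rewrite fy; exact: near_compl_punct.
apply: filterS2 hc (filterI (filterI E hn) (near_zat y)) => z hc.
move=> [[Ez hz] [_ _ z0]] zy; apply: hc.
apply/negP => /eqP fz; move: Ez; rewrite fz zatpp => /esym/eqP.
by rewrite mulf_eq0 (negPf hz) orbF expf_eq0 (negPf (z0 zy)) andbF.
Qed.

Lemma jac_act g y : jac f y = jac (act g) y * jac f (act g y).
Proof.
rewrite -(jac_comp _ cov_holo (act_holo g)); congr (jac _ _).
by apply/funext => z /=; rewrite cov_act.
Qed.

End Covering.

Section Pullback.
Context {R : realType}.
Variables (X Y : riemannSurface R) (f : Y -> X) (r : nat) (B : vbundle X r).
Hypotheses (fh : holo_map f) (vB : is_vbundle B).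

Lemma msec_pullback q (s : X -> 'M[R[i]]_(r, q)) y :
  msec B s (f y) -> msec (pullback f B) (fun z => s (f z)) y.
Proof.
move=> [hs]; split=> a ap; exact: (mhat_comp fh (hs a ap)).
Qed.

Lemma pullback_vbundle : is_vbundle (pullback f B).
Proof.
have [oB cB uB tB] := vB; split.
- by move=> a; apply: open_comp => //= y _; have [fc _] := fh; exact: fc.
- by move=> y; have [a] := cB (f y); exists a.
- by move=> a y; exact: uB.
move=> a b; apply/mholoE => y [ap bp].
exact: (mhat_comp fh ((mholoE _ _).1 (tB a b) _ (conj ap bp))).
Qed.

End Pullback.

Section ParabolicGerms.
Context {R : realType}.
Variables (X : riemannSurface R) (n r : nat) (x : 'I_n -> X).
Variable P : parabolic X n r.

Lemma par_filt_near i t s s' : (\forall q \near x i, q != x i -> s q = s' q) ->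
  par_filt x P i t s -> par_filt x P i t s'.
Proof.
move=> E [U [u [oU hu fu Es]]]; have [W oW WP] := near_open (filterI E (open_nbhs_nbhs oU)).
exists W, u; split=> //.
  by apply/hol_secE => q /WP[_ Uq]; exact: ((hol_secE _ _ _).1 hu).
by move=> q /WP[Eq Uq] qx; rewrite -(Eq qx) Es.
Qed.

Lemma par_filt_sec i t s : par_filt x P i t s ->
  \forall q \near x i, q != x i -> msec (pbundle P) s q.
Proof.
move=> [U [u [oU hu fu Es]]].
apply: (@near_punctured_sec _ _ _ _ _ (Num.floor t) s u).
  by apply: filterS (open_nbhs_nbhs oU) => q Uq; exact: ((hol_secE _ _ _).1 hu).
by apply: filterS (open_nbhs_nbhs oU) => q Uq; exact: Es.
Qed.

End ParabolicGerms.

(** * The parabolic-orbifold correspondence on stalks *)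

Section Correspondence.
Context {R : realType}.
Variables (X Y : riemannSurface R) (n : nat) (x : 'I_n -> X) (N : 'I_n -> nat).
Variables (f : Y -> X) (G : finGroupType) (act : G -> Y -> Y).
Hypothesis x_inj : injective x.
Hypothesis cov : ramified_galois_covering x N f act.
Variables (r : nat) (E : vbundle X r) (F : filtration X n r).
Variables (V : vbundle Y r) (rho : G -> Y -> 'M[R[i]]_r) (Psi : Y -> 'M[R[i]]_r).
Hypothesis vE : is_vbundle E.
Hypothesis F_near : forall i t s s',
  (\forall q \near x i, q != x i -> s q = s' q) -> F i t s -> F i t s'.
Hypothesis F_sec : forall i t s, F i t s ->
  \forall q \near x i, q != x i -> msec E s q.
Hypothesis corr : par_orb_correspond x N f act E F V rho Psi.

Lemma Psi_hom y : compl_pts x (f y) -> homat (pullback f E) V Psi y.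
Proof. by have [[/is_homE H _] _ _] := corr; exact: H. Qed.

Lemma Psi_unit y : compl_pts x (f y) -> Psi y \in unitmx.
Proof. by have [[_ H] _ _] := corr; exact: H. Qed.

Lemma Psi_act g y : compl_pts x (f y) -> Psi (act g y) = rho g y *m Psi y.
Proof. by have [_ H _] := corr; exact: H. Qed.

Lemma Psi_msec q (s : X -> 'M[R[i]]_(r, q)) y : compl_pts x (f y) ->
  msec E s (f y) -> msec V (fun z => Psi z *m s (f z)) y.
Proof.
move=> fy hs; apply: (homat_msec (pullback_vbundle (cov_holo cov) vE)).
  exact: Psi_hom.
exact: (msec_pullback (cov_holo cov) hs).
Qed.

(** A section of the form Psi s(f) is automatically invariant, so the correspondence leaves only the
    orders at the points of the fibre. Conversely, the section that it returns equals s off [x i],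
    because f is surjective and Psi invertible there; a filtered sheaf does not see the value at
    [x i]. *)
Lemma filt_ord i t s : F i t s <-> ord_filt x N f E V Psi i t s.
Proof.
have [_ _ C] := corr; split=> [Fs|[hs os]].
  have hs := F_sec Fs; split=> // y fy.
  have [U [oU Ux] UP] := near_open (filterI hs (near_other x_inj i)).
  have Ex : exists2 s', filt_sec x E F t U s' & forall y, U (f y) ->
      compl_pts x (f y) -> Psi y *m s (f y) = Psi y *m s' (f y).
    exists s; last by [].
    split=> [|k /UP[_ /(_ k erefl)] ->//].
    apply/hol_secE => q [/UP[sq _] xq]; apply: sq.
    by move/compl_ptsE: xq; exact.
  have [[_ H] _] := (C t U (fun z => Psi z *m s (f z)) oU).2 Ex.
  by apply/ord_geE; apply: H; rewrite /= fy.
have [U [oU Ux] UP] := near_open (filterI hs (near_other x_inj i)).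
have T : twisted_sec x f V (fun i => Num.floor (- t * (N i)%:R)) (f @^-1` U)
    (fun z => Psi z *m s (f z)) /\ (forall g y, U (f y) -> compl_pts x (f y) ->
    Psi (act g y) *m s (f (act g y)) = rho g y *m (Psi y *m s (f y))).
  split; last by move=> g y _ cy; rewrite (cov_act cov) Psi_act // mulmxA.
  split.
    apply/hol_secE => y [Uy cy]; apply: Psi_msec => //.
    have [sq _] := UP _ Uy; apply: sq.
    by move/compl_ptsE: cy; exact.
  move=> y k Uy fy; apply/ord_geE; have [_ H] := UP _ Uy.
  by have ki := H k fy; rewrite ki in fy *; exact: os.
have [s' [_ Fs'] E'] := (C t U (fun z => Psi z *m s (f z)) oU).1 T.
apply: F_near (Fs' i Ux).
have nU := open_nbhs_nbhs (conj oU Ux).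
apply: filterS2 nU (near_compl_punct x_inj i) => q Uq cq qx.
have [y yq] := cov_surj cov q; have fy : compl_pts x (f y).
  by rewrite yq; exact: cq.
have := E' y; rewrite yq => /(_ Uq (cq qx)) /(congr1 (mulmx (invmx (Psi y)))).
by rewrite !mulKmx ?Psi_unit.
Qed.

(* No local inverse of f is needed: u(f) Psi e is invariant for every section e of E,
   hence comes from a section of E, which is u e. *)
Lemma hat_descend u p : (0 < r)%N -> compl_pts x p ->
  (\forall q \near p, forall y, f y = q -> hat (fun z => u (f z)) y) ->
  \forall q \near p, hat u q.
Proof.
case: r E F V rho Psi vE F_near F_sec corr Psi_hom Psi_unit Psi_act Psi_msec => // r'.
move=> E' F' V' rho' Psi' vE' _ _ corr' _ Pu Pa Pm _ cp hu.
have [a ap] := fdom_ex vE' p; have [_ _ C] := corr'.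
have [U [oU Up] UP] :=
  near_open (filterI (filterI (fdom_nbhs vE' ap) (near_compl cp)) hu).
pose e q := col 0 (fmx a q).
have [|s' [hs' _] Es] := (C 0 U (fun y => u (f y) *: (Psi' y *m e (f y))) oU).1.
  split; last first.
    by move=> g y _ cy; rewrite (cov_act cov) Pa // -scalemxAr mulmxA.
  split.
    apply/hol_secE => y [Uy cy]; have [[ay _] hy] := UP _ Uy.
    apply: msec_scale; first exact: hy.
    by apply: Pm => //; apply: msec_col; have [] := frame_fmx vE' ay.
  by move=> y i Uy fy; have [[_ /compl_ptsE/(_ i)]] := UP _ Uy; rewrite fy eqxx.
have su q : U q -> s' q = u q *: e q.
  move=> Uq; have [y yq] := cov_surj cov q; have [[_ cq] _] := UP _ Uq.
  have := Es y; rewrite yq => /(_ Uq cq) /(congr1 (mulmx (invmx (Psi' y)))).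
  by rewrite -scalemxAr !mulKmx ?Pu // yq.
have nU := open_nbhs_nbhs (conj oU Up).
apply: filterS2 nU (near_nbhs nU) => q Uq nq; have [[aq cq] _] := UP _ Uq.
have := (hol_secE _ _ _).1 hs' q (conj Uq cq) => -[/(_ a aq)/(mhatP 0 0)].
apply: hat_near; apply: filterS nq => w Uw; have [[aw _] _] := UP _ Uw.
rewrite su // -scalemxAr -col_mul mulVmx ?fmx_unit // !mxE eqxx mulr1.
by [].
Qed.

Lemma mhat_descend m l (M : X -> 'M[R[i]]_(m, l)) p : (0 < r)%N -> compl_pts x p ->
  (\forall q \near p, forall y, f y = q -> mhat (fun z => M (f z)) y) ->
  \forall q \near p, mhat M q.
Proof.
move=> r0 cp hM.
have H : \forall q \near p, forall ab : 'I_m * 'I_l, hat (fun z => M z ab.1 ab.2) q.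
  apply: filter_forall => ab.
  apply: (hat_descend (u := fun z => M z ab.1 ab.2) r0 cp).
  apply: filterS hM => q hq y yq; exact: (mhatP ab.1 ab.2 (hq y yq)).
by apply: filterS H => q hq; split=> a b; exact: (hq (a, b)).
Qed.

End Correspondence.

(** * The Gunning bundle *)

Section GunningFrames.
Context {R : realType}.

Lemma det2 (K : comNzRingType) (M : 'M[K]_2) :
  \det M = M 0 0 * M 1 1 - M 0 1 * M 1 0.
Proof.
rewrite (expand_det_row _ 0) sum_ord2 /cofactor !det_mx11 !mxE /= expr0 expr1 mul1r.
have l0 : lift 0 0 = 1 :> 'I_2 by exact/val_inj.
have l1 : lift 1 0 = 0 :> 'I_2 by exact/val_inj.
by rewrite l0 l1 mulN1r mulrN.
Qed.

Lemma row_mx2E (K : nmodType) (u v : 'cV[K]_2) (a b : 'I_2) :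
  (row_mx u v : 'M[_]_2) a b = if b == 0 then u a 0 else v a 0.
Proof.
rewrite mxE; case: splitP => k; rewrite (ord1 k) => bk.
  by have -> : b = 0 by exact/val_inj.
by have -> : b = 1 by exact/val_inj.
Qed.

Lemma col0_row_mx (K : nmodType) (u v : 'cV[K]_2) : col 0 (row_mx u v : 'M[_]_2) = u.
Proof. by apply/matrixP => a b; rewrite mxE row_mx2E ord1. Qed.

Lemma col1_row_mx (K : nmodType) (u v : 'cV[K]_2) : col 1 (row_mx u v : 'M[_]_2) = v.
Proof. by apply/matrixP => a b; rewrite mxE row_mx2E ord1. Qed.

Lemma det_row_mxZ (K : comNzRingType) (c d : K) (u v : 'cV[K]_2) :
  \det (row_mx (c *: u) (d *: v) : 'M[_]_2) = c * d * \det (row_mx u v : 'M[_]_2).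
Proof. by rewrite !det2 !row_mx2E /= !mxE; ring. Qed.

Lemma msec_row_mx (X : riemannSurface R) (B : vbundle X 2)
    (u v : X -> 'cV[R[i]]_2) p : msec B u p -> msec B v p ->
  msec B (fun q => row_mx (u q) (v q) : 'M[_]_2) p.
Proof.
move=> hu hv; apply: msec_cols; apply: ord2P.
  by under [X in msec _ X _]eq_fun do rewrite col0_row_mx.
by under [X in msec _ X _]eq_fun do rewrite col1_row_mx.
Qed.

Variables (X : riemannSurface R) (n : nat) (x : 'I_n -> X).
Hypothesis x_inj : injective x.
Variables (L : vbundle X 1) (Et E : vbundle X 2).
Hypotheses (vL : is_vbundle L) (vEt : is_vbundle Et) (vE : is_vbundle E).
Variables (inc : X -> 'M[R[i]]_(2, 1)) (prj : X -> 'M[R[i]]_(1, 2)).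
Hypotheses (inc_hom : is_hom L Et setT inc)
  (prj_hom : is_hom Et (dual_bundle L) setT prj) (exact3 : short_exact inc prj).
Variables (theta : X -> R[i]) (j : X -> 'M[R[i]]_2).
Hypotheses (pairing : is_det_pairing inc prj theta)
  (preimage : is_preimage_bundle x Et E prj j).

(** t1 generates the image of L and t2 is a member of a frame of Et that [prj] does not kill at p.
    By the pairing, g is a generator of L times the image of t2 in its dual. *)
Lemma extension_frame p : exists (t1 t2 : X -> 'cV[R[i]]_2) (g : X -> R[i]),
  [/\ \forall q \near p, [/\ msec Et t1 q, msec Et t2 q & hat g q],
      forall q, prj q *m t1 q = 0,
      g p != 0 &
      \forall q \near p, theta q * \det (row_mx (t1 q) (t2 q) : 'M[_]_2) = g q].
Proof.
have [b bp] := fdom_ex vL p; have [a ap] := fdom_ex vEt p.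
have incP q : homat L Et inc q by exact: (is_homE _ _ _ _).1 inc_hom q I.
have prjP q : homat Et (dual_bundle L) prj q.
  by exact: (is_homE _ _ _ _).1 prj_hom q I.
have prj_inc q u : prj q *m (inc q *m u) = 0 :> 'cV_1.
  by have [_ H _] := exact3 q; apply/H; exists u.
have [k k0] : exists k, (prj p *m col k (fmx a p)) 0 0 != 0.
  apply: contrapT => /forallNP H.
  have : prj p *m fmx a p = 0.
    apply/matrixP => u v; have := H v.
    by rewrite -col_mul mxE [u]ord1 => /negP/negPn/eqP ->; rewrite mxE.
  move=> /(congr1 (mulmx^~ (invmx (fmx a p)))); rewrite mulmxK ?fmx_unit // mul0mx.
  have [_ _ H3] := exact3 p; have [v E1] := H3 1%:M => p0.
  by move: E1; rewrite p0 mul0mx => /matrixP/(_ 0 0)/eqP; rewrite !mxE oner_eq0.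
exists (fun q => inc q *m fmx b q), (fun q => col k (fmx a q)).
exists (fun q => fmx b q 0 0 * (prj q *m col k (fmx a q)) 0 0); split.
- apply: filterS (filterI (fdom_nbhs vL bp) (fdom_nbhs vEt ap)) => q [bq aq].
  split; first exact: incP.
    by apply: msec_col; have [] := frame_fmx vEt aq.
  have [/(_ b bq)/(mhatP 0 k)] := prjP q a aq.
  apply: hat_near; apply: filterE => z.
  by rewrite /= trmx_inv invmxK -col_mul mxE big_ord1 !mxE.
- by move=> q; exact: prj_inc.
- rewrite mulf_neq0 //; have := fmx_unit vL bp.
  by rewrite unitmxE unitfE det_mx11.
apply: filterE => q.
rewrite {1}[fmx b q]mx11_scalar mul_mx_scalar -[col k _]scale1r det_row_mxZ.
by rewrite scale1r mulr1 mulrCA pairing.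
Qed.

(** Inside Et the subsheaf E is generated by t1 and z t2, and e consists of their lifts through j.
    Since z t2 vanishes at [x i], the second column lies in the line of larger weight; the factor z
    is also the simple zero of det j det e. *)
Lemma gunning_frame i : exists (e : X -> 'M[R[i]]_2) (g : X -> R[i]),
  [/\ nframe E e (x i), j (x i) *m col 1 (e (x i)) = 0,
      \forall q \near x i, hat g q, g (x i) != 0 &
      \forall q \near x i, theta q * \det (j q) * \det (e q) = zat (x i) q * g q].
Proof.
have [t1 [t2 [g [ht prj1 g0 tg]]]] := extension_frame (x i).
have [hj [_ pre]] := preimage.
have jP q : homat E Et j q by exact: (is_homE _ _ _ _).1 hj q I.
have [U [oU Ux] UP] := near_open (filterI (filterI ht tg)
  (filterI (near_other x_inj i) (near_zat (x i)))).
have nU := open_nbhs_nbhs (conj oU Ux).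
have [s1 /hol_secE hs1 E1] : exists2 s', hol_sec E U s' &
    forall q, U q -> t1 q = j q *m s' q.
  apply/(pre U t1 oU) => [|k _]; last exact: prj1.
  by apply/hol_secE => q /UP[[[]]].
have [s2 /hol_secE hs2 E2] : exists2 s', hol_sec E U s' &
    forall q, U q -> zat (x i) q *: t2 q = j q *m s' q.
  apply/(pre U _ oU) => [|k /UP[_ [/(_ k erefl) -> _]]].
    by apply/hol_secE => q /UP[[[_ t2q _] _] [_ [zq _ _]]]; exact: msec_scale.
  by rewrite zatpp scale0r mulmx0.
pose e q : 'M[R[i]]_2 := row_mx (s1 q) (s2 q).
have he q : U q -> msec E e q.
  by move=> Uq; apply: msec_row_mx; [exact: hs1|exact: hs2].
have je q : U q -> j q *m e q = (row_mx (t1 q) (zat (x i) q *: t2 q) : 'M[_]_2).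
  by move=> Uq; rewrite E1 // E2 // -mul_mx_row.
have dje q : U q -> \det (j q *m e q) =
    zat (x i) q * \det (row_mx (t1 q) (t2 q) : 'M[_]_2).
  by move=> Uq; rewrite je // -[t1 q]scale1r det_row_mxZ mul1r scale1r.
exists e, g; split => //; last first.
- apply: filterS nU => q Uq; rewrite -mulrA -det_mulmx dje // mulrCA.
  by congr (_ * _); have [[_ <-]] := UP _ Uq.
- by apply: filterS ht => q [].
- by rewrite col1_row_mx -E2 // zatpp scale0r.
apply: nframe_of => //; first by apply: filterS nU.
pose T q : 'M[R[i]]_2 := row_mx (t1 q) (t2 q).
have fT : frame Et T (x i).
  have [[[h1 h2 _] tgx] _] := UP _ Ux; split; first exact: msec_row_mx.
  rewrite unitmxE unitfE; apply: contraNneq g0 => T0.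
  by rewrite -tgx -/(T (x i)) T0 mulr0.
have [a ap] := fdom_ex vE (x i); have fa := frame_fmx vE ap.
have hJ := (frame_msec vEt _ fT).1 (homat_msec vE (jP (x i)) fa.1).
have hS := (frame_msec vE _ fa).1 (he _ Ux).
pose d q := \det (invmx (T q) *m (j q *m fmx a q)).
pose S q := invmx (fmx a q) *m e q.
have dS : \forall q \near x i, d q * \det (S q) = zat (x i) q.
  apply: filterS (filterI nU (filterI (fdom_nbhs vE ap) (frame_near vEt fT))) => q.
  move=> [Uq [aq uT]]; rewrite -det_mulmx /S.
  rewrite -mulmxA -[j q *m _ *m _]mulmxA mulKVmx ?fmx_unit // det_mulmx dje //.
  rewrite mulrCA -det_mulmx mulVmx // det1 mulr1.
  by [].
(* Every section of E is mapped by j into the kernel of [prj] at [x i]. If j were invertible there,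
   [prj] would vanish, against surjectivity. *)
have d0 : d (x i) = 0.
  rewrite /d det_mulmx; have [-> |/= D0] := eqVneq (\det (j (x i) *m fmx a (x i))) 0.
    by rewrite mulr0.
  have uj : j (x i) *m fmx a (x i) \in unitmx by rewrite unitmxE unitfE.
  have oa : open (fdom a) by have [] := vE.
  have pj : prj (x i) *m (j (x i) *m fmx a (x i)) = 0.
    apply: col_matrixP => k; rewrite !col_mul.
    have := (pre (fdom a) (fun q => j q *m col k (fmx a q)) oa _).2.
    rewrite col0 => /(_ _ _ i ap); apply.
      apply/hol_secE => q aq; apply: (homat_msec vE (jP q)); apply: msec_col.
      by have [] := frame_fmx vE aq.
    exists (fun q => col k (fmx a q)) => //; apply/hol_secE => q aq.
    by apply: msec_col; have [] := frame_fmx vE aq.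
  have p0 : prj (x i) = 0.
    by rewrite -(mulmxK uj (prj (x i))) pj mul0mx.
  have [_ _ /(_ 1%:M)[v /matrixP/(_ 0 0)/eqP]] := exact3 (x i).
  by rewrite p0 mul0mx !mxE oner_eq0.
(* The product [d * \det S] is the coordinate, whose derivative is 1, and d vanishes at [x i]; the
   product rule leaves dif d times det S, so det S is nonzero. *)
have uS : \det (S (x i)) != 0.
  have hd : hat d (x i) by exact: hat_det hJ.
  have hds : hat (fun q => \det (S q)) (x i) by exact: hat_det hS.
  have := dif_near dS (hat_mul hd hds).
  rewrite dif_zat (dif_mul hd hds) d0 mul0r addr0 => /eqP.
  by apply: contraTneq => ->; rewrite mulr0 eq_sym oner_eq0.
have : fmx a (x i) *m S (x i) \in unitmx.
  by rewrite unitmx_mul (fmx_unit vE ap) unitmxE unitfE.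
by rewrite mulKVmx ?fmx_unit.
Qed.

End GunningFrames.

Section GunningOrbifold.
Context {R : realType}.

Lemma floor_frac (k N : nat) : (0 < N)%N ->
  Num.floor (- (k%:R / N%:R : R) * N%:R) = - k%:Z.
Proof.
move=> N0; have -> : - (k%:R / N%:R : R) * N%:R = (- k%:Z)%:~R.
  by rewrite mulNr divfK ?mulrNz // pnatr_eq0 -lt0n.
by rewrite intrKfloor.
Qed.

Variables (X Y : riemannSurface R) (n : nat) (x : 'I_n -> X) (c : 'I_n -> nat).
Hypotheses (x_inj : injective x) (c_gt1 : forall i, (1 < c i)%N).
Variables (L : vbundle X 1) (Et E : vbundle X 2).
Hypotheses (vL : is_vbundle L) (vEt : is_vbundle Et) (vE : is_vbundle E).
Variables (inc : X -> 'M[R[i]]_(2, 1)) (prj : X -> 'M[R[i]]_(1, 2)).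
Hypotheses (inc_hom : is_hom L Et setT inc)
  (prj_hom : is_hom Et (dual_bundle L) setT prj) (exact3 : short_exact inc prj).
Variables (theta : X -> R[i]) (j : X -> 'M[R[i]]_2).
Hypotheses (pairing : is_det_pairing inc prj theta)
  (preimage : is_preimage_bundle x Et E prj j).
Local Notation N := (fun i => 2 * c i + 1)%N.
Local Notation P := (gunning_parabolic x c E j).
Variables (f : Y -> X) (G : finGroupType) (act : G -> Y -> Y).
Hypothesis cov : ramified_galois_covering x N f act.
Variables (V : vbundle Y 2) (rho : G -> Y -> 'M[R[i]]_2) (Psi : Y -> 'M[R[i]]_2).
Hypothesis vV : is_vbundle V.
Hypothesis corr : par_orb_correspond x N f act E (par_filt x P) V rho Psi.
Variable thetaY : Y -> R[i].
Hypothesis thetaY_iso : is_iso (det_bundle V) (trivial_bundle Y) setT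
                  (fun y => (thetaY y)%:M).
Hypothesis thetaY_theta : forall y, compl_pts x (f y) ->
     thetaY y * \det (Psi y) = theta (f y) * \det (j (f y)).

Lemma gunning_ord i t s : par_filt x P i t s <-> ord_filt x N f E V Psi i t s.
Proof.
apply: (filt_ord x_inj cov vE _ _ corr).
- by move=> i' t' s1 s2; exact: par_filt_near.
- by move=> i' t' s1; exact: par_filt_sec.
Qed.

(** Both weights lie in [0, 1), since c_i + 1 < 2 c_i + 1, so no power of the coordinate is split
    off; the hypothesis on j puts the second column in the line. *)
Lemma gunning_par_frame i e (k : 'I_2) : nframe E e (x i) ->
  j (x i) *m col 1 (e (x i)) = 0 ->
  par_filt x P i ((c i + k)%N%:R / (N i)%:R) (fun q => col k (e q)).
Proof.
move=> he je; have N0 : 0 < (N i)%:R :> R by rewrite ltr0n addn1.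
have fl : Num.floor ((c i + k)%N%:R / (N i)%:R : R) = 0.
  apply: floor_def; rewrite add0r ler_pdivlMr // mul0r ler0n /= ltr_pdivrMr // mul1r.
  by rewrite ltr_nat; have := ltn_ord k; have := c_gt1 i; lia.
have [U [oU Ux] UP] := near_open he.
have hk : hol_sec E U (fun q => col k (e q)).
  by apply/hol_secE => q /UP[eq _]; exact: msec_col.
exists U, (fun q => col k (e q)); split=> //.
  rewrite fl subr0; left; exists k; split => //=.
  - by move: k {fl hk}; apply: ord2P => /=; rewrite ?addn0.
  - move: k {fl hk}; apply: ord2P => // -[|//] _ /=.
    by rewrite ltr_pM2r ?invr_gt0 // ltr_nat addn1.
  - move: k {fl} hk; apply: ord2P => //= hk; exists U, (fun q => col 1 (e q)).
    by split.
by move=> q Uq _; rewrite fl expr0z scale1r.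
Qed.

Lemma thetaY_hat (a : fidx V) y : fdom a y -> hat (fun z => thetaY z * \det (fmx a z)) y.
Proof.
move=> ay; have [/is_homE/(_ y I a ay)[H] _] := thetaY_iso.
have /(mhatP 0 0) := H tt I; apply: hat_near; apply: filterE => z.
by rewrite invmx1 mul1mx mul_scalar_mx !mxE !eqxx !mulr1n.
Qed.

Lemma gunning_local i : exists2 e : X -> 'M[R[i]]_2, nframe E e (x i) &
  forall y, f y = x i -> exists2 v : Y -> 'M[R[i]]_2, nframe V v y &
    forall k : 'I_2, \forall z \near y, z != y ->
      Psi z *m col k (e (f z)) = zat y z ^+ (c i + k) *: col k (v z).
Proof.
have [e [g [he je hg g0 tg]]] := gunning_frame x_inj vL vEt vE inc_hom prj_hom
  exact3 pairing preimage i.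
exists e => // y fy; have N0 : (0 < N i)%N by rewrite addn1.
have main (k : 'I_2) : exists2 w, nsec V w y & \forall z \near y, z != y ->
    Psi z *m col k (e (f z)) = zat y z ^+ (c i + k) *: w z.
  have [_ /(_ y fy)] := (gunning_ord _ _ _).1 (gunning_par_frame k he je).
  by rewrite floor_frac // opprK.
have [w0 hw0 E0] := main 0; have [w1 hw1 E1] := main 1.
pose v z : 'M[R[i]]_2 := row_mx (w0 z) (w1 z).
have Ev k : \forall z \near y, z != y ->
    Psi z *m col k (e (f z)) = zat y z ^+ (c i + k) *: col k (v z).
  by move: k; apply: ord2P; [apply: filterS E0|apply: filterS E1] => z Ez zy;
    rewrite Ez // ?col0_row_mx ?col1_row_mx.
have hv : nsec V v y.
  by apply: filterS (filterI hw0 hw1) => z [h0 h1]; exact: msec_row_mx.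
clearbody v; exists v => //; apply: nframe_of => //.
have [h [h0 hh Ef]] := ram_pt cov fy.
have gy : nbhs (f y) (fun q => hat g q /\
    theta q * \det (j q) * \det (e q) = zat (x i) q * g q).
  by rewrite fy; exact: filterI hg tg.
have hdet : hat (fun z => thetaY z * \det (v z)) y.
  apply: (det_msec_hat vV (U0 := setT)) => //; first by move=> a z _; exact: thetaY_hat.
  exact: nsec_sec.
have hgh : hat (fun z => g (f z) * h z) y.
  apply: hat_mul; last exact: nbhs_singleton hh.
  by apply: (hat_comp (cov_holo cov)); have [] := nbhs_singleton gy.
(* The determinant of Psi e is w^N det v by the two exponents. Through [thetaY_theta] it also yields
   z g with z = w^N h. The powers of w cancel off y, and the value at y follows by continuity. *)
have key : thetaY y * \det (v y) = g (f y) * h y.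
  apply: (hat_eq_punctured hdet hgh).
  have H1 := filterI (Ev 0) (Ev 1); have H2 := near_punct_cov x_inj cov fy.
  apply: filterS2 (filterI (filterI (Ev 0) (Ev 1)) (filterI H2 (near_zat y)))
    (filterI (near_cov cov gy) Ef) => z [[e0 e1] [cz [_ _ z0]]] [[_ tz] fz] zy.
  have := tz; rewrite fz -thetaY_theta; last exact: cz.
  rewrite -mulrA -det_mulmx.
  have -> : Psi z *m e (f z) = (row_mx (zat y z ^+ (c i + 0) *: col 0 (v z))
      (zat y z ^+ (c i + 1) *: col 1 (v z)) : 'M[_]_2).
    apply: col_matrixP; apply: ord2P; rewrite col_mul ?col0_row_mx ?col1_row_mx.
      exact: e0.
    exact: e1.
  rewrite det_row_mxZ -exprD.
  have -> : (c i + 0 + (c i + 1) = N i)%N by lia.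
  have -> : \det (row_mx (col 0 (v z)) (col 1 (v z)) : 'M[_]_2) = \det (v z).
    by congr (\det _); apply: col_matrixP; apply: ord2P;
      rewrite ?col0_row_mx ?col1_row_mx.
  rewrite mulrCA -mulrA [h z * _]mulrC => /mulfI; apply.
  by rewrite expf_neq0 // z0.
rewrite unitmxE unitfE; apply: contraTneq isT => v0.
have : g (f y) * h y = 0 by rewrite -key v0 mulr0.
by move/eqP; rewrite mulf_eq0 fy (negPf g0) (negPf h0).
Qed.

End GunningOrbifold.

(** * The filtration of the symmetric power by orders of vanishing *)

Section SymmetricFiltration.
Context {R : realType}.

Lemma prod_exprz (K : fieldType) (a : K) I (l : seq I) (k : I -> int) : a != 0 ->
  \prod_(i <- l) a ^ k i = a ^ (\sum_(i <- l) k i).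
Proof.
move=> a0; elim: l => [|i l IH]; first by rewrite !big_nil expr0z.
by rewrite !big_cons IH expfzDr.
Qed.

Lemma sum_ord_ltn m (k : 'I_m.+1) : (\sum_(l < m) (l < k)%N = k)%N.
Proof.
have km : (k <= m)%N by rewrite -ltnS.
rewrite -(big_mkord xpredT (fun l => nat_of_bool (l < k)%N)) (big_cat_nat _ km) //=.
rewrite big_nat (eq_bigr (fun=> 1%N)); last by move=> l /andP[_ ->].
rewrite -big_nat sum_nat_const_nat subn0 muln1.
rewrite big_nat (eq_bigr (fun=> 0%N)); last by move=> l /andP[kl _]; rewrite ltnNge kl.
by rewrite big1_eq addn0.
Qed.

Variables (X Y : riemannSurface R) (n : nat) (x : 'I_n -> X) (N c : 'I_n -> nat).
Variables (f : Y -> X) (G : finGroupType) (act : G -> Y -> Y).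
Hypotheses (x_inj : injective x) (N_gt0 : forall i, (0 < N i)%N).
Hypothesis cov : ramified_galois_covering x N f act.
Variables (E : vbundle X 2) (F : filtration X n 2) (V : vbundle Y 2).
Variable Psi : Y -> 'M[R[i]]_2.
Hypotheses (vE : is_vbundle E) (vV : is_vbundle V).
Hypothesis filtE : forall i t s, F i t s <-> ord_filt x N f E V Psi i t s.
Hypothesis local : forall i, exists2 e : X -> 'M[R[i]]_2, nframe E e (x i) &
  forall y, f y = x i -> exists2 v : Y -> 'M[R[i]]_2, nframe V v y &
    forall k : 'I_2, \forall z \near y, z != y ->
      Psi z *m col k (e (f z)) = zat y z ^+ (c i + k) *: col k (v z).
Variable m : nat.
Hypothesis m_gt0 : (0 < m)%N.
Local Notation SE := (sym_bundle m E).
Local Notation SV := (sym_bundle m V).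

Lemma near_cov_punct y i (A : set X) : f y = x i ->
  (\forall q \near x i, q != x i -> A q) -> \forall z \near y, z != y -> A (f z).
Proof.
move=> fy hA; have H : nbhs (f y) [set q | q != x i -> A q] by rewrite fy.
apply: filterS2 (near_punct_cov x_inj cov fy) (near_cov cov H) => z cz Az zy.
by apply: Az; apply/eqP; exact: (cz zy i).
Qed.

Lemma nframe_symmx (X' : riemannSurface R) (B : vbundle X' 2) e p :
  is_vbundle B -> nframe B e p -> nframe (sym_bundle m B) (fun q => symmx m (e q)) p.
Proof. by move=> vB; apply: filterS => q; exact: frame_symmx. Qed.

(** Each of the m factors of the monomial contributes d, and each of the k factors equal to the
    second column one more. *)
Lemma sym_col (Q e v : 'M[R[i]]_2) (w : R[i]) d (k : 'I_m.+1) :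
  (forall k : 'I_2, Q *m col k e = w ^+ (d + k) *: col k v) ->
  symmx m Q *m col k (symmx m e) = w ^+ (m * d + k) *: col k (symmx m v).
Proof.
move=> H; rewrite !col_symmx symmx_symprod.
have -> : (fun l : 'I_m => Q *m (if (l < k)%N then col 1 e else col 0 e)) =
    (fun l => w ^+ (d + (l < k)%N) *: (if (l < k)%N then col 1 v else col 0 v)).
  by apply/funext => l; case: (l < k)%N; rewrite H.
rewrite symprodZ; congr (_ *: _); rewrite prodrXr; congr (_ ^+ _).
by rewrite big_split /= sum_nat_const card_ord sum_ord_ltn.
Qed.

Lemma sym_local i : exists2 e : X -> 'M[R[i]]_m.+1, nframe SE e (x i) &
  forall y, f y = x i -> exists2 v : Y -> 'M[R[i]]_m.+1, nframe SV v y &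
    forall k : 'I_m.+1, \forall z \near y, z != y ->
      symmx m (Psi z) *m col k (e (f z)) = zat y z ^+ (m * c i + k) *: col k (v z).
Proof.
have [e he ey] := local i; exists (fun q => symmx m (e q)); first exact: nframe_symmx.
move=> y /ey[v hv Ev]; exists (fun z => symmx m (v z)); first exact: nframe_symmx.
move=> k.
have H : \forall z \near y, forall k : 'I_2, z != y ->
    Psi z *m col k (e (f z)) = zat y z ^+ (c i + k) *: col k (v z).
  exact: filter_forall.
by apply: filterS H => z Ez zy; apply: sym_col => k'; exact: Ez.
Qed.

Lemma sym_ord_of i t s : sym_filt x F i t s ->
  ord_filt x N f SE SV (fun z => symmx m (Psi z)) i t s.
Proof.
move=> [M [tt [v [tE vF [U oU sE]]]]].
have nU := open_nbhs_nbhs oU.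
have hv : \forall q \near x i, forall lk : 'I_M * 'I_m, q != x i ->
    msec E (v lk.1 lk.2) q.
  by apply: filter_forall => lk; have [H _] := (filtE _ _ _).1 (vF lk.1 lk.2).
have msum (Z : riemannSurface R) (B : vbundle Z m.+1) (F' : 'I_M -> Z -> 'cV[R[i]]_m.+1) q :
    (forall l, msec B (F' l) q) -> msec B (fun z => \sum_l F' l z) q.
  move=> hF; split=> a aq; under [X in mhat X _]eq_fun do rewrite mulmx_sumr.
  split=> u w; under [X in hat X _]eq_fun do rewrite summxE.
  by apply: hat_sum => l _; have [H] := hF l; exact: (mhatP u w (H a aq)).
split.
  have H : \forall q \near x i, q != x i -> \forall z \near q, z != x i.
    by apply: filterE => q; exact: near_neq_point.
  apply: filterS2 H (filterI hv (near_nbhs nU)) => q nq [vq Uq] qx.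
  apply: (@msec_near _ _ _ _ _ (fun q => \sum_l symprod (fun k => v l k q))).
    by apply: filterS2 (nq qx) Uq => z zx Uz; rewrite sE.
  by apply: msum => l; apply: msec_symprod => // k; exact: (vq (l, k) qx).
move=> y fy.
pose ka (l : 'I_M) (k : 'I_m) : int := - Num.floor (- tt l k * (N i)%:R).
set K : int := - Num.floor _.
(* The ceiling of a sum is at most the sum of the ceilings; the surplus becomes a nonnegative power
   of the coordinate in the witness. *)
have Kle l : K <= \sum_k ka l k.
  rewrite lerNl floor_ge_int mulrNz mulNr lerN2 -(tE l) mulr_suml.
  rewrite raddf_sum /=; apply: ler_sum => k _; rewrite /ka mulrNz lerNr -mulNr.
  exact: floor_le.
have /choice[sg hsg] : forall lk : 'I_M * 'I_m, exists s' : Y -> 'cV[R[i]]_2,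
    nsec V s' y /\ \forall z \near y, z != y ->
      Psi z *m v lk.1 lk.2 (f z) = zat y z ^ ka lk.1 lk.2 *: s' z.
  move=> lk; have [_ /(_ y fy)[s' h1 h2]] := (filtE _ _ _).1 (vF lk.1 lk.2).
  by exists s'.
exists (fun z => \sum_l zat y z ^+ absz ((\sum_k ka l k)%R - K) *:
    symprod (fun k => sg (l, k) z)).
  have hs : \forall z \near y, forall lk, msec V (sg lk) z.
    by apply: filter_forall => lk; have [] := hsg lk.
  apply: filterS2 hs (near_zat y) => z hz [zz _ _]; apply: msum => l.
  apply: msec_scale; first exact: hat_exp.
  by apply: msec_symprod => // k; exact: hz.
have hE : \forall z \near y, forall lk : 'I_M * 'I_m, z != y ->
      Psi z *m v lk.1 lk.2 (f z) = zat y z ^ ka lk.1 lk.2 *: sg lk z.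
  by apply: filter_forall => lk; have [] := hsg lk.
have sE' : \forall z \near y, z != y ->
    s (f z) = \sum_l symprod (fun k => v l k (f z)).
  apply: (near_cov_punct fy (A := fun q => s q = \sum_l symprod (fun k => v l k q))).
  by apply: filterS nU => q Uq; exact: sE.
apply: filterS2 (filterI hE sE') (near_zat y) => z [Ez sz] [_ _ z0] zy.
have {}z0 := z0 zy; rewrite (sz zy) mulmx_sumr scaler_sumr; apply: eq_bigr => l _.
rewrite symmx_symprod.
have -> : (fun k => Psi z *m v l k (f z)) =
    (fun k => zat y z ^ ka l k *: sg (l, k) z).
  by apply/funext => k; exact: (Ez (l, k) zy).
rewrite symprodZ scalerA prod_exprz //; congr (_ *: _).
rewrite exprnP -expfzDr // gez0_abs ?subr_ge0 //.
by rewrite addrCA subrr addr0.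
Qed.

(* In the monomials of the frame e, put the whole excess of the order of a
   coefficient on one factor. *)
Lemma sym_ord_to i t s :
  ord_filt x N f SE SV (fun z => symmx m (Psi z)) i t s ->
  sym_filt x F i t s.
Proof.
move=> [hs os]; have [e he ey] := local i.
have hE := nframe_symmx vE he.
pose a (k : 'I_m.+1) (q : X) : R[i] := (invmx (symmx m (e q)) *m s q) k 0.
pose b (k : 'I_m.+1) (l : 'I_m) : 'I_2 := if (l < k)%N then 1 else 0.
have bE (k : 'I_m.+1) (l : 'I_m) : (b k l : nat) = (l < k)%N.
  by rewrite /b; case: (l < k)%N.
have [m' mE] : exists m', m = m'.+1 by exists m.-1; rewrite prednK.
(* The factor that will carry the coefficients; it exists because m > 0. *)
pose l0 : 'I_m := cast_ord (esym mE) ord0.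
pose u (k : 'I_m.+1) (l : 'I_m) (q : X) : 'cV[R[i]]_2 :=
  (if l == l0 then a k q else 1) *: col (b k l) (e q).
(* At l0 this is the total exponent of the other m - 1 factors, so that assigning the weight t - d /
   N to the factor l0 makes the weights add up to t. *)
pose d (k : 'I_m.+1) (l : 'I_m) : int :=
  if l == l0 then (m * c i + k)%:Z - (c i + b k l)%:Z else 0.
pose tt (k : 'I_m.+1) (l : 'I_m) : R := if l == l0 then t - (d k l)%:~R / (N i)%:R
  else (c i + b k l)%N%:R / (N i)%:R.
have NR : (N i)%:R != 0 :> R by rewrite pnatr_eq0 -lt0n.
set K : int := - Num.floor (- t * (N i)%:R) in os.
have sumb k : (\sum_l (c i + b k l) = m * c i + k)%N.
  rewrite big_split /= sum_nat_const card_ord; congr (_ + _)%N.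
  by rewrite -[RHS]sum_ord_ltn; apply: eq_bigr => l _; rewrite bE.
have ha k : \forall q \near x i, q != x i -> hat (a k) q.
  apply: filterS2 hs hE => q sq eq qx.
  by apply: mhatP; apply/(frame_msec (sym_vbundle m vE) _ eq); exact: sq.
(* In the frame Sym^m(v), the pullback of s has coefficients a_k w^(m c_i + k), and these are w^K
   times holomorphic functions by hypothesis. *)
have oa y : f y = x i -> exists2 g : Y -> 'cV[R[i]]_m.+1,
    \forall z \near y, mhat g z & \forall z \near y, z != y -> forall k : 'I_m.+1,
      a k (f z) = zat y z ^ (K - (m * c i + k)%:Z) * g z k 0.
  move=> fy; have [v hv Ev] := ey y fy; have hV := nframe_symmx vV hv.
  have [sg hsg Es] := os y fy.
  exists (fun z => invmx (symmx m (v z)) *m sg z).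
    by apply: filterS2 hV hsg => z vz sz; apply/(frame_msec (sym_vbundle m vV) _ vz).
  have H : \forall z \near y, forall k : 'I_2, z != y ->
      Psi z *m col k (e (f z)) = zat y z ^+ (c i + k) *: col k (v z).
    exact: filter_forall.
  have he' : \forall z \near y, symmx m (e (f z)) \in unitmx.
    apply: (near_cov cov (P := fun q => symmx m (e q) \in unitmx)).
    by rewrite fy; apply: filterS hE => q [].
  have hv' : \forall z \near y, symmx m (v z) \in unitmx.
    by apply: filterS hV => q [].
  apply: filterS2 (filterI (filterI H Es) (near_zat y)) (filterI he' hv').
  move=> z [[Ez sz] [_ _ z0]] [ue uv] zy k; have {}z0 := z0 zy.
  have sE : s (f z) = \sum_k a k (f z) *: col k (symmx m (e (f z))).
    rewrite -[LHS](mulKVmx ue) /a; apply/matrixP => p q; rewrite mxE summxE.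
    by apply: eq_bigr => l _; rewrite ord1 !mxE mulrC.
  have : invmx (symmx m (v z)) *m (symmx m (Psi z) *m s (f z)) =
      \col_k (a k (f z) * zat y z ^+ (m * c i + k)).
    rewrite sE mulmx_sumr.
    rewrite (eq_bigr (fun k => (a k (f z) * zat y z ^+ (m * c i + k)) *:
        col k (symmx m (v z)))); last first.
      move=> k' _; rewrite -scalemxAr (@sym_col _ _ (v z) (zat y z) (c i)) ?scalerA //.
      by move=> l; exact: Ez.
    rewrite mulmx_sumr; apply/matrixP => p q; rewrite summxE ord1 mxE (bigD1 p) //=.
    rewrite -scalemxAr -col_mul mulVmx // !mxE eqxx mulr1 big1 ?addr0 //.
    move=> l lp; rewrite -scalemxAr -col_mul mulVmx // !mxE.
    by rewrite eq_sym (negPf lp) mulr0.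
  rewrite (sz zy) -scalemxAr => /matrixP/(_ k 0); rewrite [LHS]mxE [RHS]mxE.
  move=> E1; rewrite expfzDr // mulrAC E1 exprnP -mulrA -expfzDr //.
  by rewrite subrr expr0z mulr1.
exists m.+1, tt, u; split.
- move=> k; rewrite (bigD1 l0) //=.
  rewrite (eq_bigr (fun l => (c i + b k l)%N%:R / (N i)%:R)); last first.
    by move=> l /negPf ll; rewrite /tt ll.
  rewrite -mulr_suml -natr_sum; set S := (\sum_(l < m | _) _)%N.
  have -> : tt k l0 = t - S%:R / (N i)%:R.
    rewrite /tt /d eqxx; congr (_ - _ / _).
    have := sumb k; rewrite (bigD1 l0) //= -/S => <-.
    by rewrite PoszD addrAC subrr add0r.
  by rewrite subrK.
- move=> k l; apply/filtE; split.
    apply: filterS2 (ha k) he => q aq [eq _] qx; apply: msec_scale.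
      by case: (l == l0); [exact: aq|exact: hat_cst].
    exact: msec_col.
  move=> y fy; have [v hv Ev] := ey y fy; rewrite /u /tt.
  have [ll0|_] := eqVneq l l0; last first.
    rewrite floor_frac // opprK.
    exists (fun z => col (b k l) (v z)).
      by apply: filterS hv => z [vz _]; exact: msec_col.
    apply: filterS (Ev (b k l)) => z Ez zy; rewrite scale1r Ez //.
  have [g hg ag] := oa y fy.
  exists (fun z => g z k 0 *: col (b k l) (v z)).
    apply: filterS2 hg hv => z gz [vz _]; apply: msec_scale; first exact: mhatP.
    exact: msec_col.
  apply: filterS2 (filterI (Ev (b k l)) ag) (near_zat y) => z [Ez az] [_ _ z0] zy.
  have {}z0 := z0 zy.
  rewrite -scalemxAr Ez // az // !scalerA; congr (_ *: _).
  rewrite mulrAC; congr (_ * _); rewrite exprnP -expfzDr //; congr (_ ^ _).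
  have -> : - (t - (d k l)%:~R / (N i)%:R) * (N i)%:R = - t * (N i)%:R + (d k l)%:~R.
    by rewrite opprB mulrDl divfK // addrC.
  rewrite floorDrz ?intrKfloor; last by rewrite intr_int.
  by rewrite opprD -/K /d ll0 eqxx opprB addrA addrAC.
have [U oU UP] := near_open hE; exists U => // q Uq qx.
have [_ ue] := UP q Uq; rewrite -[LHS](mulKVmx ue); apply/matrixP => p o.
rewrite mxE summxE; apply: eq_bigr => k _; rewrite ord1.
have bcol : (fun l : 'I_m => col (b k l) (e q)) =
    (fun l => if (l < k)%N then col 1 (e q) else col 0 (e q)).
  by apply/funext => l; rewrite /b; case: (l < k)%N.
rewrite symprodZ -big_mkcond big_pred1_eq bcol -col_symmx [RHS]mxE.
by rewrite [col _ _ _ _]mxE mulrC.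
Qed.

Lemma sym_ord i t s : sym_filt x F i t s <->
  ord_filt x N f SE SV (fun z => symmx m (Psi z)) i t s.
Proof. by split; [exact: sym_ord_of|exact: sym_ord_to]. Qed.

End SymmetricFiltration.

Lemma mulmx_unit_inj (K : comUnitRingType) m q (A : 'M[K]_m) (M M' : 'M[K]_(m, q)) :
  A \in unitmx -> A *m M = A *m M' -> M = M'.
Proof. by move=> uA /(congr1 (mulmx (invmx A))); rewrite !mulKmx. Qed.

(** * Pulling back and descending connections *)

Section FormDivision.
Context {R : realType}.
Variable X : riemannSurface R.

Lemma fhat_div (w u : X -> R[i]) p : fhat w p -> fhat u p -> u p != 0 ->
  hat (fun q => w q / u q) p.
Proof.
move=> hw hu u0; have ip := mem_chart_at p.
have d0 := dif_coord_neq0 ip.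
have := hat_mul (fhatP hw ip) (hat_inv _ (fhatP hu ip)).
rewrite mulf_neq0 ?invr_eq0 // => /(_ isT); apply: hat_near.
apply: filterS (cdom_nbhs ip) => q iq; rewrite invfM invrK mulrACA.
by rewrite (mulVf (dif_coord_neq0 iq)) mulr1.
Qed.

Lemma ksec_div r (B : vbundle X r) q (s : X -> 'M[R[i]]_(r, q)) (u : X -> R[i]) p :
  ksec B s p -> fhat u p -> u p != 0 -> msec B (fun z => (u z)^-1 *: s z) p.
Proof.
move=> [hs] hu u0; split=> a ap; have [H] := hs a ap.
split=> k l; under [X in hat X _]eq_fun do rewrite -scalemxAr mxE mulrC.
exact: fhat_div.
Qed.

(** The extra factor [w p] avoids the exponent k - 1, so the formula covers k = 0 and zeros of w. *)
Lemma dif_expn (w : X -> R[i]) k p : hat w p ->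
  dif (fun q => w q ^+ k) p * w p = k%:R * w p ^+ k * dif w p.
Proof.
move=> hw; elim: k => [|k IH]; first by rewrite dif_cst !mul0r.
have -> : (fun q => w q ^+ k.+1) = (fun q => w q * w q ^+ k).
  by apply/funext => q; rewrite exprS.
rewrite (dif_mul hw (hat_exp k hw)); move: IH.
move: (dif (fun q => w q ^+ k) p) (dif w p) (w p) => A d W IH.
by rewrite mulrDl -[W * A * W]mulrA IH exprS -natr1; ring.
Qed.

End FormDivision.

Lemma log_derE (R : realType) (X : riemannSurface R) r (D : operator X r) p s q :
  log_der D p s q = (zat p q / dif (zat p) q) *: D s q.
Proof. by []. Qed.

(** * Connections on two bundles identified by Phi off the ramification *)

Section OrbifoldConnections.
Context {R : realType}.
Variables (X Y : riemannSurface R) (n : nat) (x : 'I_n -> X) (N : 'I_n -> nat).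
Variables (f : Y -> X) (G : finGroupType) (act : G -> Y -> Y).
Hypotheses (x_inj : injective x) (N_gt0 : forall i, (0 < N i)%N).
Hypothesis cov : ramified_galois_covering x N f act.
Variables (r : nat) (B : vbundle X r.+1) (C : vbundle Y r.+1).
Variables (F : filtration X n r.+1) (rho : G -> Y -> 'M[R[i]]_r.+1).
Variable Phi : Y -> 'M[R[i]]_r.+1.
Hypotheses (vB : is_vbundle B) (vC : is_vbundle C).
Local Notation X' := (compl_pts x).
Hypotheses
  (Phi_hom : forall y, X' (f y) -> homat (pullback f B) C Phi y)
  (Phi_unit : forall y, X' (f y) -> Phi y \in unitmx)
  (Phi_act : forall g y, X' (f y) -> Phi (act g y) = rho g y *m Phi y)
  (rho_hom : forall g y, homat C (pullback (act g) C) (rho g) y)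
  (rho_unit : forall g y, rho g y \in unitmx).
Hypothesis filtE : forall i t s, F i t s <-> ord_filt x N f B C Phi i t s.
(** The exponents of the adapted frames, m c_i + k for the symmetric power; no upper bound is
    assumed. *)
Variable b : 'I_n -> 'I_r.+1 -> nat.
Hypothesis local : forall i, exists2 e : X -> 'M[R[i]]_r.+1, nframe B e (x i) &
  forall y, f y = x i -> exists2 v : Y -> 'M[R[i]]_r.+1, nframe C v y &
    forall k, \forall z \near y, z != y ->
      Phi z *m col k (e (f z)) = zat y z ^+ b i k *: col k (v z).
Hypothesis descend : forall m l (M : X -> 'M[R[i]]_(m, l)) p, X' p ->
  (\forall q \near p, forall y, f y = q -> mhat (fun z => M (f z)) y) ->
  \forall q \near p, mhat M q.
Variables (thB : X -> R[i]) (thC : Y -> R[i]).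
Hypotheses
  (thB_hat : forall (a : fidx B) p, X' p -> fdom a p ->
     hat (fun z => thB z * \det (fmx a z)) p)
  (thC_hat : forall (a : fidx C) y, setT y -> fdom a y ->
     hat (fun z => thC z * \det (fmx a z)) y)
  (th_rel : forall y, X' (f y) -> thC y * \det (Phi y) = thB (f y)).

Hypothesis DH : @deriv_holo R.

Let fh : holo_map f := cov_holo cov.
Let vfB : is_vbundle (pullback f B) := pullback_vbundle fh vB.

Lemma oY' : open (f @^-1` X').
Proof. by rewrite openE => y /(near_covY cov). Qed.

Lemma near_off y : \forall z \near y, z != y -> X' (f z).
Proof.
have [cy|ncy] := pselect (X' (f y)).
  by apply: filterS (near_covY cov cy) => z.
have [i fy] : exists i, f y = x i.
  by apply: contrapT => /forallNP H; apply: ncy => i; exact: H.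
exact: (near_punct_cov x_inj cov fy).
Qed.

Lemma Phi_msec q (s : X -> 'M[R[i]]_(r.+1, q)) y : X' (f y) ->
  msec B s (f y) -> msec C (fun z => Phi z *m s (f z)) y.
Proof.
by move=> cy hs; apply: (homat_msec vfB (Phi_hom cy)); exact: msec_pullback.
Qed.

Lemma Phi_nsec q (s : X -> 'M[R[i]]_(r.+1, q)) y : X' (f y) ->
  nsec B s (f y) -> nsec C (fun z => Phi z *m s (f z)) y.
Proof.
move=> cy hs; apply: filterS2 (near_covY cov cy) (near_cov cov hs) => z cz sz.
exact: Phi_msec.
Qed.

Lemma Phi_nframe F' y : X' (f y) -> nframe B F' (f y) ->
  nframe C (fun z => Phi z *m F' (f z)) y.
Proof.
move=> cy hF; apply: nframe_of => //; first by apply: Phi_nsec => //; exact: nframe_nsec.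
by rewrite unitmx_mul Phi_unit //; have [] := nframe_at hF.
Qed.

(* d(z o f) / (z o f) = nu dw / w for centred coordinates z, w, and nu = N at
   the ramification point. *)
Lemma ram_log y i : f y = x i -> exists h nu mu1 : Y -> R[i],
  [/\ \forall z \near y, [/\ hat h z, hat nu z & hat mu1 z], 
      \forall z \near y, [/\ nu z != 0, h z != 0,
        zat (x i) (f z) = zat y z ^+ N i * h z &
        (nu z)^-1 - (N i)%:R^-1 = zat y z * mu1 z] &
      \forall z \near y, dif (fun z => zat (x i) (f z)) z * zat y z =
          zat (x i) (f z) * nu z * dif (zat y) z].
Proof.
move=> fy; have [h [h0 hh Ef]] := ram_pt cov fy.
have NR : (N i)%:R != 0 :> R[i] by rewrite pnatr_eq0 -lt0n.
have hn := hat_neq0 (nbhs_singleton hh) h0.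
pose h' z := dif h z / dif (zat y) z.
have hh' : \forall z \near y, hat h' z.
  have nz := near_zat y.
  have nw : \forall z \near y, hat (zat y) z by apply: filterS nz => z [].
  apply: filterS2 (filterI (near_nbhs hh) (near_nbhs nw)) nz => z [hz wz] [_ dz _].
  by apply: fhat_div => //; exact: fhat_dif.
(* The logarithmic derivative of w^N h with respect to log w. *)
pose nu z := (N i)%:R + zat y z * h' z / h z.
have nz : \forall z \near y, hat (zat y) z by apply: filterS (near_zat y) => z [].
have hnu : \forall z \near y, hat nu z.
  apply: filterS2 (filterI hh hh') (filterI hn nz) => z [hz h'z] [n0 wz].
  apply: hat_add; first exact: hat_cst.
  apply: hat_mul; last exact: hat_inv.
  exact: hat_mul.
have nu0 : \forall z \near y, nu z != 0.
  apply: (hat_neq0 (nbhs_singleton hnu)).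
  by rewrite /nu zatpp !mul0r addr0.
(* From 1/nu - 1/N = (N - nu) / (N nu), where nu - N = w h'/h is divisible by w. *)
exists h, nu, (fun z => - (h' z / h z) / ((N i)%:R * nu z)); split.
- apply: filterS2 (filterI (filterI hh hh') hnu) (filterI hn nu0).
  move=> z [[hz h'z] nz'] [n0 nu0z]; split=> //.
  apply: hat_mul; first by apply: hat_opp; apply: hat_mul => //; exact: hat_inv.
  apply: hat_inv; first by rewrite mulf_neq0.
  by apply: hat_mul => //; exact: hat_cst.
- apply: filterS2 (filterI hn nu0) Ef => z [n0 nu0z] Ez; split=> //.
  have hN : zat y z * (h' z / h z) = nu z - (N i)%:R.
    by rewrite mulrA /nu addrAC subrr add0r.
  rewrite [RHS]mulrA mulrN hN; move: (nu z) nu0z => u u0.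
  by field; rewrite NR u0.
apply: filterS2 (filterI hn (near_nbhs Ef)) (filterI hh (near_zat y)).
move=> z [n0 Ez] [hz [wz dz _]].
rewrite (nbhs_singleton Ez) (dif_near Ez).
  rewrite dif_mul //; last exact: hat_exp.
  have := dif_expn (N i) wz; rewrite /nu /h'; move: n0 dz.
  move: (dif (fun q => zat y q ^+ N i) z) (dif h z) (dif (zat y) z) (h z) (zat y z).
  move=> A dh dw H W H0 dw0 EA.
  have -> : (A * H + W ^+ N i * dh) * W = (A * W) * H + W ^+ N i * dh * W by ring.
  by rewrite EA; field; rewrite H0 dw0.
apply: (hat_near (f := fun z => zat y z ^+ N i * h z)).
  by apply: filterS Ez => w ->.
by apply: hat_mul => //; exact: hat_exp.
Qed.

Definition pulls (D : operator X r.+1) (D' : operator Y r.+1) :=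
  pullback_connection x f B Phi D D'.

Lemma pulls_nsec D D' s y : pulls D D' -> X' (f y) -> nsec B s (f y) ->
  D' (fun z => Phi z *m s (f z)) y = jac f y *: (Phi y *m D s (f y)).
Proof.
move=> H cy hs; have [U [oU Uy UP hU]] := nsec_open (near_compl cy) hs.
exact: (H U).
Qed.

Lemma pulls_dmat D D' q (M : X -> 'M[R[i]]_(r.+1, q)) y : pulls D D' -> X' (f y) ->
  nsec B M (f y) ->
  dmat D' (fun z => Phi z *m M (f z)) y = jac f y *: (Phi y *m dmat D M (f y)).
Proof.
move=> H cy hM; apply: col_matrixP => k; rewrite col_dmat.
under [X in D' X]eq_fun do rewrite col_mul.
rewrite (pulls_nsec H cy (nsec_col k hM)) -col_dmat -col_mul.
by apply/matrixP => u v; rewrite !mxE.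
Qed.

(** The relation z d/dz = nu^-1 w d/dw between vector fields; [jac f z] appears because both sides
    are to be contracted with forms written on the preferred bases. *)
Lemma log_coef y i nu : f y = x i ->
  (\forall z \near y, nu z != 0) ->
  (\forall z \near y, dif (fun z => zat (x i) (f z)) z * zat y z =
          zat (x i) (f z) * nu z * dif (zat y) z) ->
  \forall z \near y, z != y -> zat (x i) (f z) / dif (zat (x i)) (f z) =
    (nu z)^-1 * zat y z / dif (zat y) z * jac f z.
Proof.
move=> fy nu0 dz.
have hz : \forall z \near y, [/\ hat (zat (x i)) (f z), dif (zat (x i)) (f z) != 0 &
    f z != x i -> zat (x i) (f z) != 0].
  have H : nbhs (f y) [set q | [/\ hat (zat (x i)) q, dif (zat (x i)) q != 0 &
    q != x i -> zat (x i) q != 0]] by rewrite fy; exact: near_zat.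
  exact: (near_cov cov H).
apply: filterS2 (filterI (filterI nu0 dz) hz)
  (filterI (near_punct_cov x_inj cov fy) (near_zat y)).
move=> z [[n0 Ed] [h1 h2 h3]] [cz [_ w1 w0]] zy.
have {}cz := cz zy; have {}w0 := w0 zy.
have {}h3 : zat (x i) (f z) != 0 by apply: h3; apply/eqP; exact: cz.
move: Ed; rewrite (dif_comp fh h1) => Ed.
have j0 := jac_neq0 cov cz; move: Ed h2 h3 j0 n0 w0 w1.
move: (zat (x i) (f z)) (dif (zat (x i)) (f z)) (nu z) (zat y z) (dif (zat y) z)
  (jac f z) => Z dZ v W dW J Ed dZ0 Z0 J0 v0 W0 dW0.
apply: (mulIf (mulf_neq0 (mulf_neq0 dZ0 v0) dW0)).
have -> : Z / dZ * (dZ * v * dW) = Z * v * dW by field.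
by rewrite -Ed; field; rewrite dW0 v0.
Qed.

Lemma near_punct_nsec y i s : f y = x i ->
  (\forall q \near x i, q != x i -> msec B s q) ->
  \forall z \near y, z != y -> nsec B (s : X -> 'cV_r.+1) (f z).
Proof.
move=> fy hs; apply: (near_cov_punct x_inj cov fy (A := nsec B s)).
apply: filterS (near_nbhs hs) => q sq qx.
by apply: filterS2 sq (near_neq_point qx) => w sw wx; exact: sw.
Qed.

Lemma log_pull D D' y i nu s : pulls D D' -> f y = x i ->
  (\forall z \near y, nu z != 0) ->
  (\forall z \near y, dif (fun z => zat (x i) (f z)) z * zat y z =
          zat (x i) (f z) * nu z * dif (zat y) z) ->
  (\forall q \near x i, q != x i -> msec B s q) ->
  \forall z \near y, z != y -> Phi z *m log_der D (x i) s (f z) =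
    ((nu z)^-1 * zat y z / dif (zat y) z) *: D' (fun z => Phi z *m s (f z)) z.
Proof.
move=> DD fy nu0 dz hs.
apply: filterS2 (filterI (near_punct_nsec fy hs) (log_coef fy nu0 dz))
  (near_punct_cov x_inj cov fy) => z [sz Ez] cz zy.
rewrite (pulls_nsec DD (cz zy) (sz zy)) log_derE -scalemxAr (Ez zy).
by rewrite [RHS]scalerA.
Qed.

Lemma log_msec D i s : is_connection B X' D ->
  (\forall q \near x i, q != x i -> msec B s q) ->
  \forall q \near x i, q != x i -> msec B (log_der D (x i) s) q.
Proof.
move=> cD hs.
have H : \forall q \near x i, q != x i -> X' q := near_compl_punct x_inj i.
apply: filterS2 (filterI (near_nbhs hs) H) (near_nbhs (near_zat (x i))).
move=> q [sq cq] zq qx; have [hz dz z0] := nbhs_singleton zq.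
have ns : nsec B s q.
  by apply: filterS2 sq (near_neq_point qx) => w sw wx; exact: sw.
have ks := conn_ksec vB (open_compl x) cD (cq qx) ns.
have hd : fhat (dif (zat (x i))) q.
  by apply: fhat_dif => //; apply: filterS zq => w [].
apply: (@msec_near _ _ _ _ _ (fun q => zat (x i) q *: ((dif (zat (x i)) q)^-1 *:
    D s q))).
  by apply: filterE => w; rewrite log_derE scalerA.
by apply: msec_scale => //; exact: ksec_div.
Qed.

(** Put Phi s(f) = w^k g. By the Leibniz rule nu^-1 w d/dw sends it to w^k (k/nu g + w T) with T
    holomorphic, so the order k is kept. After subtraction of t = k/N the coefficient k/nu - k/N is
    k w [mu1], and one more factor w comes out. *)
Lemma ord_log D D' y i s (k : nat) (t : R[i]) : is_connection C setT D' ->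
  pulls D D' -> f y = x i -> (\forall q \near x i, q != x i -> msec B s q) ->
  ordn C y k (fun z => Phi z *m s (f z)) ->
  let S z := Phi z *m (log_der D (x i) s (f z) - t *: s (f z)) in
  ordn C y k S /\ (t = k%:R / (N i)%:R -> ordn C y k.+1 S).
Proof.
move=> cD' DD fy hs [sg hsg Es] S.
have [h [nu [mu1 [hh hnu dz]]]] := ram_log fy.
have nu0 : \forall z \near y, nu z != 0 by apply: filterS hnu => z [].
have LP := log_pull DD fy nu0 dz hs.
have nz := near_nbhs (near_zat y).
pose T z := ((nu z)^-1 * (dif (zat y) z)^-1) *: D' sg z.
have hT : nsec C T y.
  apply: filterS2 (filterI hh nu0) (filterI (near_nbhs hsg) nz) => z.
  move=> [[_ hn _] n0] [sz wz]; have [hw dw _] := nbhs_singleton wz.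
  apply: (@msec_near _ _ _ _ _ (fun z => (nu z)^-1 *: ((dif (zat y) z)^-1 *: D' sg z))).
    by apply: filterE => w; rewrite scalerA.
  apply: msec_scale; first exact: hat_inv.
  apply: ksec_div => //; first exact: (conn_ksec vC openT cD').
  by apply: fhat_dif => //; apply: filterS wz => w [].
have SE : \forall z \near y, z != y -> S z = zat y z ^+ k *:
    ((k%:R * (nu z)^-1 - t) *: sg z + zat y z *: T z).
  apply: filterS2 (filterI LP nu0) (filterI (filterI (near_nbhs Es) (near_nbhs hsg)) nz).
  move=> z [Lz n0] [[Ez sz] wz] zy; have [hw dw w0] := nbhs_singleton wz.
  have DE : D' (fun z => Phi z *m s (f z)) z =
      D' (fun z => zat y z ^+ k *: sg z) z.
    symmetry; apply: (conn_loc openT cD') => //.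
      apply: nsec_scale => //; apply: filterS wz => w [hw' _ _]; exact: hat_exp.
    by apply: filterS2 Ez (near_neq_point zy) => w Ew wy; rewrite Ew // exprnP.
  have hwk : \forall w \near z, hat (fun w => zat y w ^+ k) w.
    by apply: filterS wz => w [hw' _ _]; exact: hat_exp.
  rewrite /S mulmxBr (Lz zy) DE (conn_leib openT cD' I hwk sz) -scalemxAr.
  rewrite (nbhs_singleton Ez zy) /T -exprnP.
  have EA := dif_expn k hw.
  have {}EA : dif (fun q => zat y q ^+ k) z =
      k%:R * zat y z ^+ k * dif (zat y) z / zat y z.
    by rewrite -EA mulfK // w0.
  rewrite EA; move: (w0 zy) dw n0.
  move: (nu z) (dif (zat y) z) (zat y z) (sg z) (D' sg z) => v d w a b' w1 d1 v1.
  apply/matrixP => p q; rewrite !mxE; move: (a p q) (b' p q) => a1 b1.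
  by field; rewrite w1 d1 v1.
split.
  exists (fun z => (k%:R * (nu z)^-1 - t) *: sg z + zat y z *: T z).
    apply: filterS2 (filterI hh nu0) (filterI (filterI hsg hT) (near_zat y)) => z.
    move=> [[_ hn _] n0] [[sz Tz] [hw _ _]]; apply: msec_add; last exact: msec_scale.
    apply: msec_scale => //; apply: hat_sub; last exact: hat_cst.
    by apply: hat_mul; [exact: hat_cst|exact: hat_inv].
  by apply: filterS SE => z Ez zy; rewrite Ez.
move=> tE; exists (fun z => (k%:R * mu1 z) *: sg z + T z).
  apply: filterS2 hh (filterI hsg hT) => z [_ _ hm] [sz Tz]; apply: msec_add => //.
  by apply: msec_scale => //; apply: hat_mul => //; exact: hat_cst.
apply: filterS2 SE hnu => z Ez [_ _ _ nE] zy; rewrite (Ez zy).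
have -> : k%:R * (nu z)^-1 - t = zat y z * (k%:R * mu1 z).
  by rewrite tE -mulrBr nE mulrCA.
by rewrite -[X in X + _]scalerA -scalerDr scalerA -exprnP exprSr.
Qed.

Lemma weight_le i (k : nat) (t : R) : - Num.floor (- t * (N i)%:R) = k%:Z ->
  t * (N i)%:R <= k%:R.
Proof.
move=> kE; have := floor_le (- t * (N i)%:R); rewrite -[Num.floor _]opprK kE.
by rewrite mulrNz mulNr lerN2.
Qed.

Lemma ceil_nat i (t : R) : 0 <= t ->
  exists k : nat, - Num.floor (- t * (N i)%:R) = k%:Z.
Proof.
move=> t0; have : 0 <= - Num.floor (- t * (N i)%:R).
  rewrite oppr_ge0 floor_le0 (le_lt_trans _ ltr01) // mulNr oppr_le0.
  by rewrite mulr_ge0.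
by case: (- Num.floor _) => // k _; exists k.
Qed.

Lemma pulls_parabolic D D' : is_connection B X' D -> is_connection C setT D' ->
  pulls D D' -> parabolic_connection x B F D.
Proof.
move=> cD cD' DD.
have NR i : (N i)%:R != 0 :> R by rewrite pnatr_eq0 -lt0n.
have Np i : 0 < (N i)%:R :> R by rewrite ltr0n.
have pres i t s : 0 <= t -> F i t s -> F i t (log_der D (x i) s).
  move=> t0 /filtE[hs os]; apply/filtE; split; first exact: log_msec.
  move=> y fy; have := os y fy; have [k ->] := ceil_nat i t0 => ok.
  have [H _] := ord_log 0 cD' DD fy hs ok; move: H.
  by under [X in ordn _ _ _ X -> _]eq_fun do rewrite scale0r subr0.
split=> //.
- by move=> i s; exact: pres.
- by move=> i t s /andP[t0 _] _; exact: pres.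
move=> i t s /andP[t0 _] _ /filtE[hs os].
have [k kE] := ceil_nat i t0; have tk := weight_le kE.
have hs' : \forall q \near x i, q != x i ->
    msec B (fun q => log_der D (x i) s q - t%:C *: s q) q.
  apply: filterS2 (log_msec cD hs) hs => q lq sq qx.
  have -> : (fun q => log_der D (x i) s q - t%:C *: s q) =
     (fun q => log_der D (x i) s q + (- t%:C) *: s q).
    by apply/funext => w; rewrite scaleNr.
  apply: msec_add; first exact: lq.
  by apply: msec_scale; [exact: hat_cst|exact: sq].
(* With k the ceiling of t N: if t N = k, the order rises to k + 1 and the weight to (k + 1)/N;
   otherwise k/N already exceeds t and keeping the order k is enough. *)
have [tE|tE] := eqVneq (t * (N i)%:R) k%:R.
  exists (k.+1%:R / (N i)%:R).
    by rewrite ltr_pdivlMr // tE ltr_nat.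
  apply/filtE; split=> // y fy; rewrite floor_frac // opprK.
  have := os y fy; rewrite kE => ok.
  have [_] := ord_log t%:C cD' DD fy hs ok; apply.
  have -> : t = k%:R / (N i)%:R by rewrite -tE mulfK.
  by rewrite fmorph_div !rmorph_nat.
exists (k%:R / (N i)%:R).
  by rewrite ltr_pdivlMr // lt_neqAle tE.
apply/filtE; split=> // y fy; rewrite floor_frac // opprK.
have := os y fy; rewrite kE => ok.
by have [H _] := ord_log t%:C cD' DD fy hs ok.
Qed.

(** In the frame Phi F' both sides of the criterion acquire the factor [jac f y], which is nonzero
    off the ramification. *)
Lemma trace_pull D D' F' y : pulls D D' -> X' (f y) -> nframe B F' (f y) ->
  trace_crit thC D' (fun z => Phi z *m F' (f z)) y <-> trace_crit thB D F' (f y).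
Proof.
move=> DD cy hF; have hFY := Phi_nframe cy hF; have j0 := jac_neq0 cov cy.
have hg := det_msec_hat vB thB_hat cy (nsec_sec (nframe_nsec hF)).
rewrite /trace_crit.
have -> : dif (fun z => thC z * \det (Phi z *m F' (f z))) y =
    jac f y * dif (fun q => thB q * \det (F' q)) (f y).
  rewrite -(dif_comp fh hg); apply: dif_near.
    apply: filterS (near_covY cov cy) => z cz.
    by rewrite det_mulmx mulrA th_rel.
  exact: (det_msec_hat vC thC_hat I (nsec_sec (nframe_nsec hFY))).
have uF : F' (f y) \in unitmx by have [] := nframe_at hF.
have -> : invmx (Phi y *m F' (f y)) *m dmat D' (fun z => Phi z *m F' (f z)) y =
    jac f y *: (invmx (F' (f y)) *m dmat D F' (f y)).
  rewrite (pulls_dmat DD cy (nframe_nsec hF)) -scalemxAr; congr (_ *: _).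
  apply: (mulmx_unit_inj (A := Phi y *m F' (f y))).
    by rewrite unitmx_mul Phi_unit.
  rewrite mulKVmx ?unitmx_mul ?Phi_unit // -mulmxA; congr (_ *m _).
  by rewrite mulKVmx.
rewrite mxtraceZ det_mulmx [thC y * (_ * _)]mulrA (th_rel cy).
move: (dif _ _) (\tr _) (thB _ * _) => A T d.
by rewrite [d * (_ * _)]mulrCA; split=> [|->//]; exact: mulfI.
Qed.

Lemma down_det D D' : is_connection B X' D -> is_connection C setT D' ->
  pulls D D' -> det_trivial C setT thC D' -> det_trivial B X' thB D.
Proof.
move=> cD cD' DD dD'; apply: (trace_det_trivial vB (open_compl x) cD thB_hat).
move=> p; have [y <-] := cov_surj cov p => cy.
have [a ap] := fdom_ex vB (f y); have hF := nframe_fmx vB ap.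
exists (fmx a); first exact: hF.
apply: (trace_pull DD cy hF).1.
exact: (det_trivial_trace openT I (Phi_nframe cy hF) dD').
Qed.

(* Powers of a coordinate at x i bring the exponents b into [0, N i). *)
Lemma weight_frame i : exists (s : X -> 'M[R[i]]_r.+1) (kp : 'I_r.+1 -> nat),
  [/\ forall k, (kp k < N i)%N,
      \forall q \near x i, q != x i -> nframe B s q &
      forall y, f y = x i -> exists2 v : Y -> 'M[R[i]]_r.+1, nframe C v y &
        forall k, \forall z \near y, z != y ->
          Phi z *m col k (s (f z)) = zat y z ^+ kp k *: col k (v z)].
Proof.
have [e he ey] := local i.
pose a k := (b i k %/ N i)%N.
have colE (A : 'M[R[i]]_r.+1) (d : 'I_r.+1 -> R[i]) k :
    col k (A *m diag_mx (\row_l d l)) = d k *: col k A.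
  by rewrite mul_mx_diag; apply/matrixP => p q; rewrite !mxE mulrC.
have unitE (A : 'M[R[i]]_r.+1) (d : 'I_r.+1 -> R[i]) : A \in unitmx ->
    (forall k, d k != 0) -> A *m diag_mx (\row_l d l) \in unitmx.
  move=> uA d0; rewrite unitmx_mul uA unitmxE unitfE det_diag.
  by apply/prodf_neq0 => k _; rewrite mxE.
(* The k-th column is divided by z^a with a the quotient of [b i k] by N. As z^a pulls back to w^(N
   a) h^a, the exponent becomes the remainder, and the unit h^a is moved into v. *)
exists (fun q => e q *m diag_mx (\row_l zat (x i) q ^- a l)).
exists (fun k => b i k %% N i)%N; split.
- by move=> k; rewrite ltn_mod.
- apply: filterS2 (near_nbhs he) (near_nbhs (near_zat (x i))) => q eq zq qx.
  have [hz dz z0] := nbhs_singleton zq; apply: nframe_of => //.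
    apply: filterS2 (filterI eq (near_neq_point qx)) zq => w [[sw _] wx] [wz _ w0].
    apply: msec_cols => k; under [X in msec _ X _]eq_fun do rewrite colE.
    apply: msec_scale; last exact: msec_col.
    apply: hat_inv; last exact: hat_exp.
    by rewrite expf_neq0 // w0.
  apply: unitE; first by have [] := nframe_at eq.
  by move=> k; rewrite invr_eq0 expf_neq0 // z0.
move=> y fy; have [v hv Ev] := ey y fy; have [h [h0 hh Ef]] := ram_pt cov fy.
have hn := hat_neq0 (nbhs_singleton hh) h0.
exists (fun z => v z *m diag_mx (\row_l h z ^- a l)).
  apply: nframe_of => //; last first.
    apply: unitE; first by have [] := nframe_at hv.
    by move=> k; rewrite invr_eq0 expf_neq0.
  apply: filterS2 hv (filterI hh hn) => z [vz _] [hz n0].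
  apply: msec_cols => k; under [X in msec _ X _]eq_fun do rewrite colE.
  apply: msec_scale; last exact: msec_col.
  by apply: hat_inv; [rewrite expf_neq0|exact: hat_exp].
move=> k; apply: filterS2 (filterI (Ev k) (near_zat y)) (filterI Ef hn).
move=> z [Ez [_ _ w0]] [fz n0] zy; have {}w0 := w0 zy.
rewrite !colE -scalemxAr (Ez zy) fz !scalerA; congr (_ *: _).
have bE : zat y z ^+ b i k = zat y z ^+ (N i * a k) * zat y z ^+ (b i k %% N i).
  by rewrite -exprD mulnC -divn_eq.
have P1 : zat y z ^+ (N i * a k) != 0 by rewrite expf_neq0.
have P2 : h z ^+ a k != 0 by rewrite expf_neq0.
rewrite exprMn -exprM bE; move: P1 P2.
move: (zat y z ^+ (N i * a k)) (h z ^+ a k) (zat y z ^+ _) => P Q S P0 Q0.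
by field; rewrite P0 Q0.
Qed.

Lemma weight_frame_filt i (s : X -> 'M[R[i]]_r.+1) (kp : 'I_r.+1 -> nat) :
  (forall k, (kp k < N i)%N) ->
  (\forall q \near x i, q != x i -> nframe B s q) ->
  (forall y, f y = x i -> exists2 v : Y -> 'M[R[i]]_r.+1, nframe C v y &
        forall k, \forall z \near y, z != y ->
          Phi z *m col k (s (f z)) = zat y z ^+ kp k *: col k (v z)) ->
  forall k, F i ((kp k)%:R / (N i)%:R) (fun q => col k (s q)).
Proof.
move=> kpN hs sv k; apply/filtE; split=> [|y fy].
  by apply: filterS hs => q sq qx; apply: msec_col; exact: (nsec_sec (nframe_nsec (sq qx))).
rewrite floor_frac // opprK; have [v hv Ev] := sv y fy.
exists (fun z => col k (v z)); first by apply: nsec_col; exact: nframe_nsec.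
exact: Ev.
Qed.

(** A column of a frame does not vanish at y, so the order of w^kp v_k is exactly kp. *)
Lemma ordn_vanish (v : Y -> 'M[R[i]]_r.+1) y k (kp : nat) (K : int) s :
  nframe C v y -> kp%:Z < K ->
  (\forall z \near y, z != y -> s z = zat y z ^+ kp *: col k (v z)) ->
  ~ ordn C y K s.
Proof.
move=> hv kK Es [u hu Eu].
have [d dE] : exists d : nat, K = kp%:Z + d.+1%:Z.
  by exists (absz (K - kp%:Z)).-1; lia.
have hk : msec C (fun z => col k (v z)) y.
  by apply: msec_col; exact: (nsec_sec (nframe_nsec hv)).
have hw : msec C (fun z => zat y z ^+ d.+1 *: u z) y.
  by apply: msec_scale; [apply: hat_exp; exact: hat_zat|exact: nsec_sec].
have : col k (v y) = zat y y ^+ d.+1 *: u y.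
  apply: (msec_eq_punctured vC hk hw).
  apply: filterS2 (filterI Es Eu) (near_zat y) => z [E1 E2] [_ _ w0] zy.
  have {}w0 := w0 zy; apply: (scalerI (expf_neq0 kp w0)).
  rewrite -E1 // E2 // dE expfzDr // -scalerA -!exprnP.
  by [].
rewrite zatpp expr0n scale0r => v0; have [_] := nframe_at hv.
move=> /(fun h => mulVmx h) /(congr1 (col k)); rewrite col_mul v0 mulmx0.
by move=> /matrixP/(_ k 0)/eqP; rewrite !mxE eqxx eq_sym oner_eq0.
Qed.

(** * Lifting a parabolic connection to the covering *)

Section Lift.
Variable D : operator X r.+1.
Hypothesis cD : is_connection B X' D.

(* The connection whose matrix in the frame [F'] is [Om]. *)
Definition lop (F' Om : Y -> 'M[R[i]]_r.+1) q (s : Y -> 'M[R[i]]_(r.+1, q)) (z : Y) :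
    'M[R[i]]_(r.+1, q) :=
  F' z *m (mdif (fun w => invmx (F' w) *m s w) z + Om z *m (invmx (F' z) *m s z)).

(** A local lift of D: d + [Om] is the pullback of D off the ramification and is holomorphic
    everywhere near y. *)
Definition compat (F' Om : Y -> 'M[R[i]]_r.+1) (y : Y) : Prop :=
  [/\ nframe C F' y, \forall z \near y, mfhat Om z &
    \forall z \near y, X' (f z) -> forall s : X -> 'cV[R[i]]_r.+1, nsec B s (f z) ->
      lop F' Om (fun w => Phi w *m s (f w)) z = jac f z *: (Phi z *m D s (f z))].

Lemma mdif_col q m (M : Y -> 'M[R[i]]_(q, m)) z k :
  mdif (fun w => col k (M w)) z = col k (mdif M z).
Proof.
apply/matrixP => u v; rewrite mdifE mxE mdifE.
by have -> : (fun w => col k (M w) u v) = (fun w => M w u k)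
  by apply/funext => w; rewrite mxE.
Qed.

Lemma lop_col F' Om z q (S : Y -> 'M[R[i]]_(r.+1, q)) k :
  lop F' Om (fun w => col k (S w)) z = col k (lop F' Om S z).
Proof.
rewrite /lop col_mul; congr (_ *m _); rewrite linearD /= -mdif_col !col_mul.
by congr (mdif _ _ + _); apply/funext => w; rewrite col_mul.
Qed.

Section OneFrame.
Variables (F' Om : Y -> 'M[R[i]]_r.+1) (z : Y).
Hypothesis hF : nframe C F' z.

Lemma lop_near q (s s' : Y -> 'M[R[i]]_(r.+1, q)) : nsec C s z ->
  (\forall w \near z, s w = s' w) -> lop F' Om s z = lop F' Om s' z.
Proof.
move=> hs ss; rewrite /lop (nbhs_singleton ss); congr (_ *m (_ + _)).
apply: mdif_near; last exact: (nbhs_singleton (nframe_coord vC hF hs)).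
by apply: filterS ss => w ->.
Qed.

Lemma lop_mul q m (S : Y -> 'M[R[i]]_(r.+1, q)) (u : Y -> 'M[R[i]]_(q, m)) :
  nsec C S z -> mhat u z ->
  lop F' Om (fun w => S w *m u w) z = S z *m mdif u z + lop F' Om S z *m u z.
Proof.
move=> hS hu; have hT := nbhs_singleton (nframe_coord vC hF hS).
have [_ uF] := nframe_at hF; rewrite /lop.
have -> : (fun w => invmx (F' w) *m (S w *m u w)) =
    (fun w => (invmx (F' w) *m S w) *m u w).
  by apply/funext => w; rewrite mulmxA.
rewrite (mdif_mul hT hu) [_ *m _ + _ *m mdif u z]addrC -addrA mulmxDr.
congr (_ + _); first by rewrite -mulmxA mulKVmx.
by rewrite -[RHS]mulmxA mulmxDl -!mulmxA.
Qed.

Lemma lop_scale q (g : Y -> R[i]) (s : Y -> 'M[R[i]]_(r.+1, q)) :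
  hat g z -> nsec C s z ->
  lop F' Om (fun w => g w *: s w) z = dif g z *: s z + g z *: lop F' Om s z.
Proof.
move=> hg hs; have hT := nbhs_singleton (nframe_coord vC hF hs).
have [_ uF] := nframe_at hF; rewrite /lop.
have -> : (fun w => invmx (F' w) *m (g w *: s w)) =
    (fun w => g w *: (invmx (F' w) *m s w)).
  by apply/funext => w; rewrite scalemxAr.
rewrite (mdif_scale hg hT) scalemxAr !mulmxDr -!scalemxAr (mulKVmx uF).
by rewrite scalerDr addrA.
Qed.

Lemma lop_self : lop F' Om F' z = F' z *m Om z.
Proof.
have [_ uF] := nframe_at hF; rewrite /lop mulVmx // mulmx1.
have -> : mdif (fun w => invmx (F' w) *m F' w) z = mdif (fun=> 1%:M) z.
  apply: mdif_near; last exact: (nbhs_singleton (nframe_coord vC hF (nframe_nsec hF))).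
  by apply: filterS hF => w [_ uw]; rewrite mulVmx.
by rewrite mdif_cst add0r.
Qed.

(** Coordinates with respect to S are pulled back from X, and on such functions the Leibniz rules of
    both sides agree, so the columns of S are enough. *)
Lemma lop_frame S : X' (f z) -> nframe B S (f z) ->
  (forall k, lop F' Om (fun w => Phi w *m col k (S (f w))) z =
     jac f z *: (Phi z *m D (fun q => col k (S q)) (f z))) ->
  forall s : X -> 'cV[R[i]]_r.+1, nsec B s (f z) ->
  lop F' Om (fun w => Phi w *m s (f w)) z = jac f z *: (Phi z *m D s (f z)).
Proof.
move=> cz hS HS s hs; have hu := nframe_coord vB hS hs.
have hu0 := nbhs_singleton hu.
set u := fun w => invmx (S w) *m s w in hu hu0.
have SE : \forall w \near f z, s w = S w *m u w.
  by apply: filterS hS => w [_ uw]; rewrite /u mulKVmx.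
rewrite (lop_near (s' := fun w => (Phi w *m S (f w)) *m u (f w))).
- rewrite lop_mul; last exact: mhat_comp.
    rewrite (mdif_comp fh hu0).
    have -> : D s (f z) = D (fun w => S w *m u w) (f z).
      exact: (conn_loc (open_compl x) cD cz hs SE).
    rewrite (conn_mul (open_compl x) cD cz (nframe_nsec hS) hu).
    rewrite mulmxDr scalerDr -scalemxAr mulmxA; congr (_ + _).
    rewrite mulmxA scalemxAl; congr (_ *m _).
    apply: col_matrixP => k; rewrite -lop_col.
    under [X in lop _ _ X]eq_fun do rewrite col_mul.
    rewrite HS -col_dmat; apply/matrixP => p q; rewrite !mxE; congr (_ * _).
    by apply: eq_bigr => l _; rewrite !mxE.
  exact: Phi_nsec cz (nframe_nsec hS).
- exact: Phi_nsec.
by apply: filterS (near_cov cov SE) => w ->; rewrite mulmxA.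
Qed.

Lemma lop_ksec q (s : Y -> 'M[R[i]]_(r.+1, q)) : nsec C s z -> mfhat Om z ->
  ksec C (lop F' Om s) z.
Proof.
move=> hs hO; apply/(frame_ksec vC _ (nframe_at hF)).
have hc := nframe_coord vC hF hs.
apply: (@mfhat_near _ _ _ _ (fun p => mdif (fun z => invmx (F' z) *m s z) p +
      Om p *m (invmx (F' p) *m s p))).
  by apply: filterS hF => w [_ uw]; rewrite /lop mulKmx.
apply: mfhat_add; first exact: mfhat_dif.
by apply: mfhat_mulr => //; exact: nbhs_singleton hc.
Qed.

End OneFrame.

Lemma compat_near F' Om y : compat F' Om y -> \forall z \near y, compat F' Om z.
Proof.
move=> [h1 h2 h3]; apply: filterS2 (near_nbhs h1) (filterI (near_nbhs h2) (near_nbhs h3)).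
by move=> z ? [? ?]; split.
Qed.

(** Off the ramification, Phi maps a frame of B to a frame of C, on which D dictates both values; at
    y the two holomorphic forms agree by continuity. This makes local lifts glue. *)
Lemma compat_uniq F1 O1 F2 O2 y (s : Y -> 'cV[R[i]]_r.+1) :
  compat F1 O1 y -> compat F2 O2 y -> nsec C s y ->
  lop F1 O1 s y = lop F2 O2 s y.
Proof.
have reg z : X' (f z) -> compat F1 O1 z -> compat F2 O2 z -> nsec C s z ->
    lop F1 O1 s z = lop F2 O2 s z.
  move=> cz [h1 _ E1] [h2 _ E2] hs; have [a ap] := fdom_ex vB (f z).
  have hF := nframe_fmx vB ap; have hG := Phi_nframe cz hF.
  set g := fun w => Phi w *m fmx a (f w) in hG.
  have hu := nbhs_singleton (nframe_coord vC hG hs).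
  have SE : \forall w \near z, s w = g w *m (invmx (g w) *m s w).
    by apply: filterS hG => w [_ uw]; rewrite mulKVmx.
  rewrite (lop_near O1 h1 hs SE) (lop_near O2 h2 hs SE).
  have nG := nframe_nsec hG.
  rewrite (lop_mul O1 h1 nG hu) (lop_mul O2 h2 nG hu).
  have gE k : (fun w => col k (g w)) = (fun w => Phi w *m col k (fmx a (f w))).
    by apply/funext => w; rewrite col_mul.
  have hk k := nsec_col k (nframe_nsec hF).
  have L1 k : col k (lop F1 O1 g z) =
      jac f z *: (Phi z *m D (fun q => col k (fmx a q)) (f z)).
    by rewrite -lop_col gE; exact: (nbhs_singleton E1 cz _ (hk k)).
  have L2 k : col k (lop F2 O2 g z) =
      jac f z *: (Phi z *m D (fun q => col k (fmx a q)) (f z)).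
    by rewrite -lop_col gE; exact: (nbhs_singleton E2 cz _ (hk k)).
  suff -> : lop F1 O1 g z = lop F2 O2 g z by [].
  by apply: col_matrixP => k; exact: etrans (L1 k) (esym (L2 k)).
move=> h1 h2 hs; have [[hF1 hO1 _] [hF2 hO2 _]] := (h1, h2).
apply: (ksec_eq_punctured vC (lop_ksec hF1 hs (nbhs_singleton hO1))
  (lop_ksec hF2 hs (nbhs_singleton hO2))).
apply: filterS2 (filterI (compat_near h1) (compat_near h2))
  (filterI (near_nbhs hs) (near_off y)).
by move=> z [? ?] [? cz] zy; apply: reg => //; exact: cz.
Qed.

Lemma compat_regular y : X' (f y) -> exists F' Om, compat F' Om y.
Proof.
move=> cy; have [a ap] := fdom_ex vB (f y); have hF := nframe_fmx vB ap.
set Fa := fmx a in hF; pose K q := invmx (Fa q) *m dmat D Fa q.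
have near_f : \forall z \near y, X' (f z) /\ nframe B Fa (f z).
  exact: filterI (near_covY cov cy) (near_cov cov (near_nbhs hF)).
have hG := Phi_nframe cy hF.
exists (fun z => Phi z *m Fa (f z)), (fun z => jac f z *: K (f z)); split=> //.
  apply: filterS near_f => z [cz Fz]; apply: mfhat_comp => //.
  apply/(frame_ksec vB _ (nframe_at Fz)).
  exact: (ksec_dmat vB (open_compl x) cD cz (nframe_nsec Fz)).
apply: filterS2 (near_nbhs hG) near_f => z Gz [cz Fz] _.
apply: (lop_frame Gz cz Fz) => k.
have -> : (fun w => Phi w *m col k (Fa (f w))) = (fun w => col k (Phi w *m Fa (f w))).
  by apply/funext => w; rewrite col_mul.
have [_ uF] := nframe_at Fz.
set H := (fun w => Phi w *m Fa (f w)) in hG Gz *.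
set Om := (fun z => jac f z *: K (f z)).
apply: (etrans (lop_col H Om z H k)); rewrite (lop_self Om Gz) -col_dmat.
have -> : H z *m Om z = jac f z *: (Phi z *m dmat D Fa (f z)).
  by rewrite /Om -scalemxAr /H -mulmxA /K mulKVmx.
by rewrite linearZ /= col_mul.
Qed.

(* Around a ramification point the weights of D are exactly what is needed for
   the pulled back connection to have no pole in the frame v. *)
Lemma compat_ramified y i : parabolic_connection x B F D -> f y = x i ->
  exists F' Om, compat F' Om y.
Proof.
move=> [_ _ _ grD] fy; have [s [kp [kpN hs sv]]] := weight_frame i.
have NR : (N i)%:R != 0 :> R by rewrite pnatr_eq0 -lt0n.
have NC : (N i)%:R != 0 :> R[i] by rewrite pnatr_eq0 -lt0n.
have Np : 0 < (N i)%:R :> R by rewrite ltr0n.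
have [v hv Ev] := sv y fy.
have [h [nu [mu1 [hh hnu dz]]]] := ram_log fy.
have nu0 : \forall z \near y, nu z != 0 by apply: filterS hnu => z [].
pose t k : R := (kp k)%:R / (N i)%:R.
have Fk k : F i (t k) (fun q => col k (s q)) := weight_frame_filt kpN hs sv k.
(* The residue condition speaks only of true weights; that [t k] is one follows from the exact order
   of the k-th column at y. *)
have wk k : is_weight F i (t k).
  exists (fun q => col k (s q)) => // -[u tu /filtE[_ /(_ y fy)]].
  apply: (ordn_vanish hv _ (Ev k)).
  rewrite ltrNr floor_lt_int mulrNz mulNr ltrN2.
  by rewrite -[X in X < _](divfK NR) ltr_pM2r.
(* Lying in V_u for some u > kp/N forces the order to be at least kp + 1. *)
have /choice[sg hsg] : forall k, exists sg : Y -> 'cV[R[i]]_r.+1, nsec C sg y /\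
    \forall z \near y, z != y ->
      Phi z *m (log_der D (x i) (fun q => col k (s q)) (f z) -
        (t k)%:C *: col k (s (f z))) = zat y z ^+ (kp k).+1 *: sg z.
  move=> k; have t01 : 0 <= t k < 1.
    by rewrite /t divr_ge0 ?ler0n //= ltr_pdivrMr // mul1r ltr_nat.
  have [u tu /filtE[_ /(_ y fy)[sg h1 h2]]] := grD i (t k) _ t01 (wk k) (Fk k).
  have [d dE] : exists d : nat, - Num.floor (- u * (N i)%:R) = (kp k).+1%:Z + d%:Z.
    have : (kp k)%:Z < - Num.floor (- u * (N i)%:R).
      rewrite ltrNr floor_lt_int mulrNz mulNr ltrN2.
      by rewrite -[X in X < _](divfK NR) ltr_pM2r.
    move: (- Num.floor _) => K kK; exists (absz (K - (kp k).+1%:Z)).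
    by lia.
  exists (fun z => zat y z ^+ d *: sg z); split.
    apply: nsec_scale => //; apply: filterS (near_zat y) => z [hz _ _].
    exact: hat_exp.
  apply: filterS2 h2 (near_zat y) => z E2 [_ _ w0] zy.
  by rewrite (E2 zy) dE expfzDr ?w0 // scalerA.
(* Obtained by solving for D' v_k. The residue condition and the Leibniz rule give nu^-1 (w/dw) D'
   v_k = (kp/N - kp/nu) v_k + w [sg k], and kp/N - kp/nu = - kp w [mu1]; dividing by w, D' v_k is dw
   times the k-th column of [tau]. *)
pose tau z : 'M[R[i]]_r.+1 := \matrix_(p, k)
  ((- mu1 z * nu z * (kp k)%:R) * v z p k + nu z * sg k z p 0).
have ctau k z : col k (tau z) =
    (- mu1 z * nu z * (kp k)%:R) *: col k (v z) + nu z *: sg k z.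
  by apply/matrixP => p q; rewrite !mxE ord1.
have nz := near_nbhs (near_zat y).
have htau : nsec C tau y.
  have hsg' : \forall z \near y, forall k, msec C (sg k) z.
    by apply: filter_forall => k; have [] := hsg k.
  apply: filterS2 (filterI hsg' hh) hv => z [sz [_ hn hm]] [vz _].
  apply: msec_cols => k; under [X in msec _ X _]eq_fun do rewrite ctau.
  apply: msec_add; apply: msec_scale => //; last exact: msec_col.
  apply: hat_mul; last exact: hat_cst.
  by apply: hat_mul => //; exact: hat_opp.
pose Om z := dif (zat y) z *: (invmx (v z) *m tau z).
exists v, Om; split=> //.
  apply: filterS2 (filterI hv htau) nz => z [vz tz] wz.
  apply: mfhat_scaler; last exact/(frame_msec vC _ vz).
  by apply: fhat_dif => //; apply: filterS wz => w [].
have hEv : \forall z \near y, forall k, z != y ->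
    Phi z *m col k (s (f z)) = zat y z ^+ kp k *: col k (v z).
  exact: filter_forall.
have hEs : \forall z \near y, forall k, z != y ->
   Phi z *m (log_der D (x i) (fun q => col k (s q)) (f z) -
        (t k)%:C *: col k (s (f z))) = zat y z ^+ (kp k).+1 *: sg k z.
  by apply: filter_forall => k; have [] := hsg k.
apply: filterS2 (filterI (filterI (near_nbhs hv) (near_nbhs hEv))
    (filterI hEs hnu)) (filterI (filterI nz (log_coef fy nu0 dz))
    (near_cov_punct x_inj cov fy hs)).
move=> z [[hvz Evz] [Esz [n0 _ _ nE]]] [[wz lc] Sz] cz.
have zy : z != y by apply/eqP => zy; apply: (cz i); rewrite zy.
apply: (lop_frame hvz cz (Sz zy)) => k.
have [hw dw w0'] := nbhs_singleton wz; have w0 := w0' zy.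
have hvk := nsec_col k (nframe_nsec hvz).
rewrite (lop_near Om (s' := fun w => zat y w ^+ kp k *: col k (v w)) hvz).
- rewrite (lop_scale Om hvz (hat_exp (kp k) hw) hvk) (lop_col v Om z v k) (lop_self Om hvz).
  have [_ uv] := nframe_at hvz.
  have -> : v z *m Om z = dif (zat y) z *: tau z by rewrite /Om -scalemxAr mulKVmx.
  have -> : col k (dif (zat y) z *: tau z) = dif (zat y) z *: col k (tau z).
    by apply/matrixP => p q; rewrite !mxE.
  rewrite ctau; have := Esz k zy.
  rewrite log_derE (lc zy) mulmxBr -!scalemxAr (nbhs_singleton Evz k zy).
  rewrite exprSr; have EA := dif_expn (kp k) hw.
  have tC : (t k)%:C = (kp k)%:R / (N i)%:R by rewrite fmorph_div !rmorph_nat.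
  rewrite tC; move: EA nE n0 dw w0.
  move: (Phi z *m D _ _) (jac f z) => PD J.
  move: (dif (fun q => zat y q ^+ kp k) z) (zat y z ^+ kp k) (col k (v z)) (sg k z).
  move: (nu z) (mu1 z) (dif (zat y) z) (zat y z) (kp k)%:R.
  move=> m u d w kk A W vk g EA nE m0 d0 w0 EP.
  (* Both sides are compared after contraction with nu^-1 w d/dw, the form in which the residue
     condition is available. *)
  have c0 : m^-1 * w / d != 0 by rewrite !mulf_neq0 ?invr_eq0.
  apply: (scalerI c0); rewrite [RHS]scalerA.
  move/eqP: EP; rewrite subr_eq => /eqP ->.
  have {}EA : A = kk * W * d / w by rewrite -EA mulfK.
  have {}nE : u = (m^-1 - (N i)%:R^-1) / w by rewrite nE mulrAC mulfV // mul1r.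
  rewrite EA nE; apply/matrixP => p q; rewrite !mxE.
  by field; rewrite w0 d0 m0 NC.
- exact: (Phi_nsec cz (nsec_col k (nframe_nsec (Sz zy)))).
by apply: filterS2 Evz (near_neq_point zy) => w Ew wy; exact: Ew.
Qed.

(** A local lift is chosen at every y and used at y only; by [compat_uniq] the one chosen at y also
    computes D' at nearby points, so D' is locally of the form d + [Om]. *)
Lemma up_exists : parabolic_connection x B F D ->
  exists2 D', is_connection C setT D' & pulls D D'.
Proof.
move=> pD.
have ex y : exists FO : (Y -> 'M[R[i]]_r.+1) * (Y -> 'M[R[i]]_r.+1), compat FO.1 FO.2 y.
  have [cy|ncy] := pselect (X' (f y)).
    by have [F' [Om H]] := compat_regular cy; exists (F', Om).
  have [i fy] : exists i, f y = x i.
    by apply: contrapT => /forallNP H; apply: ncy => i; exact: H.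
  by have [F' [Om H]] := compat_ramified pD fy; exists (F', Om).
have /choice[FO hFO] := ex.
exists (fun s y => lop (FO y).1 (FO y).2 s y).
  apply: (conn_mk vC DH openT) => y _; have [hF hO _] := hFO y.
  exists (FO y).1, (FO y).2; split=> //.
  apply: filterS (compat_near (hFO y)) => z cz s hs.
  exact: (compat_uniq (hFO z) cz hs).
move=> U s oU UX hs y Uy; have [_ _ E] := hFO y.
exact: (nbhs_singleton E (UX _ Uy) _ (hol_nsec oU Uy hs)).
Qed.

End Lift.

(** An arbitrary choice, with no continuity in p; equivariance makes what is built from it
    independent of the choice. *)
Definition point_over (p : X) : Y := projT1 (cid (cov_surj cov p)).

Lemma point_overK p : f (point_over p) = p.
Proof. exact: projT2 (cid (cov_surj cov p)). Qed.

Lemma Phi_inj q (M M' : 'M[R[i]]_(r.+1, q)) y : X' (f y) ->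
  jac f y *: (Phi y *m M) = jac f y *: (Phi y *m M') -> M = M'.
Proof.
move=> cy /(scalerI (jac_neq0 cov cy)) /(congr1 (mulmx (invmx (Phi y)))).
by rewrite !mulKmx ?Phi_unit.
Qed.

(** * Descending an equivariant connection *)

Section Descent.
Variable D' : operator Y r.+1.
Hypothesis cD' : is_connection C setT D'.
Hypothesis eD' : forall g U s, open U -> hol_sec C U s ->
  forall y, U (act g y) ->
    D' (fun y' => invmx (rho g y') *m s (act g y')) y =
    jac (act g) y *: (invmx (rho g y) *m D' s (act g y)).

Definition down_conn : operator X r.+1 := fun s p =>
  let y := point_over p in
  (jac f y)^-1 *: (invmx (Phi y) *m D' (fun z => Phi z *m s (f z)) y).

Lemma down_act g y s : X' (f y) -> nsec B s (f y) ->
  D' (fun z => Phi z *m s (f z)) y = jac (act g) y *: (invmx (rho g y) *m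
    D' (fun z => Phi z *m s (f z)) (act g y)).
Proof.
move=> cy hs; set S := fun z => Phi z *m s (f z).
have cgy : X' (f (act g y)) by rewrite (cov_act cov).
have nS : nsec C S (act g y) by apply: Phi_nsec => //; rewrite (cov_act cov).
have [U [oU Ug _ hU]] := nsec_open (filterT : nbhs (act g y) setT) nS.
rewrite -(eD' oU hU Ug); apply: (conn_loc openT cD') => //; first exact: Phi_nsec.
apply: filterS (near_covY cov cy) => z cz.
by rewrite /S (cov_act cov) Phi_act // -mulmxA mulKmx.
Qed.

(** The point y and the chosen point of its fibre differ by some g. The factors [rho g] and
    [jac (act g)] from equivariance cancel against [Phi_act] and [jac_act]. *)
Lemma down_connE y s : X' (f y) -> nsec B s (f y) ->
  D' (fun z => Phi z *m s (f z)) y = jac f y *: (Phi y *m down_conn s (f y)).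
Proof.
move=> cy hs; rewrite /down_conn; move: (point_over _) (point_overK (f y)) => y0 fy0.
set S := fun z => Phi z *m s (f z).
have [g yE] := cov_fibre cov fy0.
have cy0 : X' (f y0) by rewrite fy0.
have hs0 : nsec B s (f y0) by rewrite fy0.
have j0 := jac_neq0 cov cy0.
have jj := jac_act cov g y0.
have jg0 : jac (act g) y0 != 0 by apply: contraNneq j0 => E; rewrite jj E mul0r.
have jy0 : jac f (act g y0) != 0 by apply: contraNneq j0 => E; rewrite jj E mulr0.
rewrite (down_act g cy0 hs0) -/S yE -[invmx (Phi y0) *m (_ *: _)]scalemxAr scalerA.
rewrite -[Phi _ *m (_ *: _)]scalemxAr scalerA jj.
have -> : jac f (act g y0) * ((jac (act g) y0 * jac f (act g y0))^-1 *
    jac (act g) y0) = 1.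
  move: jg0 jy0; move: (jac (act g) y0) (jac f (act g y0)) => u v u0 v0.
  by field; rewrite u0 v0.
rewrite scale1r (Phi_act g cy0) -mulmxA (mulKVmx (Phi_unit cy0)).
by rewrite mulKVmx.
Qed.

Lemma down_pulls : pulls down_conn D'.
Proof.
move=> U s oU UX hs y Uy; apply: down_connE; first exact: UX.
exact: (hol_nsec oU Uy hs).
Qed.

(** The formula is checked upstairs: the coordinates of s are pulled back, so the Leibniz rule of D'
    yields pulled back terms, and [Phi_inj] brings them down. *)
Lemma down_local F' q s : X' q -> nframe B F' q -> nsec B s q ->
  down_conn s q = F' q *m (mdif (fun z => invmx (F' z) *m s z) q +
    invmx (F' q) *m dmat down_conn F' q *m (invmx (F' q) *m s q)).
Proof.
have [y <-] := cov_surj cov q => cy hF hs.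
set u := fun z => invmx (F' z) *m s z.
have hu := nframe_coord vB hF hs; have hu0 := nbhs_singleton hu.
have hFY := Phi_nframe cy hF.
have huY : \forall z \near y, mhat (fun z => u (f z)) z.
  by apply: filterS (near_cov cov hu) => z; exact: mhat_comp.
have E1 : D' (fun z => Phi z *m s (f z)) y =
    D' (fun z => (Phi z *m F' (f z)) *m u (f z)) y.
  apply: (conn_loc openT cD') => //; first exact: Phi_nsec.
  apply: filterS (near_cov cov hF) => z [_ uz].
  by rewrite /u -mulmxA mulKVmx.
have uF : F' (f y) \in unitmx by have [] := nframe_at hF.
apply: (Phi_inj cy); rewrite -down_connE // E1.
rewrite (conn_mul openT cD' I (nframe_nsec hFY) huY).
rewrite (mdif_comp fh hu0) (pulls_dmat down_pulls cy (nframe_nsec hF)).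
rewrite -scalemxAr -scalemxAl -scalerDr -!mulmxA -mulmxDr; congr (_ *: (_ *m _)).
by rewrite mulmxDr mulKVmx.
Qed.

(** Functions descend rather than forms, so the connection matrix is divided by d(coord i). Upstairs
    this quotient is the matrix of D' divided by the differential of coord i o f, which has no zero
    off the ramification. *)
Lemma down_form F' p : X' p -> nframe B F' p ->
  \forall q \near p, mfhat (fun q => invmx (F' q) *m dmat down_conn F' q) q.
Proof.
move=> cp hF; have ip := mem_chart_at p; set i := chart_at p in ip.
pose M q := (dif (coord i) q)^-1 *: (invmx (F' q) *m dmat down_conn F' q).
have hM : \forall q \near p, mhat M q.
  apply: descend => //.
  apply: filterS2 (filterI (near_nbhs (near_compl cp)) (near_nbhs hF))
    (cdom_nbhs ip) => q [cq Fq] iq y fy.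
  have cy : X' (f y) by rewrite fy; exact: nbhs_singleton cq.
  have hFy : nframe B F' (f y) by rewrite fy.
  have hFY := Phi_nframe cy hFy.
  have K := (frame_ksec vC _ (nframe_at hFY)).1
    (ksec_dmat vC openT cD' I (nframe_nsec hFY)).
  have iy : cdom i (f y) by rewrite fy.
  have ni := near_cov cov (cdom_nbhs iy).
  have hw : fhat (dif (fun z => coord i (f z) : R[i])) y.
    apply: fhat_dif => //; apply: filterS ni => z iz.
    exact: (hat_comp fh (hat_coord iz)).
  have w0 : dif (fun z => coord i (f z) : R[i]) y != 0.
    rewrite (dif_comp fh (hat_coord iy)).
    exact: (mulf_neq0 (jac_neq0 cov cy) (dif_coord_neq0 iy)).
  have [K'] := K.
  have H : mhat (fun z => (dif (fun z => coord i (f z) : R[i]) z)^-1 *: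
      (invmx (Phi z *m F' (f z)) *m dmat D' (fun z => Phi z *m F' (f z)) z)) y.
    by split=> k l; under [X in hat X _]eq_fun do rewrite mxE mulrC;
      exact: fhat_div.
  apply: mhat_near H.
  have nF : \forall z \near y, nframe B F' (f z) := near_cov cov (near_nbhs hFy).
  apply: filterS2 (filterI (near_covY cov cy) ni) nF => z [cz iz] Fz.
  rewrite /M (dif_comp fh (hat_coord iz)) (pulls_dmat down_pulls cz (nframe_nsec Fz)).
  have uF : F' (f z) \in unitmx by have [] := nframe_at Fz.
  rewrite -scalemxAr scalerA.
  have -> : (jac f z * dif (coord i) (f z))^-1 * jac f z = (dif (coord i) (f z))^-1.
    by rewrite invfM mulrAC (mulVf (jac_neq0 cov cz)) mul1r.
  congr (_ *: _); apply: (mulmx_unit_inj (A := Phi z *m F' (f z))).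
    by rewrite unitmx_mul Phi_unit.
  rewrite mulKVmx ?unitmx_mul ?Phi_unit // -mulmxA; congr (_ *m _).
  by rewrite mulKVmx.
apply: filterS2 (near_nbhs hM) (near_nbhs (cdom_nbhs ip)) => q hq iq.
split=> k l; apply: (fhat_one DH (nbhs_singleton iq)).
apply: hat_near (mhatP k l (nbhs_singleton hq)).
by apply: filterE => z; rewrite mxE mulrC.
Qed.

Lemma down_connection : is_connection B X' down_conn.
Proof.
apply: (conn_mk vB DH (open_compl x)) => p cp.
have [a ap] := fdom_ex vB p; have hF := nframe_fmx vB ap.
exists (fmx a), (fun q => invmx (fmx a q) *m dmat down_conn (fmx a) q); split=> //.
  exact: down_form.
apply: filterS2 (near_nbhs hF) (near_compl cp) => q Fq cq s hs.
exact: down_local.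
Qed.

End Descent.

(** * Equivariance of the lift and its determinant *)

Section Equivariance.
Variables (D : operator X r.+1) (D' : operator Y r.+1).
Hypotheses (cD : is_connection B X' D) (cD' : is_connection C setT D').
Hypothesis DD : pulls D D'.

Lemma act_msec g q (s : Y -> 'M[R[i]]_(r.+1, q)) y : msec C s (act g y) ->
  msec C (fun z => invmx (rho g z) *m s (act g z)) y.
Proof.
move=> hs; have gh := act_holo cov g.
apply: (homat_msec (pullback_vbundle gh vC)).
  exact: (homat_inv vC (pullback_vbundle gh vC) (@rho_hom g y) (rho_unit g y)).
exact: msec_pullback.
Qed.

Lemma act_nsec g q (s : Y -> 'M[R[i]]_(r.+1, q)) y : nsec C s (act g y) ->
  nsec C (fun z => invmx (rho g z) *m s (act g z)) y.
Proof.
move=> hs; apply: filterS (holo_map_cont (act_holo cov g) hs) => z.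
exact: act_msec.
Qed.

Lemma act_ksec g q (s : Y -> 'M[R[i]]_(r.+1, q)) y : ksec C s (act g y) ->
  ksec C (fun z => jac (act g) z *: (invmx (rho g z) *m s (act g z))) y.
Proof.
move=> [hs]; have gh := act_holo cov g.
have H : ksec (pullback (act g) C) (fun z => jac (act g) z *: s (act g z)) y.
  split=> a ap; have K := mfhat_comp DH gh (hs a ap).
  by apply: mfhat_near K; apply: filterE => z; rewrite scalemxAr.
have K := homat_ksec (pullback_vbundle gh vC)
  (homat_inv vC (pullback_vbundle gh vC) (@rho_hom g y) (rho_unit g y)) H.
by apply: ksec_near K; apply: filterE => z; rewrite scalemxAr.
Qed.

(** The frame H = Phi e satisfies H(g y) = rho(g) H(y), and D' H is the pullback of D e. With s = H
    u, both sides then involve only the derivative of u, which [act g] multiplies by its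
    jacobian. *)
Lemma up_act_regular g s y : X' (f y) -> nsec C s (act g y) ->
  D' (fun z => invmx (rho g z) *m s (act g z)) y =
  jac (act g) y *: (invmx (rho g y) *m D' s (act g y)).
Proof.
move=> cy hs; have gh := act_holo cov g.
have cgy : X' (f (act g y)) by rewrite (cov_act cov).
have [a ap] := fdom_ex vB (f y); have hF := nframe_fmx vB ap.
have hFg : nframe B (fmx a) (f (act g y)) by rewrite (cov_act cov).
pose H z := Phi z *m fmx a (f z).
have hH : nframe C H y := Phi_nframe cy hF.
have hHg : nframe C H (act g y) := Phi_nframe cgy hFg.
set u := fun z => invmx (H z) *m s z.
have hu : \forall z \near act g y, mhat u z := nframe_coord vC hHg hs.
have hu0 : mhat u (act g y) := nbhs_singleton hu.
have hug : \forall z \near y, mhat (fun z => u (act g z)) z.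
  by apply: filterS (holo_map_cont gh hu) => z; exact: mhat_comp.
have E1 : D' s (act g y) = D' (fun z => H z *m u z) (act g y).
  apply: (conn_loc openT cD') => //.
  by apply: filterS hHg => z [_ uz]; rewrite /u mulKVmx.
have E2 : D' (fun z => invmx (rho g z) *m s (act g z)) y =
    D' (fun z => H z *m u (act g z)) y.
  apply: (conn_loc openT cD') => //; first exact: act_nsec.
  have nH := holo_map_cont gh hHg.
  apply: filterS2 nH (near_covY cov cy) => z [_ uz] cz.
  have HE : H (act g z) = rho g z *m H z.
    by rewrite /H (cov_act cov) Phi_act // mulmxA.
  rewrite /u HE -{1}(mulKVmx uz (s (act g z))) HE.
  by rewrite -[rho g z *m H z *m _]mulmxA mulKmx.
clearbody u.
have M1 := conn_mul openT cD' I (nframe_nsec hHg) hu.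
have M2 := conn_mul openT cD' I (nframe_nsec hH) hug.
have P1 : dmat D' H (act g y) = jac f (act g y) *: (Phi (act g y) *m dmat D (fmx a) (f y)).
  by rewrite /H (pulls_dmat DD cgy (nframe_nsec hFg)) (cov_act cov).
have P2 : dmat D' H y = jac f y *: (Phi y *m dmat D (fmx a) (f y)).
  exact: pulls_dmat DD cy (nframe_nsec hF).
have HE : H (act g y) = rho g y *m H y.
  by rewrite /H (cov_act cov) Phi_act // mulmxA.
rewrite (mdif_comp gh hu0) P2 in M2; rewrite P1 HE (Phi_act g cy) in M1.
apply: (etrans (etrans E2 M2)); rewrite (etrans E1 M1) (jac_act cov g y).
move: (mdif u _) (u _) (dmat D _ _) (jac f _) (jac (act g) y) (H y) (Phi y).
move=> du u1 dm j1 j2 H1 Ph.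
have -> : rho g y *m H1 *m du + j1 *: (rho g y *m Ph *m dm) *m u1 =
    rho g y *m (H1 *m du + j1 *: (Ph *m dm *m u1)).
  by rewrite mulmxDr -scalemxAl -scalemxAr !mulmxA.
rewrite mulKmx // scalerDr -scalemxAr scalerA; congr (_ + _).
by rewrite -scalemxAl.
Qed.

Lemma up_act g s y : nsec C s (act g y) ->
  D' (fun z => invmx (rho g z) *m s (act g z)) y =
  jac (act g) y *: (invmx (rho g y) *m D' s (act g y)).
Proof.
move=> hs; have nS := act_nsec hs.
apply: (ksec_eq_punctured vC (conn_ksec vC openT cD' I nS)
  (act_ksec (conn_ksec vC openT cD' I hs))).
have ns := holo_map_cont (act_holo cov g) (near_nbhs hs).
apply: filterS2 ns (near_off y) => z sz cz zy.
exact: (up_act_regular (cz zy) sz).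
Qed.

Lemma up_equivariant g U s : open U -> hol_sec C U s ->
  forall y, U (act g y) ->
    D' (fun y' => invmx (rho g y') *m s (act g y')) y =
    jac (act g) y *: (invmx (rho g y) *m D' s (act g y)).
Proof.
by move=> oU hs y Uy; apply: up_act; exact: (hol_nsec oU Uy hs).
Qed.

(** At a ramification point the trace criterion equates two holomorphic 1-forms, so it may be tested
    at nearby points, where [trace_pull] reduces it to D. *)
Lemma up_det : det_trivial B X' thB D -> det_trivial C setT thC D'.
Proof.
move=> dD.
have cD'0 : is_connection C (f @^-1` X') D' by move=> U oU _; exact: cD'.
have thC0 (a : fidx C) y : (f @^-1` X') y -> fdom a y ->
    hat (fun z => thC z * \det (fmx a z)) y by move=> _; exact: thC_hat.
have d0 : det_trivial C (f @^-1` X') thC D'.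
  apply: (trace_det_trivial vC oY' cD'0 thC0) => y cy.
  have [a ap] := fdom_ex vB (f y); have hF := nframe_fmx vB ap.
  exists (fun z => Phi z *m fmx a (f z)); first exact: Phi_nframe.
  apply: (trace_pull DD cy hF).2.
  exact: (det_trivial_trace (open_compl x) cy hF dD).
apply: (trace_det_trivial vC openT cD' thC_hat) => y _.
have [a ap] := fdom_ex vC y; have hF := nframe_fmx vC ap.
exists (fmx a) => //.
have hd : \forall z \near y, hat (fun z => thC z * \det (fmx a z)) z.
  by apply: filterS hF => z [vz _]; exact: (det_msec_hat vC thC_hat I vz).
have K := (frame_ksec vC _ (nframe_at hF)).1
  (ksec_dmat vC openT cD' I (nframe_nsec hF)).
have ht : fhat (fun z => thC z * \det (fmx a z) *
    \tr (invmx (fmx a z) *m dmat D' (fmx a) z)) y.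
  apply: fhat_mul (nbhs_singleton hd) _.
  by apply: fhat_sum => k _; case: K.
apply: (fhat_eq_punctured (fhat_dif DH hd) ht).
apply: filterS2 (near_nbhs hF) (near_off y) => z Fz cz zy.
exact: (det_trivial_trace oY' (cz zy) Fz d0).
Qed.

End Equivariance.

Lemma filt_near i t s s' : (\forall q \near x i, q != x i -> s q = s' q) ->
  F i t s -> F i t s'.
Proof.
move=> E /filtE[hs os]; apply/filtE; split.
  apply: filterS2 (near_nbhs E) hs => q Eq sq qx.
  apply: (msec_near _ (sq qx)).
  by apply: filterS2 Eq (near_neq_point qx) => w Ew wx; exact: Ew.
move=> y fy; have [sg hsg Es] := os y fy; exists sg => //.
have H : \forall z \near y, f z != x i -> s (f z) = s' (f z).
  by apply: (near_cov cov (P := fun q => q != x i -> s q = s' q)); rewrite fy.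
apply: filterS2 (filterI H Es) (near_punct_cov x_inj cov fy) => z [Ez Sz] cz zy.
by rewrite -Sz // Ez //; apply/eqP; exact: (cz zy).
Qed.

(** * Gauge transformations *)

Definition twined (A : X -> 'M[R[i]]_r.+1) (A' : Y -> 'M[R[i]]_r.+1) (y : Y) : Prop :=
  X' (f y) -> Phi y *m A (f y) = A' y *m Phi y.

Lemma twinedE A A' y : twined A A' y -> X' (f y) ->
  A' y = Phi y *m A (f y) *m invmx (Phi y).
Proof. by move=> H cy; rewrite H // mulmxK // Phi_unit. Qed.

Lemma twined_inv A A' y : A (f y) \in unitmx -> A' y \in unitmx ->
  twined A A' y -> twined (fun p => invmx (A p)) (fun z => invmx (A' z)) y.
Proof.
move=> uA uA' H cy; apply: (mulmx_unit_inj uA').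
by rewrite mulKVmx // mulmxA -(H cy) mulmxK.
Qed.

Lemma homat_pullback A y : homat B B A (f y) ->
  homat (pullback f B) (pullback f B) (fun z => A (f z)) y.
Proof.
move=> hA a ap.
exact (msec_pullback fh (hA a ap)).
Qed.

Section GaugeUp.
Variable A : X -> 'M[R[i]]_r.+1.
Hypothesis A_hom : forall p, X' p -> homat B B A p.
Hypothesis A_filt : forall i t s, F i t s -> F i t (fun q => A q *m s q).

(* A preserves weights, so at a ramification point Phi A maps w^kp v_k to
   w^kp (holomorphic), that is A' v_k is holomorphic. *)
Lemma gauge_extension (y : Y) : exists M : Y -> 'M[R[i]]_r.+1,
  (\forall z \near y, homat C C M z) /\ (\forall z \near y, twined A M z).
Proof.
have [cy|ncy] := pselect (X' (f y)).
  exists (fun z => Phi z *m A (f z) *m invmx (Phi z)); split.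
    apply: filterS (near_covY cov cy) => z cz.
    have hi := homat_inv vfB vC (Phi_hom cz) (Phi_unit cz).
    have h1 := homat_comp vfB hi (homat_pullback (A_hom cz)).
    apply: homat_near (homat_comp vfB h1 (Phi_hom cz)).
    by apply: filterE => w; rewrite mulmxA.
  by apply: filterE => z cz; rewrite mulmxKV ?Phi_unit.
have [i fy] : exists i, f y = x i.
  by apply: contrapT => /forallNP H; apply: ncy => i; exact: H.
have [s [kp [kpN hs sv]]] := weight_frame i.
have [v hv Ev] := sv y fy.
have /choice[sg hsg] : forall k, exists sg : Y -> 'cV[R[i]]_r.+1, nsec C sg y /\
    \forall z \near y, z != y ->
      Phi z *m (A (f z) *m col k (s (f z))) = zat y z ^+ kp k *: sg z.
  move=> k; have := A_filt (weight_frame_filt kpN hs sv k).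
  move=> /filtE[_ /(_ y fy)]; rewrite floor_frac // opprK => -[sg h1 h2].
  by exists sg.
pose S z : 'M[R[i]]_r.+1 := \matrix_(p, k) sg k z p 0.
have Sc k z : col k (S z) = sg k z by apply/matrixP => p q; rewrite !mxE ord1.
have hS : \forall z \near y, msec C S z.
  have H : \forall z \near y, forall k, msec C (sg k) z.
    by apply: filter_forall => k; have [] := hsg k.
  apply: filterS H => z Hz; apply: msec_cols => k.
  by under [X in msec _ X _]eq_fun do rewrite Sc.
exists (fun z => S z *m invmx (v z)); split.
  apply: filterS2 (near_nbhs hv) hS => z hvz Sz.
  apply: (homat_frame vC (nframe_at hvz)); apply: msec_near Sz.
  by apply: filterS hvz => w [_ uw]; rewrite mulmxKV.
have hEv : \forall z \near y, forall k, z != y ->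
    Phi z *m col k (s (f z)) = zat y z ^+ kp k *: col k (v z).
  exact: filter_forall.
have hEs : \forall z \near y, forall k, z != y ->
    Phi z *m (A (f z) *m col k (s (f z))) = zat y z ^+ kp k *: sg k z.
  by apply: filter_forall => k; have [] := hsg k.
apply: filterS2 (filterI hEv hEs) (filterI hv (near_zat y)).
move=> z [Ez Esz] [[_ uv] [_ _ w0]] cz.
have zy : z != y by apply/eqP => zy; apply: (cz i); rewrite zy.
have {}w0 := w0 zy; have uP := Phi_unit cz.
suff E : Phi z *m A (f z) *m invmx (Phi z) *m v z = S z.
  by rewrite -E (mulmxK uv) (mulmxKV uP).
apply: col_matrixP => k; rewrite Sc col_mul.
apply: (scalerI (expf_neq0 (kp k) w0)).
by rewrite -Esz // scalemxAr -Ez // -!mulmxA mulKmx.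
Qed.

End GaugeUp.

Section GaugeUpIso.
Variable A : X -> 'M[R[i]]_r.+1.
Hypothesis A_iso : is_iso B B X' A.

Lemma A_homat p : X' p -> homat B B A p.
Proof. by have [/is_homE H _] := A_iso; exact: H. Qed.

Lemma A_unitmx p : X' p -> A p \in unitmx.
Proof. by have [_] := A_iso; exact. Qed.

Hypothesis A_filt : forall i t s, F i t s <-> F i t (fun q => A q *m s q).

(** The condition on the filtration is an equivalence, so the inverse of A extends as well; the
    product of the two extensions is 1 off the ramification, hence also at y. *)
Lemma gauge_extension_unit (y : Y) : exists M : Y -> 'M[R[i]]_r.+1,
  [/\ \forall z \near y, homat C C M z, \forall z \near y, twined A M z &
      M y \in unitmx].
Proof.
have [M [hM tM]] := gauge_extension A_homat (fun i t s => (A_filt i t s).1) y.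
have inv_hom p : X' p -> homat B B (fun q => invmx (A q)) p.
  by move=> cp; exact: (homat_inv vB vB (A_homat cp) (A_unitmx cp)).
have inv_filt i t s : F i t s -> F i t (fun q => invmx (A q) *m s q).
  move=> Fs; apply/A_filt; apply: filt_near Fs.
  apply: filterS (near_compl_punct x_inj i) => q cq qx.
  by rewrite mulKVmx // A_unitmx //; exact: (cq qx).
have [M2 [hM2 tM2]] := gauge_extension inv_hom inv_filt y.
exists M; split=> //.
have h1 : homat C C (fun z => M2 z *m M z) y.
  exact: (homat_comp vC (nbhs_singleton hM) (nbhs_singleton hM2)).
have h2 : homat C C (fun=> 1%:M) y.
  move=> a ap; apply: (@msec_near _ _ _ _ _ (fmx a)).
    by apply: filterE => z; rewrite mul1mx.
  by have [] := frame_fmx vC ap.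
have E : M2 y *m M y = 1%:M.
  apply: (homat_eq_punctured vC vC h1 h2).
  apply: filterS2 (filterI tM tM2) (near_off y) => z [t1 t2] cz zy.
  have {}cz := cz zy; rewrite (twinedE t1 cz) (twinedE t2 cz).
  rewrite -!mulmxA mulKmx ?Phi_unit // [invmx (A _) *m _]mulmxA.
  by rewrite mulVmx ?A_unitmx // mul1mx mulmxV ?Phi_unit.
by have [] := mulmx1_unit E.
Qed.

Lemma gauge_up : exists A' : Y -> 'M[R[i]]_r.+1,
  [/\ is_iso C C setT A', forall y, twined A A' y &
      forall g y, A' (act g y) *m rho g y = rho g y *m A' y].
Proof.
have /choice[M hM] := gauge_extension_unit.
(* Only the value at y of the extension chosen for y is kept. Near y this agrees with [M y], because
   A determines every extension off the ramification. *)
pose A' y := M y y.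
have loc y : \forall z \near y, A' z = M y z.
  have [_ ty _] := hM y; apply: filterS2 ty (near_off y) => z tz cz.
  have [->//|zy] := eqVneq z y; have {}cz := cz zy.
  have [_ tz' _] := hM z; rewrite (twinedE tz cz).
  exact: (twinedE (nbhs_singleton tz') cz).
have tw y : twined A A' y by have [_ ty _] := hM y; exact: nbhs_singleton ty.
have hA y : homat C C A' y.
  have [hy _ _] := hM y; apply: homat_near (nbhs_singleton hy).
  by apply: filterS (loc y) => z ->.
exists A'; split=> //.
  by split=> [|y _]; [apply/is_homE => y _; exact: hA|have [] := hM y].
have reg g y : X' (f y) -> A' (act g y) *m rho g y = rho g y *m A' y.
  move=> cy; have cgy : X' (f (act g y)) by rewrite (cov_act cov).
  apply: (can_inj (mulmxK (Phi_unit cy))).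
  rewrite -!mulmxA -(Phi_act g cy) -(tw _ cgy) -(tw _ cy).
  by rewrite (cov_act cov) Phi_act // mulmxA.
move=> g y; have gh := act_holo cov g; have vgC := pullback_vbundle gh vC.
have h1 : homat C (pullback (act g) C) (fun z => A' (act g z) *m rho g z) y.
  apply: (homat_comp vgC (@rho_hom g y)) => a ap.
  exact (msec_pullback gh (hA (act g y) a ap)).
have h2 : homat C (pullback (act g) C) (fun z => rho g z *m A' z) y.
  exact: (homat_comp vC (@hA y) (@rho_hom g y)).
apply: (homat_eq_punctured vC vgC h1 h2).
by apply: filterS (near_off y) => z cz zy; exact: (reg g z (cz zy)).
Qed.

End GaugeUpIso.

Lemma gauge_germs (Z : riemannSurface R) (W : vbundle Z r.+1) (U0 : set Z)
    (D1 D2 : operator Z r.+1) (A : Z -> 'M[R[i]]_r.+1) : open U0 ->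
  (forall U s, open U -> U `<=` U0 -> hol_sec W U s ->
    forall p, U p -> D2 (fun q => A q *m s q) p = A p *m D1 s p) <->
  (forall s p, U0 p -> nsec W s p -> D2 (fun q => A q *m s q) p = A p *m D1 s p).
Proof.
move=> oU0; split=> [H s p U0p hs|H U s oU UU0 hs p Up].
  have [U [oU Up UP hU]] := nsec_open (open_nbhs_nbhs (conj oU0 U0p)) hs.
  exact: (H U).
by apply: H; [exact: UU0|exact: (hol_nsec oU Up hs)].
Qed.

Section Gauge.
Variables (D1 D2 : operator X r.+1) (D1' D2' : operator Y r.+1).
Hypotheses (cD1 : is_connection B X' D1) (cD2 : is_connection B X' D2)
  (cD1' : is_connection C setT D1') (cD2' : is_connection C setT D2')
  (DD1 : pulls D1 D1') (DD2 : pulls D2 D2').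

Lemma gauge_lift :
  gauge_equiv B X' (fun A => forall i t s,
    F i t s <-> F i t (fun q => A q *m s q)) D1 D2 ->
  gauge_equiv C setT (fun A => forall g y,
    A (act g y) *m rho g y = rho g y *m A y) D1' D2'.
Proof.
move=> [A [A_iso A_filt /(gauge_germs _ _ _ _ (open_compl x)) A_id]].
have [A' [iA' tA eA]] := gauge_up A_iso A_filt.
have hA' y : homat C C A' y by have [/is_homE H _] := iA'; exact: H.
have nA' s y : nsec C s y -> nsec C (fun z => A' z *m s z) y.
  by move=> hs; apply: filterS hs => z; exact: (homat_msec vC (@hA' z)).
exists A'; split=> //; apply/(gauge_germs _ _ _ _ openT).
have reg s y : X' (f y) -> nsec C s y ->
    D2' (fun z => A' z *m s z) y = A' y *m D1' s y.
  move=> cy hs.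
  have [a ap] := fdom_ex vB (f y); have hF := nframe_fmx vB ap.
  have nF := nframe_nsec hF.
  pose H z := Phi z *m fmx a (f z).
  have hH : nframe C H y := Phi_nframe cy hF.
  set u := fun z => invmx (H z) *m s z.
  have hu : \forall z \near y, mhat u z := nframe_coord vC hH hs.
  have E1 : D1' s y = D1' (fun z => H z *m u z) y.
    apply: (conn_loc openT cD1') => //.
    by apply: filterS hH => z [_ uz]; rewrite /u mulKVmx.
  pose AF q := A q *m fmx a q.
  have nAF : nsec B AF (f y).
    apply: filterS2 nF (near_compl cy) => q sq cq.
    exact: (homat_msec vB (A_homat A_iso cq) sq).
  have E2 : D2' (fun z => A' z *m s z) y =
      D2' (fun z => (Phi z *m AF (f z)) *m u z) y.
    apply: (conn_loc openT cD2') => //; first exact: nA'.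
    apply: filterS2 hH (near_covY cov cy) => z [_ uz] cz.
    by rewrite /AF mulmxA (tA z cz) -!mulmxA [Phi z *m (_ *m _)]mulmxA /u mulKVmx.
  have M1 := conn_mul openT cD1' I (nframe_nsec hH) hu.
  have M2 := conn_mul openT cD2' I (Phi_nsec cy nAF) hu.
  have P1 : dmat D1' H y = jac f y *: (Phi y *m dmat D1 (fmx a) (f y)).
    exact: (pulls_dmat DD1 cy nF).
  have P2 : dmat D2' (fun z => Phi z *m AF (f z)) y =
      jac f y *: (Phi y *m (A (f y) *m dmat D1 (fmx a) (f y))).
    rewrite (pulls_dmat DD2 cy nAF); congr (_ *: (_ *m _)).
    apply: col_matrixP => k; rewrite col_dmat col_mul col_dmat.
    rewrite -(A_id _ _ cy (nsec_col k nF)); congr (D2 _ _).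
    by apply/funext => q; rewrite col_mul.
  apply: (etrans (etrans E2 M2)); rewrite (etrans E1 M1) P1 P2.
  by rewrite /AF /H mulmxDr -!scalemxAl -scalemxAr !mulmxA (tA y cy).
move=> s y _ hs.
have k1 : ksec C (D2' (fun z => A' z *m s z)) y := conn_ksec vC openT cD2' I (nA' _ _ _ hs).
have k2 : ksec C (fun z => A' z *m D1' s z) y.
  exact: (homat_ksec vC (@hA' y) (conn_ksec vC openT cD1' I hs)).
apply: (ksec_eq_punctured vC k1 k2).
apply: filterS2 (near_nbhs hs) (near_off y) => z sz cz zy.
exact: (reg s z (cz zy) sz).
Qed.

(** A' is holomorphic at the points of the fibre, so it cannot lower an order of vanishing. *)
Lemma twined_filt A A' : (forall p, X' p -> homat B B A p) ->
  (forall y, homat C C A' y) -> (forall y, twined A A' y) ->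
  forall i t s, F i t s -> F i t (fun q => A q *m s q).
Proof.
move=> hA hA' tA i t s /filtE[hs os]; apply/filtE; split.
  apply: filterS2 hs (near_compl_punct x_inj i) => q sq cq qx.
  exact: (homat_msec vB (hA q (cq qx)) (sq qx)).
move=> y fy; have [sg hsg Es] := os y fy.
exists (fun z => A' z *m sg z).
  by apply: filterS hsg => z; exact: (homat_msec vC (@hA' z)).
apply: filterS2 Es (near_off y) => z Ez cz zy.
by rewrite mulmxA (tA z (cz zy)) -mulmxA Ez // scalemxAr.
Qed.

Lemma gauge_down :
  gauge_equiv C setT (fun A => forall g y,
    A (act g y) *m rho g y = rho g y *m A y) D1' D2' ->
  gauge_equiv B X' (fun A => forall i t s,
    F i t s <-> F i t (fun q => A q *m s q)) D1 D2.
Proof.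
move=> [A' [[/is_homE hA' uA'] eA /(gauge_germs _ _ _ _ openT) A_id]].
have {}hA' y : homat C C A' y := hA' y I.
have {}uA' y : A' y \in unitmx := uA' y I.
(* The value does not depend on the point of the fibre, since A' commutes with [rho]; holomorphy
   then follows from [descend]. *)
pose A p := let y := point_over p in invmx (Phi y) *m (A' y *m Phi y).
have tA y : twined A A' y.
  move=> cy; have := point_overK (f y); rewrite /A /=.
  move: (point_over _) => y0 fy0; have [g yE] := cov_fibre cov fy0.
  have cy0 : X' (f y0) by rewrite fy0.
  rewrite yE (Phi_act g cy0) -mulmxA (mulKVmx (Phi_unit cy0)) !mulmxA.
  by rewrite eA.
have AE y : X' (f y) -> A (f y) = invmx (Phi y) *m (A' y *m Phi y).
  by move=> cy; rewrite -tA // mulKmx // Phi_unit.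
clearbody A.
have uA p : X' p -> A p \in unitmx.
  have [y <-] := cov_surj cov p => cy.
  by rewrite AE // !unitmx_mul unitmx_inv Phi_unit ?uA'.
have hA p : X' p -> homat B B A p.
  move=> cp a ap; apply: (msec_one vB ap); apply: (nbhs_singleton (p := p)).
  apply: descend => //.
  apply: filterS2 (near_compl cp) (near_nbhs (fdom_nbhs vB ap)) => q cq aq y fy.
  have cy : X' (f y) by rewrite fy.
  have ay : fdom a (f y) by rewrite fy; exact: nbhs_singleton aq.
  have hF := nframe_fmx vB ay; have hH := Phi_nframe cy hF.
  have K := (frame_msec vC _ (nframe_at hH)).1
    (homat_msec vC (@hA' y) (nsec_sec (nframe_nsec hH))).
  apply: mhat_near K.
  apply: filterS2 (near_covY cov cy) (near_cov cov hF) => z cz [_ uz].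
  rewrite (AE z cz); apply: (mulmx_unit_inj (A := Phi z *m fmx a (f z))).
    by rewrite unitmx_mul Phi_unit.
  rewrite mulKVmx ?unitmx_mul ?Phi_unit // -!mulmxA (mulKVmx uz).
  by rewrite mulKVmx ?Phi_unit.
have iA : is_iso B B X' A by split=> //; apply/is_homE.
exists A; split=> //; last first.
  apply/(gauge_germs _ _ _ _ (open_compl x)) => s p.
  have [y <-] := cov_surj cov p => cy hs.
  have hAs : nsec B (fun q => A q *m s q) (f y).
    apply: filterS2 hs (near_compl cy) => q sq cq.
    exact: (homat_msec vB (hA q cq) sq).
  apply: (Phi_inj cy); rewrite -(pulls_nsec DD2 cy hAs) mulmxA (tA y cy).
  rewrite -mulmxA scalemxAr -(pulls_nsec DD1 cy hs) -A_id //.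
    apply: (conn_loc openT cD2' I (Phi_nsec cy hAs)).
    by apply: filterS (near_covY cov cy) => z cz; rewrite !mulmxA (tA z cz).
  exact: Phi_nsec.
move=> i t s; split; first exact: (twined_filt hA hA' tA).
(* The converse implication for the filtration is the direct one applied to the inverses. *)
have hA2 p : X' p -> homat B B (fun q => invmx (A q)) p.
  by move=> cp; exact: (homat_inv vB vB (hA p cp) (uA p cp)).
have hA2' y : homat C C (fun z => invmx (A' z)) y.
  exact: (homat_inv vC vC (@hA' y) (uA' y)).
have tA2 y : twined (fun q => invmx (A q)) (fun z => invmx (A' z)) y.
  by move=> cy; apply: (twined_inv (uA _ cy) (uA' y) (tA y)).
move=> /(twined_filt hA2 hA2' tA2); apply: filt_near.
apply: filterS (near_compl_punct x_inj i) => q cq qx.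
by rewrite mulKmx // uA //; exact: (cq qx).
Qed.

End Gauge.

End OrbifoldConnections.

(** The class map sends k to everything related to a member of k. Totality of [rel] makes values
    nonempty and all classes reached; its compatibility with [e] and [e'] makes each value a single
    class and the map injective. *)
Lemma classes_bij (S T : Type) (P : S -> Prop) (Q : T -> Prop)
    (e : S -> S -> Prop) (e' : T -> T -> Prop) (rel : S -> T -> Prop) :
  (forall s, P s -> exists2 t, Q t & rel s t) ->
  (forall t, Q t -> exists2 s, P s & rel s t) ->
  (forall s1 s2 t1 t2, P s1 -> P s2 -> Q t1 -> Q t2 -> rel s1 t1 -> rel s2 t2 ->
     e s1 s2 <-> e' t1 t2) ->
  exists Phi, set_bij (classes P e) (classes Q e') Phi /\
    forall s t, P s -> Q t -> rel s t -> Phi (class_of P e s) = class_of Q e' t.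
Proof.
move=> up down ee.
pose Phi (k : set S) : set T := [set t | Q t /\ exists2 s, k s & rel s t].
have PhiE s t : P s -> Q t -> rel s t -> Phi (class_of P e s) = class_of Q e' t.
  move=> Ps Qt st; apply/seteqP; split=> t'.
    move=> [Qt' [s' [Ps' es] st']]; split=> //.
    exact: ((ee s s' t t' Ps Ps' Qt Qt' st st').1 es).
  move=> [Qt' et]; split=> //; have [s' Ps' st'] := down t' Qt'.
  by exists s' => //; split=> //; apply/(ee s s' t t').
have Phi_sub s1 s2 : P s1 -> P s2 -> Phi (class_of P e s1) = Phi (class_of P e s2) ->
    class_of P e s1 `<=` class_of P e s2.
  move=> P1 P2 E s [Ps es]; split=> //.
  have [t Qt st] := up s Ps; have [t2 Q2 st2] := up s2 P2.
  have : Phi (class_of P e s1) t by split=> //; exists s.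
  by rewrite E (PhiE s2 t2) // => -[_ et]; apply/(ee s2 s t2 t).
exists Phi; split=> //; split.
- by move=> _ [s Ps ->]; have [t Qt st] := up s Ps; exists t => //; exact: PhiE.
- move=> k1 k2 /set_mem[s1 P1 ->] /set_mem[s2 P2 ->] E.
  by apply/seteqP; split; apply: Phi_sub.
- move=> _ [t Qt ->]; have [s Ps st] := down t Qt.
  by exists (class_of P e s); [exists s|exact: PhiE].
Qed.

Lemma det_symmx_hat (R : realType) (X : riemannSurface R) (B : vbundle X 2)
    (m : nat) (theta : X -> R[i]) (a : fidx B) p : is_vbundle B -> fdom a p ->
  hat (fun z => theta z * \det (fmx a z)) p ->
  hat (fun z => theta z ^+ 'C(m.+1, 2) * \det (symmx m (fmx a z))) p.
Proof.
move=> vB ap ht; apply: hat_near (hat_exp _ ht).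
apply: filterS (fdom_nbhs vB ap) => z az.
by rewrite exprMn det_symmx // fmx_unit.
Qed.

Theorem proposition3p6 (R : realType)
  (* the compact Riemann surface X and the points of S *)
  (X : riemannSurface R)
  (X_compact : compact [set: X]) (X_connected : connected [set: X])
  (n : nat) (x : 'I_n -> X)
  (n_ge1 : (1 <= n)%N) (x_inj : injective x)
  (n_ge3 : has_genus X 0 -> (3 <= n)%N)
  (* the integers c_i, and r *)
  (c : 'I_n -> nat) (c_gt1 : forall i, (1 < c i)%N)
  (r : nat) (r_ge2 : (2 <= r)%N)
  (* the theta characteristic L and the extension Et of L^* by L of class 1 *)
  (L : vbundle X 1) (L_bundle : is_vbundle L)
  (kappa : X -> 'M[R[i]]_1)
  (kappa_iso : is_iso (twist L L) (canonical_bundle X) setT kappa)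
  (Et : vbundle X 2) (Et_bundle : is_vbundle Et)
  (inc : X -> 'M[R[i]]_(2, 1)) (prj : X -> 'M[R[i]]_(1, 2))
  (inc_hom : is_hom L Et setT inc)
  (prj_hom : is_hom Et (dual_bundle L) setT prj)
  (Et_exact : short_exact inc prj)
  (Et_class : extension_class L kappa Et inc prj 1)
  (theta : X -> R[i]) (theta_pairing : is_det_pairing inc prj theta)
  (* the parabolic Gunning bundle E *)
  (E : vbundle X 2) (E_bundle : is_vbundle E)
  (j : X -> 'M[R[i]]_2) (E_preimage : is_preimage_bundle x Et E prj j)
  (* the covering f : Y -> X with Galois group G *)
  (Y : riemannSurface R)
  (Y_compact : compact [set: Y]) (Y_connected : connected [set: Y])
  (f : Y -> X) (G : finGroupType) (act : G -> Y -> Y)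
  (f_covering : ramified_galois_covering x (fun i => 2 * c i + 1)%N f act)
  (* the orbifold bundle V corresponding to E *)
  (V : vbundle Y 2) (rho : G -> Y -> 'M[R[i]]_2)
  (V_orbifold : orbifold_bundle act V rho)
  (Psi : Y -> 'M[R[i]]_2)
  (V_corresponds :
     par_orb_correspond x (fun i => 2 * c i + 1)%N f act E
       (par_filt x (gunning_parabolic x c E j)) V rho Psi)
  (* the equivariant isomorphism of det V with the trivial bundle, which
     corresponds to the isomorphism of det E *)
  (thetaY : Y -> R[i])
  (thetaY_iso : is_iso (det_bundle V) (trivial_bundle Y) setT
                  (fun y => (thetaY y)%:M))
  (thetaY_equiv : forall g y, thetaY (act g y) * \det (rho g y) = thetaY y)
  (thetaY_theta : forall y, compl_pts x (f y) ->
     thetaY y * \det (Psi y) = theta (f y) * \det (j (f y))) :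
  let P := gunning_parabolic x c E j in
  let thetaE := fun p => theta p * \det (j p) in
  exists Phi : set (operator X r.-1.+1) -> set (operator Y r.-1.+1),
    [/\ set_bij (par_SL_opers x P thetaE)
          (equi_SL_classes act V rho thetaY) Phi,
        forall D, par_SL_connection x P thetaE D ->
          exists2 D', equi_SL_connection act V rho thetaY D' &
            pullback_connection x f (sym_bundle r.-1 E)
              (fun y => symmx r.-1 (Psi y)) D D' &
        forall D D', par_SL_connection x P thetaE D ->
          equi_SL_connection act V rho thetaY D' ->
          pullback_connection x f (sym_bundle r.-1 E)
            (fun y => symmx r.-1 (Psi y)) D D' ->
          Phi (class_of (par_SL_connection x P thetaE) (par_equiv x P) D) =
          class_of (equi_SL_connection act V rho thetaY)
            (equi_equiv act V rho) D'].
Proof.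
move=> P thetaE; case: r r_ge2 => [//|m] m_gt0.
have vV : is_vbundle V by case: V_orbifold.
pose N i := (2 * c i + 1)%N.
have N_gt0 i : (0 < N i)%N by rewrite /N addn1.
have vB : is_vbundle (sym_bundle m E) := sym_vbundle m E_bundle.
have vC : is_vbundle (sym_bundle m V) := sym_vbundle m vV.
have vfE := pullback_vbundle (cov_holo f_covering) E_bundle.
have F_near := @par_filt_near _ X n 2 x P.
have F_sec := @par_filt_sec _ X n 2 x P.
have Phi_hom y : compl_pts x (f y) ->
    homat (pullback f (sym_bundle m E)) (sym_bundle m V) (fun y => symmx m (Psi y)) y.
  by move=> cy; exact (homat_symmx vfE vV (Psi_hom V_corresponds cy)).
have Phi_unit y : compl_pts x (f y) -> symmx m (Psi y) \in unitmx.
  by move=> cy; apply: symmx_unit; exact: (Psi_unit V_corresponds cy).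
have Phi_act g y : compl_pts x (f y) ->
    symmx m (Psi (act g y)) = symmx m (rho g y) *m symmx m (Psi y).
  by move=> cy; rewrite (Psi_act V_corresponds g cy) symmxM.
have rho_iso g : is_iso V (pullback (act g) V) setT (rho g) by case: V_orbifold.
have rho_hom g y : homat (sym_bundle m V) (pullback (act g) (sym_bundle m V))
    (fun y => symmx m (rho g y)) y.
  have [/is_homE H _] := rho_iso g.
  have vgV := pullback_vbundle (act_holo f_covering g) vV.
  exact (homat_symmx vV vgV (H y I)).
have rho_unit g y : symmx m (rho g y) \in unitmx.
  by apply: symmx_unit; have [_] := rho_iso g; exact.
have filtE := gunning_ord x_inj E_bundle f_covering V_corresponds.
have loc := gunning_local x_inj c_gt1 L_bundle Et_bundle E_bundle inc_hom prj_hom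
  Et_exact theta_pairing E_preimage f_covering vV V_corresponds thetaY_iso
  thetaY_theta.
have sfiltE := sym_ord x_inj N_gt0 f_covering E_bundle vV filtE loc m_gt0.
have sloc := sym_local E_bundle vV loc m.
have descend k l (M : X -> 'M[R[i]]_(k, l)) p := @mhat_descend _ _ _ _ _ _ _ _ _
  f_covering _ _ _ _ _ _ E_bundle F_near F_sec V_corresponds k l M p isT.
have tY_hat (a : fidx V) y : setT y -> fdom a y ->
    hat (fun z => thetaY z * \det (fmx a z)) y.
  by move=> _; exact: thetaY_hat.
have thC_hat (a : fidx (sym_bundle m V)) y : setT y -> fdom a y ->
    hat (fun z => thetaY z ^+ 'C(m.+1, 2) * \det (fmx a z)) y.
  by move=> _ ay; exact (det_symmx_hat m vV ay (tY_hat a y I ay)).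
(* [theta] is only given pointwise by the pairing; off S the holomorphy of [theta * \det j] on
   frames of E is obtained from that of [thetaY] by descent. *)
have tE_hat (a : fidx E) p : compl_pts x p -> fdom a p ->
    hat (fun z => thetaE z * \det (fmx a z)) p.
  move=> cp ap; apply: (nbhs_singleton (p := p)).
  apply: (hat_descend f_covering E_bundle F_near F_sec V_corresponds) => //.
  apply: filterS2 (near_compl cp) (near_nbhs (fdom_nbhs E_bundle ap)) => q cq aq y fy.
  have cy : compl_pts x (f y) by rewrite fy.
  have ay : fdom a (f y) by rewrite fy; exact: nbhs_singleton aq.
  have hF : msec E (fmx a) (f y) by have [] := frame_fmx E_bundle ay.
  apply: hat_near (det_msec_hat vV tY_hat I
    (Psi_msec f_covering E_bundle V_corresponds cy hF)).
  apply: filterS (near_covY f_covering cy) => z cz.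
  by rewrite det_mulmx mulrA thetaY_theta.
have thB_hat (a : fidx (sym_bundle m E)) p : compl_pts x p -> fdom a p ->
    hat (fun z => thetaE z ^+ 'C(m.+1, 2) * \det (fmx a z)) p.
  by move=> cp ap; exact (det_symmx_hat m E_bundle ap (tE_hat a p cp ap)).
have th_rel y : compl_pts x (f y) ->
    thetaY y ^+ 'C(m.+1, 2) * \det (symmx m (Psi y)) = thetaE (f y) ^+ 'C(m.+1, 2).
  move=> cy; rewrite det_symmx; last exact: (Psi_unit V_corresponds cy).
  by rewrite -exprMn thetaY_theta.
(* A point of S serves to produce a point of X' close to it and a point of Y above it, at which the
   given connection yields [deriv_holo]. *)
pose i0 : 'I_n := Ordinal n_ge1.
have dh D : is_connection (sym_bundle m E) (compl_pts x) D -> @deriv_holo R.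
  move=> cD; have [p cp px] := near_neq (near_compl_punct x_inj i0).
  exact (conn_deriv_holo vB (open_compl x) (cp px) cD).
have dhY D' : is_connection (sym_bundle m V) setT D' -> @deriv_holo R.
  move=> cD'; have [y _] := cov_surj f_covering (x i0).
  exact (conn_deriv_holo vC openT (p := y) I cD').
have up D : par_SL_connection (r := m.+1) x P thetaE D ->
    exists2 D', equi_SL_connection (r := m.+1) act V rho thetaY D' &
      pullback_connection x f (sym_bundle m E) (fun y => symmx m (Psi y)) D D'.
  move=> [pD dD]; have cD : is_connection (sym_bundle m E) (compl_pts x) D by case: pD.
  have DH := dh D cD.
  have [D' cD' DD] := up_exists x_inj N_gt0 f_covering vB vC Phi_hom Phi_unit
    sfiltE sloc DH cD pD.
  exists D' => //; split.
    split=> //; exact (up_equivariant x_inj f_covering vB vC Phi_hom Phi_unit Phi_act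
      rho_hom rho_unit DH cD' DD).
  exact (up_det x_inj f_covering vB vC Phi_hom Phi_unit thB_hat thC_hat th_rel
    DH cD' DD dD).
have down D' : equi_SL_connection (r := m.+1) act V rho thetaY D' ->
    exists2 D, par_SL_connection (r := m.+1) x P thetaE D &
      pullback_connection x f (sym_bundle m E) (fun y => symmx m (Psi y)) D D'.
  move=> [[cD' eD'] dD']; have DH := dhY D' cD'.
  have cD := down_connection f_covering vB vC Phi_hom Phi_unit Phi_act rho_unit
    descend DH cD' eD'.
  have DD := down_pulls f_covering vB Phi_hom Phi_unit Phi_act rho_unit cD' eD'.
  exists (down_conn f_covering (fun y => symmx m (Psi y)) D') => //; split.
    exact (pulls_parabolic x_inj N_gt0 f_covering vB vC sfiltE DH cD cD' DD).
  exact (down_det f_covering vB vC Phi_hom Phi_unit thB_hat thC_hat th_rel cD cD'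
    DD dD').
have [Phi [Phi_bij PhiE]] := classes_bij up down (fun D1 D2 D1' D2' _ _ Q1 Q2 DD1 DD2 =>
  conj (gauge_lift x_inj N_gt0 f_covering vB vC Phi_hom Phi_unit Phi_act rho_hom
          sfiltE sloc Q1.1.1 Q2.1.1 DD1 DD2)
       (gauge_down x_inj f_covering vB vC Phi_hom Phi_unit Phi_act sfiltE
          descend Q2.1.1 DD1 DD2)).
by exists Phi; split.
Qed.
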